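(* Let $T$ be an $m$-linear Calderón–Zygmund operator on $\mathbb R^n$ with the modulus $\rho$ of continuity of the kernel satisfying $$\int_0^1\rho(t)\log\frac1t\,\frac{dt}{t}<+\infty .$$ Let $v_1,\dots,v_m$ be any weights and let $p_1,\dots,p_m>1$ be any (finite) numbers. Define $p>0$ by $\frac1p=\frac1{p_1}+\dots+\frac1{p_m}$ and put $v=\prod_{i=1}^mv_i^{p/p_i}$, $w_{m+1}=v$, $w_i=v_i^{-1/(p_i-1)}$ ($i=1,\dots,m$). Then $$\|T\|_{L^{p_1}(v_1)\times\dots\times L^{p_m}(v_m)\to L^p(v)}\le C(T,p_i)\,[w_1,\dots,w_{m+1}]_{1/p_1',\dots,1/p_m',1/p}^{\max(p_1',\dots,p_m',p)}$$ $$=C(T,p_i)\Big[\sup_{Q\subset\mathbb R^n,\ Q\text{ is a cube}}v_Q^{1/p}\prod_{i=1}^m\big(v_i^{-p_i'/p_i}\big)_Q^{1/p_i'}\Big]^{\max(p_1',\dots,p_m',p)},$$ where the constant $C(T,p_i)$ depends only on $T$ and $p_1,\dots,p_m$.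
   Context: A cube in $\mathbb R^n$ is a half-open cube $[x_1,x_1+\ell)\times\dots\times[x_n,x_n+\ell)$, $\ell>0$; $\ell_Q$ denotes the sidelength of $Q$, $c(Q)$ its center, $Q_{[t]}=c(Q)+t(Q-c(Q))$ for $t>0$, and $f_Q=(f)_Q=\frac1{|Q|}\int_Qf$. A weight is a function $0<v\in L^1_{\mathrm{loc}}(\mathbb R^n)$; $\|f\|_{L^q(v)}=(\int_{\mathbb R^n}|f|^qv)^{1/q}$ for $0<q<\infty$; $p_i'=\frac{p_i}{p_i-1}$. For positive functions $w_1,\dots,w_k$ and exponents $q_1,\dots,q_k>0$, the joint Muckenhoupt quantity is $$[w_1,\dots,w_k]_{q_1,\dots,q_k}=\sup_{Q\subset\mathbb R^n,\ Q\text{ is a cube}}\ \prod_{i=1}^k(w_i)_Q^{q_i}$$ (which may be $+\infty$, in which case the claimed bound says nothing). $L^\infty_0$ denotes the space of bounded measurable functions on $\mathbb R^n$ with compact support. The norm $\|T\|_{L^{p_1}(v_1)\times\dots\times L^{p_m}(v_m)\to L^p(v)}$ is understood as the smallest constant $A$ such that $\|T[f_1,\dots,f_m]\|_{L^p(v)}\le A\prod_{i=1}^m\|f_i\|_{L^{p_i}(v_i)}$ for all $f_1,\dots,f_m\in L^\infty_0$. An $m$-linear Calderón–Zygmund operator ($m\ge1$) is an $m$-linear operator $T$ taking $m$ functions $f_1,\dots,f_m\in L^1(\mathbb R^n)$ to an almost everywhere finite measurable function, associated with a measurable kernel $K(x,y_1,\dots,y_m)$, $x,y_i\in\mathbb R^n$,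 which may be singular only when $y_1=\dots=y_m=x$, in the sense that $$T[f_1,\dots,f_m](x)=\int_{(\mathbb R^n)^m}K(x,y_1,\dots,y_m)f_1(y_1)\cdots f_m(y_m)\,dy_1\cdots dy_m$$ whenever the integral makes sense (in particular, for almost every $x$ outside the intersection of the closed supports of the $f_i$). The following are required, for some constant $C$ and some modulus of continuity $\rho:[0,+\infty)\to[0,+\infty)$ (a continuous, increasing and subadditive function with $\rho(0)=0$): (i) $|K(x,y_1,\dots,y_m)|\le\dfrac{C}{(\max_i|x-y_i|)^{nm}}$; (ii) $|K(x',y_1,\dots,y_m)-K(x'',y_1,\dots,y_m)|\le\dfrac{C}{(t\ell_Q)^{mn}}\rho(t^{-1})$ whenever $Q$ is a cube, $x',x''\in Q$, $t\ge2$, and there exists $i$ such that $y_i\notin Q_{[t]}$; (iii) the weak type bound: for some constant $C$ and all $\alpha>0$, $f_i\in L^1(\mathbb R^n)$, $$|\{x\in\mathbb R^n:|T[f_1,\dots,f_m](x)|>\alpha\}|\le C\Big(\frac1\alpha\prod_{i=1}^m\|f_i\|_{L^1}\Big)^{1/m}.$$ *)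

(* Defs.v *)
From HB Require Import structures.
From mathcomp Require Import all_boot all_order all_algebra.
From mathcomp Require Import all_classical all_reals all_analysis.
Set Implicit Arguments.
Unset Strict Implicit.
Unset Printing Implicit Defensive.
Import Order.TTheory GRing.Theory Num.Theory.
Import numFieldNormedType.Exports.
Local Open Scope classical_set_scope.
Local Open Scope ring_scope.

(* The sigma-algebra on R^n generated by the coordinate functions, i.e. the
   Borel sets (every Lebesgue measurable function is a.e. equal to a Borel
   measurable one). *)
Section measurable_rV.
Context (R : realType) (n : nat).

Let coord (i : 'I_n) (x : 'rV[R]_n) : R := x ord0 i.

Let rV_set0 : g_sigma_preimage coord set0.
Proof. exact: sigma_algebra0. Qed.

Let rV_setC A : g_sigma_preimage coord A -> g_sigma_preimage coord (~` A).
Proof. exact: sigma_algebraC. Qed.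

Let rV_bigcup (F : _^nat) : (forall i, g_sigma_preimage coord (F i)) ->
  g_sigma_preimage coord (\bigcup_i (F i)).
Proof. exact: sigma_algebra_bigcup. Qed.

HB.instance Definition _ :=
  @isMeasurable.Build (measure_tuple_display default_measure_display)
  'rV[R]_n (g_sigma_preimage coord) rV_set0 rV_setC rV_bigcup.

Lemma measurable_coord (i : 'I_n) :
  measurable_fun [set: 'rV[R]_n] (fun x : 'rV[R]_n => x ord0 i).
Proof.
move=> _ Y mY; rewrite setTI; apply: sub_sigma_algebra => /=.
rewrite -bigcup_seq/=; exists i => /=; first by rewrite mem_index_enum.
by exists Y => //; rewrite setTI.
Qed.

Lemma measurable_fun_rV d (T : measurableType d) (f : T -> 'rV[R]_n) :
  (forall i, measurable_fun [set: T] (fun t => f t ord0 i)) ->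
  measurable_fun [set: T] f.
Proof.
move=> mf.
apply: (measurability (\big[setU/set0]_(i < n)
  preimage_set_system setT (coord i) measurable)).
  by [].
move=> _ [B + <-]; rewrite -bigcup_seq => -[i _ [C mC <-]].
by rewrite setTI; apply: mf.
Qed.

End measurable_rV.

Lemma product_sigma_finite d1 d2 (T1 : measurableType d1)
    (T2 : measurableType d2) (R : realType)
    (m1 : {sigma_finite_measure set T1 -> \bar R})
    (m2 : {sigma_finite_measure set T2 -> \bar R}) :
  sigma_finite setT (m1 \x m2)%E.
Proof.
have /sigma_finiteP[F [TF ndF Foo]] := sigma_finiteT m1.
have /sigma_finiteP[G [TG ndG Goo]] := sigma_finiteT m2.
exists (fun n => F n `*` G n).
  rewrite -setXTT TF TG predeqE => -[x y]; split.
    move=> [/= [n _ Fnx] [k _ Gky]]; exists (maxn n k) => //; split.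
    - by move: x Fnx; exact/subsetPset/ndF/leq_maxl.
    - by move: y Gky; exact/subsetPset/ndG/leq_maxr.
  by move=> [n _ []/= ? ?]; split; exists n.
move=> k; have [? ?] := Foo k; have [? ?] := Goo k.
split; first exact: measurableX.
by rewrite product_measure1E// lte_mul_pinfty// ge0_fin_numE.
Qed.

Section pushforward_iso.
Context d1 d2 (T1 : measurableType d1) (T2 : measurableType d2) (R : realType).
Variables (mu : {measure set T1 -> \bar R}) (f : T1 -> T2) (g : T2 -> T1).
Hypothesis mu_sigma_finite : sigma_finite setT mu.
Hypotheses (mf : measurable_fun [set: T1] f) (mg : measurable_fun [set: T2] g).
Hypothesis fK : cancel f g.

(* Plain push-forward; the proofs are arguments only so that the instances below
   can use them. *)
Definition pushforward_iso of sigma_finite setT mu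
    & measurable_fun [set: T1] f & measurable_fun [set: T2] g
    & cancel f g : set T2 -> \bar R :=
  pushforward mu f.

Local Notation m := (pushforward_iso mu_sigma_finite mf mg fK).

Let m0 : m set0 = 0%E.
Proof. by rewrite /pushforward_iso /pushforward preimage_set0 measure0. Qed.

Let m_ge0 A : (0 <= m A)%E.
Proof. exact: measure_ge0. Qed.

Let m_sigma_additive : semi_sigma_additive m.
Proof.
move=> F mF tF mUF; rewrite /pushforward_iso /pushforward preimage_bigcup.
have mpre A : measurable A -> measurable (f @^-1` A).
  by move=> mA; rewrite -[X in measurable X]setTI; exact: mf.
apply: measure_semi_sigma_additive.
- by move=> n; exact: mpre.
- apply/trivIsetP => /= i j _ _ ij; rewrite -preimage_setI.
  by move/trivIsetP : tF => /(_ _ _ _ _ ij) ->//; rewrite preimage_set0.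
- by rewrite -preimage_bigcup; exact: mpre.
Qed.

HB.instance Definition _ := isMeasure.Build _ _ _ m m0 m_ge0 m_sigma_additive.

Let m_sigma_finite : sigma_finite setT m.
Proof.
have [F TF Ffin] := mu_sigma_finite.
exists (fun k => g @^-1` F k).
  by rewrite -preimage_bigcup -TF preimage_setT.
move=> k; have [mF Fk] := Ffin k; split.
  by rewrite -[X in measurable X]setTI; exact: mg.
rewrite /pushforward_iso /pushforward -comp_preimage.
by rewrite (_ : g \o f = id) //; apply/funext => x /=; exact: fK.
Qed.

HB.instance Definition _ := Measure_isSigmaFinite.Build _ _ _ m m_sigma_finite.

End pushforward_iso.

Section power_measure.
Context d (T : measurableType d) (R : realType).
Variable mu : {sigma_finite_measure set T -> \bar R}.

Definition tuple_cons n (x : T * n.-tuple T) : n.+1.-tuple T :=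
  [tuple of x.1 :: x.2].

Definition tuple_uncons n (t : n.+1.-tuple T) : T * n.-tuple T :=
  (thead t, [tuple of behead t]).

Lemma tuple_consK n : cancel (@tuple_cons n) (@tuple_uncons n).
Proof.
case=> x t; rewrite /tuple_cons /tuple_uncons theadE; congr (_, _).
exact: val_inj.
Qed.

Lemma measurable_tuple_cons n : measurable_fun setT (@tuple_cons n).
Proof. exact: (measurable_cons measurable_fst measurable_snd). Qed.

Lemma measurable_tuple_uncons n : measurable_fun setT (@tuple_uncons n).
Proof.
apply: measurable_fun_pair; last exact: measurable_behead.
exact: measurable_tnth.
Qed.

Fixpoint power_measure n : {sigma_finite_measure set (n.-tuple T) -> \bar R} :=
  match n with
  | 0 => \d_ ([tuple] : 0.-tuple T)
  | k.+1 => pushforward_iso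
      (product_sigma_finite mu (power_measure k))
      (@measurable_tuple_cons k) (@measurable_tuple_uncons k) (@tuple_consK k)
  end.

Lemma power_measureE n (A : 'I_n -> set T) : (forall i, measurable (A i)) ->
  power_measure n [set t | forall i, A i (tnth t i)] = (\prod_(i < n) mu (A i))%E.
Proof.
elim: n A => [|n IH] A mA.
  rewrite big_ord0 /= diracE mem_set//= => -[].
  by [].
rewrite big_ord_recl -IH; last by move=> i; exact: mA.
rewrite /= /pushforward_iso /pushforward -product_measure1E//.
  congr (product_measure1 _ _ _); apply/seteqP; split=> [[x t] H|[x t] [Hx Ht] i].
    split=> [|i]; first by have := H ord0.
    by have := H (lift ord0 i); rewrite tnthS.
  case: (unliftP ord0 i) => [j|] -> ; last by [].
  by rewrite tnthS; exact: Ht.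
rewrite (_ : mkset _ = \bigcap_(i in [set: 'I_n])
    ((fun t => tnth t i) @^-1` A (lift ord0 i))); last first.
  by apply/seteqP; split=> [t H i _|t H i]; exact: H.
apply: fin_bigcap_measurable => // i _.
by rewrite -[X in measurable X]setTI; exact: measurable_tnth.
Qed.

End power_measure.

Section lebesgue_rV.
Context (R : realType) (n : nat).

Definition rV_of_tuple (t : n.-tuple (measurableTypeR R)) : 'rV[R]_n :=
  \row_i tnth t i.

Definition tuple_of_rV (x : 'rV[R]_n) : n.-tuple (measurableTypeR R) :=
  [tuple x ord0 i | i < n].

Lemma rV_of_tupleK : cancel rV_of_tuple tuple_of_rV.
Proof. by move=> t; apply: eq_from_tnth => i; rewrite tnth_mktuple mxE. Qed.

Lemma measurable_rV_of_tuple : measurable_fun setT rV_of_tuple.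
Proof.
apply: measurable_fun_rV => i.
rewrite (_ : (fun _ => _) = fun t : n.-tuple (measurableTypeR R) => tnth t i).
  exact: measurable_tnth.
by apply/funext => t; rewrite mxE.
Qed.

Lemma measurable_tuple_of_rV : measurable_fun setT tuple_of_rV.
Proof.
apply/measurable_fun_tnthP => i.
rewrite (_ : _ \o _ = fun x : 'rV[R]_n => x ord0 i); first exact: measurable_coord.
by apply/funext => x /=; rewrite tnth_mktuple.
Qed.

Definition lebesgue_rV : {sigma_finite_measure set 'rV[R]_n -> \bar R} :=
  pushforward_iso (sigma_finiteT (power_measure (@lebesgue_measure R) n))
    measurable_rV_of_tuple measurable_tuple_of_rV rV_of_tupleK.

End lebesgue_rV.

Arguments lebesgue_rV : clear implicits.

Section cubes.
Context (R : realType) (n : nat).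
Local Notation Rn := 'rV[R]_n.
Local Notation mu := (lebesgue_rV R n).

(* A cube is given by its lower corner x and its sidelength l (> 0). *)
Definition cube (x : Rn) (l : R) : set Rn :=
  [set z | forall i, x ord0 i <= z ord0 i < x ord0 i + l].

Definition cube_center (x : Rn) (l : R) : Rn := x + const_mx (l / 2).

Definition cube_dilate (x : Rn) (l t : R) : set Rn :=
  [set cube_center x l + t *: (z - cube_center x l) | z in cube x l].

Lemma lebesgue_rV_cube (x : Rn) (l : R) : 0 < l -> mu (cube x l) = (l ^+ n)%:E.
Proof.
move=> l0.
rewrite /lebesgue_rV /= /pushforward_iso /pushforward.
rewrite (_ : _ @^-1` _ = [set t : n.-tuple (measurableTypeR R) |
    forall i, `[x ord0 i, x ord0 i + l[%classic (tnth t i)]); last first.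
  apply/seteqP; split=> t /= H i; have := H i;
    by rewrite /= ?mxE ?in_itv.
have mA i : measurable (`[x ord0 i, x ord0 i + l[%classic :
    set (measurableTypeR R)) by exact: measurable_itv.
apply: (etrans (power_measureE (@lebesgue_measure R) mA)).
transitivity (\prod_(i < n) l%:E)%E.
  apply: eq_bigr => i _.
  transitivity (lebesgue_measure `[x ord0 i, x ord0 i + l[%classic); first by [].
  by rewrite lebesgue_measure_itv/= lte_fin ltrDl l0 -EFinB addrAC subrr add0r.
by rewrite prodEFin big_const_ord iter_mulr_1.
Qed.

(* The mean f_Q; it may be +oo for nonnegative f. *)
Definition mean (f : Rn -> R) (Q : set Rn) : \bar R :=
  ((fine (mu Q))^-1%:E * \int[mu]_(z in Q) (f z)%:E)%E.

Definition joint_Muckenhoupt k (w : 'I_k -> Rn -> R) (q : 'I_k -> R) : \bar R :=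
  ereal_sup [set (\prod_(i < k) (mean (w i) (cube c.1 c.2)) `^ (q i))%E
            | c in [set c : Rn * R | 0 < c.2]].

Definition weight (v : Rn -> R) : Prop :=
  [/\ measurable_fun [set: Rn] v, forall x, 0 < v x &
      forall K : set Rn, compact K -> (\int[mu]_(x in K) (v x)%:E < +oo)%E].

(* The (quasi)norm of L^q(v), 0 < q < oo. *)
Definition weighted_norm (q : R) (v f : Rn -> R) : \bar R :=
  ((\int[mu]_x (`|f x| `^ q * v x)%:E) `^ q^-1)%E.

Definition Linfty0 (f : Rn -> R) : Prop :=
  [/\ measurable_fun [set: Rn] f, exists M : R, forall x, `|f x| <= M &
      compact (closure [set x | f x != 0])].

Definition L1 (f : Rn -> R) : Prop := mu.-integrable [set: Rn] (EFin \o f).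

Definition euclidean_norm (x : Rn) : R := Num.sqrt (\sum_(i < n) x ord0 i ^+ 2).

End cubes.

Definition conjugate_exponent (R : realType) (p : R) : R := p / (p - 1).

Definition modulus_of_continuity (R : realType) (rho : R -> R) : Prop :=
  [/\ {within `[0, +oo[, continuous rho},
      {in `[0, +oo[ &, {homo rho : s t / s <= t}},
      {in `[0, +oo[ &, forall s t, rho (s + t) <= rho s + rho t} &
      rho 0 = 0].

Section Calderon_Zygmund.
Context (R : realType) (n m : nat).
Local Notation Rn := 'rV[R]_n.
Local Notation mu := (lebesgue_rV R n).
Implicit Types (T : ('I_m -> Rn -> R) -> Rn -> R) (K : Rn -> m.-tuple Rn -> R).

(* Elements of L^1 and values of T are functions modulo a.e. equality. *)
Definition multilinear T : Prop :=
  [/\ forall f, (forall i, L1 (f i)) -> measurable_fun [set: Rn] (T f),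
      forall f g, (forall i, L1 (f i)) -> (forall i, L1 (g i)) ->
        (forall i, {ae mu, forall x, f i x = g i x}) ->
        {ae mu, forall x, T f x = T g x} &
      forall f i (g h : Rn -> R) (a : R),
        (forall j, L1 (f j)) -> L1 g -> L1 h ->
        {ae mu, forall x, T (dfwith f i (fun z => a * g z + h z)) x =
                          a * T (dfwith f i g) x + T (dfwith f i h) x}].

Definition associated_kernel T K : Prop :=
  forall f, (forall i, L1 (f i)) ->
  {ae mu, forall x,
    let F := fun y : m.-tuple Rn => K x y * \prod_(i < m) f i (tnth y i) in
    (power_measure mu m).-integrable [set: m.-tuple Rn] (EFin \o F) ->
    (T f x)%:E = (\int[power_measure mu m]_y (F y)%:E)%E}.

(* On the diagonal y_1 = ... = y_m = x the kernel may be singular, so that its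
   values there are irrelevant. *)
Definition kernel_size K (C : R) : Prop :=
  forall (x : Rn) (y : m.-tuple Rn), (exists i, tnth y i != x) ->
  `|K x y| <=
    C / (\big[Num.max/0]_(i < m) euclidean_norm (x - tnth y i)) ^+ (n * m).

Definition kernel_regularity K (rho : R -> R) (C : R) : Prop :=
  forall (q : Rn) (l : R) (x' x'' : Rn) (t : R) (y : m.-tuple Rn),
  0 < l -> cube q l x' -> cube q l x'' -> 2 <= t ->
  (exists i, ~ cube_dilate q l t (tnth y i)) ->
  `|K x' y - K x'' y| <= C / (t * l) ^+ (m * n) * rho t^-1.

Definition weak_type_bound T (C : R) : Prop :=
  forall (alpha : R) f, 0 < alpha -> (forall i, L1 (f i)) ->
  (mu [set x | (alpha < `|T f x|)%R] <=
    C%:E * (alpha^-1%:E * \prod_(i < m) \int[mu]_x `|f i x|%:E) `^ m%:R^-1)%E.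

Definition Calderon_Zygmund T (rho : R -> R) : Prop :=
  [/\ multilinear T, modulus_of_continuity rho,
      exists K, [/\ measurable_fun [set: Rn * m.-tuple Rn]
                      (fun z : Rn * m.-tuple Rn => K z.1 z.2),
                    associated_kernel T K &
                    exists C, kernel_size K C /\ kernel_regularity K rho C] &
      exists C, weak_type_bound T C].

(* The norm of T from L^{p_1}(v_1) x ... x L^{p_m}(v_m) to L^p(v); +oo when
   there is no admissible constant. *)
Definition operator_norm T (ps : 'I_m -> R) (vs : 'I_m -> Rn -> R)
    (p : R) (v : Rn -> R) : \bar R :=
  ereal_inf [set A%:E | A in [set A : R | 0 <= A /\
    forall f, (forall i, Linfty0 (f i)) ->
      (weighted_norm p v (T f) <=
        A%:E * \prod_(i < m) weighted_norm (ps i) (vs i) (f i))%E]].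

End Calderon_Zygmund.

Definition product_weight (R : realType) n m (ps : 'I_m -> R)
    (vs : 'I_m -> 'rV[R]_n -> R) (p : R) : 'rV[R]_n -> R :=
  fun x => \prod_(i < m) vs i x `^ (p / ps i).

(* The family (a_1, ..., a_m, b). *)
Definition extend A m (a : 'I_m -> A) (b : A) : 'I_m.+1 -> A :=
  fun i => if unlift ord_max i is Some j then a j else b.

(* Main.v *)
Require Import Defs.
From HB Require Import structures.
From mathcomp Require Import all_boot all_order all_algebra.
From mathcomp Require Import all_classical all_reals all_analysis.
From mathcomp Require Import measurable_realfun ring lra zify.
Set Implicit Arguments.
Unset Strict Implicit.
Unset Printing Implicit Defensive.
Import Order.TTheory GRing.Theory Num.Theory.
Import numFieldNormedType.Exports.
Local Open Scope classical_set_scope.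
Local Open Scope ring_scope.

(* Sparse domination. Fix a dyadic lattice. A cube P inside Q is bad for Q if the
   mean of some |f_i| over 3P is much larger than over 3Q, or if the set where
   T[f_1 1_3Q, ..., f_m 1_3Q] is large occupies a substantial part of P; by the weak
   type bounds the maximal bad cubes, the children of Q, fill at most half of Q.
   When the kernel sum over k of rho(2^-k) converges (this is what the Dini condition
   is used for), passing from Q to a child changes the localized operator by at most
   a multiple of the product of the means over 3Q, up to its value on the child.
   Iterating from a cube Q0 bounds |T f| almost everywhere on Q0 by a sum of products
   of means over 3Q, where Q runs over cubes with disjoint cores filling at least half
   of each.

   For such a sum the joint Muckenhoupt bound is applied cube by cube, raised to the
   power e = max(p_1', ..., p_m', p) (times p if p <= 1); the surplus powers of the
   weights over 3Q are traded for the same powers over the core of Q. What remains is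
   a sum over the cores to which Hoelder's inequality and a Carleson embedding for the
   weighted dyadic maximal functions apply; for p > 1 the sum to the power p is
   estimated by pairing it with its own power p - 1. *)

(** * Inequalities for finite products and powers *)

(** The exponents are dictated by the identity that the product of the w_k^(q_k) is 1, where k runs
    over the m dual weights and v. Through Hoelder's inequality it bounds the volume of a core by
    the masses of the weights on that core, so leftover powers of the volume can be turned into
    powers of these masses. The value of e is what makes [1 <= e * q k] hold for every k: once G^e
    is split off, each weight over 3Q keeps a nonpositive power, and such a power only grows when 3Q
    shrinks to the core.

    Triples appear because kernel regularity needs some y_i outside a dilate of the cube. They are
    not nested like the cubes, so they are sorted into 3^n classes that are. Values of [T] make
    sense only almost everywhere; this is why badness is measured by the density of an exceptional
    set, and why the operators of a cube and a child are compared at a point chosen outside a set of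
    small measure.

    For p > 1 the estimated integral J reappears on the right as J^(1 - 1/p) and is divided out.
    This is possible because finite subfamilies are treated first, with constants independent of
    their number. *)

Section product_inequalities.
Context (R : realType) (I : finType).
Implicit Types (x y th : I -> R).

Lemma powR_prod_seq (J : Type) (s : seq J) (P : pred J) (x : J -> R) (r : R) :
  (forall i, 0 <= x i) ->
  (\prod_(i <- s | P i) x i) `^ r = \prod_(i <- s | P i) x i `^ r.
Proof.
move=> x0; elim: s => [|a s IH]; first by rewrite !big_nil powR1.
by rewrite !big_cons; case: ifP => // _; rewrite powRM ?IH ?prodr_ge0.
Qed.

Lemma powR_sum (a : R) (c : I -> R) : 0 < a ->
  a `^ (\sum_i c i) = \prod_i a `^ (c i).
Proof.
move=> a0; elim/big_rec2 : _ => [|i u v _ <-]; first by rewrite powRr0.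
by rewrite powRD// (gt_eqF a0) implybT.
Qed.

(** The tangent inequality [ln u <= u - 1] at [u = x i / S], with [S] the weighted mean: the terms
    [th i * (1 - x i / S)] add up to 0. A vanishing factor is treated apart, since [ln] needs
    positive arguments. *)
Lemma weighted_AM_GM th x : (forall i, 0 < th i) -> \sum_i th i = 1 ->
  (forall i, 0 <= x i) -> \prod_i x i `^ th i <= \sum_i th i * x i.
Proof.
move=> th0 th1 x0.
have S0 : 0 <= \sum_i th i * x i.
  by apply: sumr_ge0 => i _; rewrite mulr_ge0// ltW.
have [/existsP[i /eqP xi0]|/existsPn xn0] := boolP [exists i, x i == 0].
  by rewrite (bigD1 i)//= xi0 powR0 ?gt_eqF// mul0r.
have xgt0 i : 0 < x i by rewrite lt_def x0 xn0.
set S := \sum_i th i * x i in S0 *.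
have Sgt0 : 0 < S.
  have [i _] : exists i : I, true.
    apply: contrapT => /forallNP noI; move: th1; rewrite big1 => [/eqP|i _].
      by rewrite eq_sym oner_eq0.
    by have := noI i.
  rewrite /S (bigD1 i)//= ltr_pwDl ?mulr_gt0//.
  by apply: sumr_ge0 => j _; rewrite mulr_ge0// ltW.
have -> : S = \prod_i S `^ th i by rewrite -powR_sum// th1 powRr1// ltW.
rewrite -ler_ln ?posrE ?prodr_gt0//; try by move=> i _; rewrite powR_gt0.
have lnprod (y : I -> R) : (forall i, 0 < y i) ->
    ln (\prod_i y i `^ th i) = \sum_i th i * ln (y i).
  move=> y0.
  have : 0 < \prod_i y i `^ th i /\ ln (\prod_i y i `^ th i) = \sum_i th i * ln (y i).
    elim/big_rec2 : _ => [|i a b _ [b0 <-]]; first by rewrite ltr01 ln1.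
    by split; rewrite ?mulr_gt0 ?powR_gt0// lnM ?posrE ?powR_gt0// ln_powR.
  by case.
rewrite !lnprod//.
rewrite -subr_ge0 -sumrB.
have : \sum_i th i * (1 - x i / S) = 0.
  rewrite -[LHS](@mulfK _ S) ?gt_eqF// mulr_suml.
  rewrite (eq_bigr (fun i => th i * S - th i * x i)); last first.
    by move=> i _; field; rewrite gt_eqF.
  by rewrite sumrB -mulr_suml th1 mul1r subrr mul0r.
move=> H; rewrite -[leLHS]H; apply: ler_sum => i _.
rewrite -mulrBr; apply: ler_wpM2l; first exact: ltW.
have xS : 0 < x i / S by rewrite divr_gt0.
have : ln (x i / S) <= x i / S - 1.
  have := expR_ge1Dx (ln (x i / S)); rewrite lnK ?posrE//; lra.
have -> : ln (x i / S) = ln (x i) - ln S by rewrite ln_div ?posrE.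
lra.
Qed.

(** Normalizing each family by its sum [S i] reduces this to [weighted_AM_GM] term by term; if some
    [S i] is 0, every product on the left has a zero factor. *)
Lemma holder_sum (J : Type) (s : seq J) th (x : I -> J -> R) :
  (forall i, 0 < th i) -> \sum_i th i = 1 -> (forall i j, 0 <= x i j) ->
  \sum_(j <- s) \prod_i x i j `^ th i <= \prod_i (\sum_(j <- s) x i j) `^ th i.
Proof.
move=> th0 th1 x0.
set S := fun i => \sum_(j <- s) x i j.
have S0 i : 0 <= S i by apply: sumr_ge0.
have [/existsP[i /eqP Si0]|/existsPn Sn0] := boolP [exists i, S i == 0].
  rewrite [leRHS](bigD1 i)//= -/(S i) Si0 powR0 ?gt_eqF// mul0r.
  have : \sum_(j <- s) \prod_i0 x i0 j `^ th i0 = 0.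
    move: Si0; rewrite /S; elim: s {S S0} => [|j s IH]; first by rewrite !big_nil.
    rewrite !big_cons => /eqP; rewrite paddr_eq0//; last exact: sumr_ge0.
    by move=> /andP[/eqP xij0 /eqP/IH ->]; rewrite (bigD1 i)//= xij0
      powR0 ?gt_eqF// mul0r addr0.
  by move=> ->.
have Sgt0 i : 0 < S i by rewrite lt_def S0 Sn0.
have P0 : 0 < \prod_i S i `^ th i by rewrite prodr_gt0// => i _; rewrite powR_gt0.
rewrite -[leRHS]mulr1 -ler_pdivrMl//.
apply: (@le_trans _ _ (\sum_(j <- s) \sum_i th i * (x i j / S i))).
  rewrite mulr_sumr; apply: ler_sum => j _.
  rewrite -prodfV -big_split/=.
  apply: le_trans (weighted_AM_GM th0 th1 _); last first.
    by move=> i; rewrite divr_ge0.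
  apply: ler_prod => i _; rewrite mulr_ge0 ?invr_ge0 ?powR_ge0//=.
  by rewrite powRM ?invr_ge0// -(powR_inv1 (ltW (Sgt0 i))) -powRrM mulN1r powRN mulrC.
rewrite exchange_big/= -th1 le_eqVlt; apply/orP; left; apply/eqP.
apply: eq_bigr => i _.
by rewrite -mulr_sumr -mulr_suml -/(S i) divff ?mulr1// gt_eqF.
Qed.

(* [W], [E] stand for the weights of a cube and of its core, [V], [e] for their
   volumes; since [a <= s q], the powers [a - s q] of [W] increase when [W] is
   replaced by [E]. *)
Lemma joint_weight_term (m s G V e c : R) (q a W E : I -> R) :
  0 < m -> (forall i, 0 < q i) -> \sum_i q i = m ->
  (forall i, a i <= s * q i) -> 0 <= s -> \sum_i a i <= 1 + s * m ->
  0 < V -> 0 <= c -> 0 <= e -> V <= c * e ->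
  (forall i, 0 < E i) -> (forall i, E i <= W i) ->
  e <= \prod_i E i `^ (q i / m) -> \prod_i (W i / V) `^ q i <= G ->
  V * \prod_i (W i / V) `^ a i <=
    c `^ (1 + s * m - \sum_i a i) * G `^ s *
    \prod_i E i `^ (a i + q i * (1 - \sum_i a i) / m).
Proof.
move=> m0 q0 qm aq s0 sm V0 c0 e0 Ve E0 EW eE WG.
have W0 i : 0 < W i := lt_le_trans (E0 i) (EW i).
set k := 1 + s * m - \sum_i a i.
have k0 : 0 <= k by rewrite subr_ge0.
have WV0 i : 0 < W i / V by rewrite divr_gt0.
have EV0 i : 0 < E i / V by rewrite divr_gt0.
have G0 : 0 <= G.
  by apply: le_trans WG; apply: prodr_ge0 => i _; rewrite powR_ge0.
have -> : \prod_i (W i / V) `^ a i =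
    (\prod_i (W i / V) `^ q i) `^ s * \prod_i (W i / V) `^ (a i - s * q i).
  rewrite powR_prod_seq; last by move=> i; rewrite powR_ge0.
  rewrite -big_split; apply: eq_bigr => i _ /=.
  by rewrite -powRrM -powRD ?(gt_eqF (WV0 i)) ?implybT//; congr powR; ring.
apply: (@le_trans _ _ (V * (G `^ s * \prod_i (E i / V) `^ (a i - s * q i)))).
  rewrite ler_wpM2l ?(ltW V0)//.
  apply: ler_pM; rewrite ?powR_ge0//; first by apply: prodr_ge0 => i _; rewrite powR_ge0.
    apply: ge0_ler_powR => //; rewrite nnegrE//.
    by apply: prodr_ge0 => i _; rewrite powR_ge0.
  apply: ler_prod => i _; rewrite powR_ge0/=.
  have -> : a i - s * q i = - (s * q i - a i) by rewrite opprB.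
  rewrite !powRN lef_pV2 ?posrE ?powR_gt0//.
  apply: ge0_ler_powR; rewrite ?nnegrE ?subr_ge0//; try exact: ltW.
  by rewrite ler_pM2r ?invr_gt0.
(* The powers of [V] collect into V^k because the [q i] sum to [m]. As k is nonnegative, [V] may
   then be replaced by an upper bound. *)
have -> : V * (G `^ s * \prod_i (E i / V) `^ (a i - s * q i)) =
    G `^ s * \prod_i E i `^ (a i - s * q i) * V `^ k.
  have -> : V `^ k = V * \prod_i (V^-1) `^ (a i - s * q i).
    have Vi : 0 < V^-1 by rewrite invr_gt0.
    rewrite -powR_sum// sumrB -mulr_sumr qm.
    rewrite -(powR_inv1 (ltW V0)) -powRrM -[X in X * _](powRr1 (ltW V0)).
    by rewrite -powRD ?(gt_eqF V0) ?implybT//; congr powR; rewrite /k; ring.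
  have -> : \prod_i (E i / V) `^ (a i - s * q i) =
      \prod_i E i `^ (a i - s * q i) * \prod_i (V^-1) `^ (a i - s * q i).
    rewrite -big_split; apply: eq_bigr => i _ /=.
    by rewrite powRM ?invr_ge0 ?ltW.
  by ring.
(* Both bounds on volumes are used here: [V <= c * e], and [e] is at most the geometric mean of the
   [E i] with exponents [q i / m]. *)
have Vk : V `^ k <= c `^ k * \prod_i E i `^ (q i * k / m).
  apply: (@le_trans _ _ ((c * e) `^ k)).
    by apply: ge0_ler_powR; rewrite ?nnegrE ?mulr_ge0// ltW.
  rewrite powRM// ler_wpM2l ?powR_ge0//.
  apply: (@le_trans _ _ ((\prod_i E i `^ (q i / m)) `^ k)).
    apply: ge0_ler_powR; rewrite ?nnegrE ?mulr_ge0//.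
    by apply: prodr_ge0 => i _; rewrite powR_ge0.
  rewrite powR_prod_seq; last by move=> i; rewrite powR_ge0.
  rewrite le_eqVlt; apply/orP; left; apply/eqP; apply: eq_bigr => i _.
  by rewrite -powRrM mulrAC.
apply: le_trans (ler_wpM2l _ Vk) _.
  by rewrite mulr_ge0 ?powR_ge0//; apply: prodr_ge0 => i _; rewrite powR_ge0.
rewrite le_eqVlt; apply/orP; left; apply/eqP.
have -> : \prod_i E i `^ (a i + q i * (1 - \sum_i a i) / m) =
    \prod_i E i `^ (a i - s * q i) * \prod_i E i `^ (q i * k / m).
  rewrite -big_split; apply: eq_bigr => i _ /=.
  rewrite -powRD ?(gt_eqF (E0 i)) ?implybT//; congr powR; rewrite /k; field.
  by rewrite gt_eqF.
by ring.
Qed.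

End product_inequalities.

Section power_inequalities.
Context {R : realType}.

(** Young's inequality for the product of a and b^(q - 1), rearranged. It is the discrete form of
    d(t^q) = q/(q - 1) t d(t^(q - 1)), applied when a running maximum rises from [b] to [a]. *)
Lemma powR_increment_le (q a b : R) : 1 < q -> 0 <= b -> b <= a ->
  a `^ q - b `^ q <= q / (q - 1) * a * (a `^ (q - 1) - b `^ (q - 1)).
Proof.
move=> q1 b0 ba; have a0 : 0 <= a := le_trans b0 ba.
have q0 : 0 < q by lra.
have qm0 : 0 < q - 1 by lra.
have := @conjugate_powR R a (b `^ (q - 1)) q (q / (q - 1)) a0 (powR_ge0 _ _) q0.
rewrite -powRrM mulrCA divff ?gt_eqF// mulr1 => /(_ (divr_gt0 q0 qm0)).
have -> : q^-1 + (q / (q - 1))^-1 = 1 by field; rewrite !gt_eqF.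
move=> /(_ erefl).
have <- : a * a `^ (q - 1) = a `^ q by rewrite mulr_powRB1.
set A := a `^ (q - 1); set B := b `^ (q - 1); set D := b `^ q.
rewrite -(ler_pM2l (divr_gt0 q0 qm0)).
have -> : q / (q - 1) * (a * A / q + D / (q / (q - 1))) = a * A / (q - 1) + D.
  by field; rewrite !gt_eqF.
have -> : q / (q - 1) * a * (A - B) = a * A + a * A / (q - 1) - q / (q - 1) * (a * B).
  by field; rewrite !gt_eqF.
lra.
Qed.

(** If [t * b <= a] the first term suffices, otherwise the second. A small [t] lets the second term
    be absorbed in [nested_maximal]. *)
Lemma mulr_powR_le (q a b t : R) : 1 < q -> 0 <= a -> 0 <= b -> 0 < t ->
  a * b `^ (q - 1) <= t `^ (1 - q) * a `^ q + t * b `^ q.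
Proof.
move=> q1 a0 b0 t0.
have q0 : 0 < q by lra.
have [tba|atb] := leP (t * b) a; last first.
  apply: (@le_trans _ _ (t * b `^ q)); last by rewrite lerDr mulr_ge0// powR_ge0.
  by rewrite -(mulr_powRB1 b0 q0) mulrA ler_wpM2r ?powR_ge0// ltW.
apply: (@le_trans _ _ (t `^ (1 - q) * a `^ q)); last first.
  by rewrite lerDl mulr_ge0 ?powR_ge0// ltW.
rewrite -(mulr_powRB1 a0 q0) mulrCA ler_wpM2l//.
have -> : t `^ (1 - q) = (t^-1) `^ (q - 1).
  by rewrite -(powR_inv1 (ltW t0)) -powRrM; congr powR; lra.
rewrite -powRM ?invr_ge0//; last exact: ltW.
apply: ge0_ler_powR; rewrite ?nnegrE ?subr_ge0 ?mulr_ge0 ?invr_ge0//; try exact: ltW.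
by rewrite ler_pdivlMl.
Qed.

(** A share u in [0, 1] satisfies u <= u^p; this is applied to a/(a + b) and b/(a + b), which add up
    to 1. *)
Lemma powR_sum_le (J : Type) (s : seq J) (x : J -> R) (p : R) :
  0 < p -> p <= 1 -> (forall j, 0 <= x j) ->
  (\sum_(j <- s) x j) `^ p <= \sum_(j <- s) x j `^ p.
Proof.
move=> p0 p1 x0; elim: s => [|j s IH]; first by rewrite !big_nil powR0 ?gt_eqF.
rewrite !big_cons; apply: le_trans (lerD (lexx _) IH).
have S0 : 0 <= \sum_(j <- s) x j by apply: sumr_ge0.
move: (x j) (x0 j) => a a0; set b := \sum_(j <- s) x j in S0 *.
have [->|ab0] := eqVneq (a + b) 0; first by rewrite powR0 ?gt_eqF// addr_ge0 ?powR_ge0.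
have {}ab0 : 0 < a + b by rewrite lt_def ab0 addr_ge0.
have key c : 0 <= c -> c <= a + b -> c / (a + b) * (a + b) `^ p <= c `^ p.
  move=> c0 cab; have [->|cn0] := eqVneq c 0; first by rewrite !mul0r powR_ge0.
  have cgt0 : 0 < c by rewrite lt_def cn0.
  have -> : c `^ p = (c / (a + b)) `^ p * (a + b) `^ p.
    by rewrite -powRM ?divr_ge0 1?ltW// divfK ?gt_eqF.
  rewrite ler_wpM2r ?powR_ge0//.
  have u1 : c / (a + b) <= 1 by rewrite ler_pdivrMr// mul1r.
  have u0 : 0 < c / (a + b) by rewrite divr_gt0.
  rewrite -[leLHS]powRr1; last exact: ltW.
  by apply: ger_powR => //; rewrite u0.
apply: le_trans (lerD (key a a0 _) (key b S0 _)); rewrite ?lerDl ?lerDr//.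
by rewrite -mulrDl -mulrDl divff ?gt_eqF// mul1r.
Qed.

End power_inequalities.

(** * Exhaustion arguments in measure theory *)

Section finite_enumeration.
Context (I : countType) (P : set I).

(** Finite lists increasing with [N] to the countable set [P], through which bounds for finite
    families pass to countable ones. *)
Definition first_terms (N : nat) : seq I :=
  [seq i <- pmap (@pickle_inv I) (iota 0 N) | `[< P i >]].

Lemma mem_first_terms N i : (i \in first_terms N) = `[< P i >] && (pickle i < N)%N.
Proof.
rewrite mem_filter; case: asboolP => //= _.
rewrite mem_pmap; apply/mapP/idP => [[k]|iN].
  rewrite mem_iota add0n /= => kN ik.
  suff -> : pickle i = k by [].
  by have := @pickle_invK I k; rewrite -ik.
by exists (pickle i); rewrite ?mem_iota//= pickleK_inv.
Qed.

Lemma first_terms_uniq N : uniq (first_terms N).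
Proof.
apply: filter_uniq; apply: (pmap_uniq (g := @pickle I)); last exact: iota_uniq.
exact: pickle_invK.
Qed.

End finite_enumeration.

Section measure_lemmas.
Context d (T : measurableType d) (R : realType) (mu : {measure set T -> \bar R}).

Lemma integral_indicM (B : set T) (f : T -> R) :
  (\int[mu]_(x in B) (f x)%:E = \int[mu]_x (f x * \1_B x)%:E)%E.
Proof.
rewrite integral_mkcond; apply: eq_integral => x _.
by rewrite /patch indicE; case: ifP => _; rewrite ?mulr1 ?mulr0.
Qed.

Lemma countable_bigcup_measurable (I : countType) (P : set I) (B : I -> set T) :
  (forall i, measurable (B i)) -> measurable (\bigcup_(i in P) B i).
Proof.
move=> mB; rewrite (_ : \bigcup_(i in P) B i =
    \bigcup_N \bigcup_(i in [set` first_terms P N]) B i); last first.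
  apply/seteqP; split=> [x [i Pi Bx]|x [N _ [i /= iN Bx]]].
    exists (pickle i).+1 => //; exists i => //=.
    by rewrite mem_first_terms ltnSn andbT; apply/asboolP.
  by exists i => //; move: iN; rewrite mem_first_terms => /andP[/asboolP].
apply: bigcupT_measurable => N.
by rewrite bigcup_seq; apply: bigsetU_measurable.
Qed.

Lemma countable_bigcup_le (I : countType) (P : set I) (B : I -> set T) (b : \bar R) :
  (forall i, measurable (B i)) ->
  (forall s : seq I, (forall i, i \in s -> P i) ->
    (mu (\bigcup_(i in [set` s]) B i) <= b)%E) ->
  (mu (\bigcup_(i in P) B i) <= b)%E.
Proof.
move=> mB Hb.
have mF N : measurable (\bigcup_(i in [set` first_terms P N]) B i).
  exact: countable_bigcup_measurable.
rewrite (_ : \bigcup_(i in P) B i =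
    \bigcup_N \bigcup_(i in [set` first_terms P N]) B i); last first.
  apply/seteqP; split=> [x [i Pi Bx]|x [N _ [i /= iN Bx]]].
    exists (pickle i).+1 => //; exists i => //=.
    by rewrite mem_first_terms ltnSn andbT; apply/asboolP.
  by exists i => //; move: iN; rewrite mem_first_terms => /andP[/asboolP].
have cv := @nondecreasing_cvg_mu _ _ _ mu _ mF (bigcupT_measurable _ mF).
rewrite -(cvg_lim _ (cv _))//; last first.
  move=> N M NM; apply/subsetPset => x [i /= + Bx]; exists i => //=.
  move: p; rewrite !mem_first_terms => /andP[-> /=] /leq_trans; exact.
apply: lime_le.
  apply/cvg_ex; eexists; apply: cv.
  move=> N M NM; apply/subsetPset => x [i /= + Bx]; exists i => //=.
  move: p; rewrite !mem_first_terms => /andP[-> /=] /leq_trans; exact.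
near=> N; apply: Hb => i; rewrite mem_first_terms => /andP[/asboolP].
by [].
Unshelve. all: by end_near. Qed.

Lemma ge0_integral_exhaust_le (h : T -> \bar R) (F : (set T)^nat) (b : \bar R) :
  measurable_fun [set: T] h -> (forall x, 0 <= h x)%E ->
  (forall k, measurable (F k)) -> {homo F : n m / (n <= m)%N >-> n `<=` m} ->
  {ae mu, forall x, exists k, F k x} ->
  (forall k, \int[mu]_(x in F k) h x <= b)%E -> (\int[mu]_x h x <= b)%E.
Proof.
move=> mh h0 mF ndF aeF Hb.
have mU : measurable (\bigcup_k F k) by exact: bigcupT_measurable.
have -> : (\int[mu]_x h x = \int[mu]_(x in \bigcup_k F k) h x)%E.
  rewrite [RHS]integral_mkcond; apply: ge0_ae_eq_integral => //.
  - by apply/(measurable_restrictT _ _).1 => //; exact: measurable_funTS.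
  - by move=> x _; rewrite /patch; case: ifP.
  - apply: filterS aeF => x [k Fk] _.
    by rewrite /patch mem_set//; exists k.
have cv := @ge0_nondecreasing_set_cvg_integral _ _ _ F h mu.
rewrite -(cvg_lim _ (cv _ mF _ _))//.
- apply: lime_le; last by near=> k; exact: Hb.
  apply/cvg_ex; eexists; apply: cv => //.
  + by move=> i j ij; apply/subsetPset; exact: ndF.
  + by move=> i; exact: measurable_funTS.
- by move=> i j ij; apply/subsetPset; exact: ndF.
- by move=> i; exact: measurable_funTS.
Unshelve. all: by end_near. Qed.

(** Hoelder's inequality for the constant 1, written as the geometric mean of the [w i]: pointwise
    [weighted_AM_GM] for [w i x / S i], integrated over [E]. It supplies the bound on [e] in
    [joint_weight_term]. *)
Lemma holder_measure (I : finType) (th : I -> R) (w : I -> T -> R) (E : set T)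
    (S : I -> R) : measurable E -> (forall i, 0 < th i) -> \sum_i th i = 1 ->
  (forall i, measurable_fun setT (w i)) -> (forall i x, 0 < w i x) ->
  (forall x, \prod_i w i x `^ th i = 1) ->
  (forall i, 0 < S i) -> (forall i, \int[mu]_(x in E) (w i x)%:E = (S i)%:E)%E ->
  (mu E <= (\prod_i S i `^ th i)%:E)%E.
Proof.
move=> mE th0 th1 mw w0 w1 S0 wS.
have P0 : 0 < \prod_i S i `^ th i by apply: prodr_gt0 => i _; rewrite powR_gt0.
rewrite -[X in mu X](setIT E) -(integral_indic mu measurableT mE).
have mt i : measurable_fun setT (fun x => (th i * (S i)^-1 * (w i x * \1_E x))%:E).
  apply/measurable_EFinP; apply: measurable_funM => //.
  by apply: measurable_funM => //; exact: measurable_indic.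
apply: (@le_trans _ _ (\int[mu]_x ((\prod_i S i `^ th i)%:E *
    \sum_i (th i * (S i)^-1 * (w i x * \1_E x))%:E)))%E.
  apply: ge0_le_integral => //.
  - by apply/measurable_EFinP; exact: measurable_indic.
  - by apply: measurable_funeM; apply: emeasurable_sum.
  - move=> x _; rewrite sumEFin -EFinM lee_fin indicE.
    case: (x \in E); last first.
      by rewrite [X in _ * X]big1 ?mulr0// => i _; rewrite !mulr0.
    rewrite mulrC -ler_pdivrMr// mul1r.
    apply: (@le_trans _ _ (\prod_i (w i x / S i) `^ th i)); last first.
      apply: le_trans (weighted_AM_GM th0 th1 _) _.
        by move=> i; rewrite divr_ge0// ltW.
      by apply: ler_sum => i _; rewrite mulr1 mulrA mulrAC.
    rewrite -[leLHS]mul1r -[X in X / _](w1 x) -prodf_div.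
    apply: ler_prod => i _; rewrite divr_ge0 ?powR_ge0//=.
    rewrite powRM ?invr_ge0 ?(ltW (S0 i)) ?(ltW (w0 i x))//.
    by rewrite -(powR_inv1 (ltW (S0 i))) -powRrM mulN1r powRN.
rewrite ge0_integralZl ?lee_fin ?(ltW P0)//; last 2 first.
- exact: emeasurable_sum.
- move=> x _; apply: sume_ge0 => i _; rewrite lee_fin.
  by rewrite !mulr_ge0 ?invr_ge0 ?indicE// ltW.
rewrite ge0_integral_sum//; last first.
  by move=> i x _; rewrite lee_fin !mulr_ge0 ?invr_ge0 ?indicE// ltW.
rewrite (eq_bigr (fun i => (th i)%:E)); last first.
  move=> i _; under eq_integral do rewrite EFinM.
  rewrite ge0_integralZl//; last 3 first.
  - by apply/measurable_EFinP; apply: measurable_funM.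
  - by move=> x _; rewrite lee_fin mulr_ge0 ?indicE// ltW.
  - by rewrite lee_fin mulr_ge0 ?invr_ge0// ltW.
  by rewrite -integral_indicM wS -EFinM divfK ?gt_eqF.
by rewrite sumEFin th1 mule1.
Qed.

End measure_lemmas.

(** * The maximal function and Carleson embedding of a nested family *)

Section nested_families.
Context d (T : measurableType d) (R : realType) (mu : {measure set T -> \bar R}).
Context (I : choiceType) (lvl : I -> nat) (B : I -> set T).
Hypothesis mB : forall i, measurable (B i).

Let sub_behead (P Q : I) (s : seq I) : P \in s -> P \in Q :: s.
Proof. by rewrite in_cons => ->; rewrite orbT. Qed.

Definition nested (s : seq I) := forall P Q, P \in s -> Q \in s ->
  (lvl Q <= lvl P)%N -> B P `&` B Q !=set0 -> B P `<=` B Q.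

Let finer (P Q : I) := (lvl Q <= lvl P)%N.

Lemma nested_sub s1 s2 : {subset s1 <= s2} -> nested s2 -> nested s1.
Proof. by move=> s12 n2 P Q Ps Qs; apply: n2; exact: s12. Qed.

(** After sorting by level, the head [Q] is the finest set: each set of [s] either contains [B Q] or
    is disjoint from it, so whatever is built from [s] is constant on [B Q]. Invariance of [Phi]
    under permutations pays for the sorting. *)
Lemma nested_ind (Phi : seq I -> Prop) :
  (forall s1 s2, perm_eq s1 s2 -> Phi s1 -> Phi s2) -> Phi [::] ->
  (forall Q s, nested (Q :: s) -> (forall P, P \in s -> (lvl P <= lvl Q)%N) ->
    Phi s -> Phi (Q :: s)) ->
  forall s, nested s -> Phi s.
Proof.
move=> permPhi Phi0 PhiS s ns.
have finer_total : total finer by move=> P Q; rewrite /finer leq_total.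
have finer_trans : transitive finer by move=> P Q S QP PS; exact: leq_trans PS QP.
have ps : perm_eq (sort finer s) s by rewrite perm_sort.
apply: (permPhi _ _ ps).
have {}ns : nested (sort finer s).
  by apply: nested_sub ns => P; rewrite (perm_mem ps).
move: (sort_sorted finer_total s) ns; elim: (sort finer s) => [//|Q t IH] /=.
rewrite path_sortedE// => /andP[/allP Qt st] nQt.
apply: PhiS => //; apply: IH => //.
by apply: nested_sub nQt => P Pt; rewrite in_cons Pt orbT.
Qed.

(** Weak type bound with constant 1: the finest set added last lies inside the union of the others
    or is disjoint from it, and in the second case both sides are additive. *)
Lemma nested_weak (g : T -> R) (theta : R) (s : seq I) :
  measurable_fun setT g -> (forall x, 0 <= g x) -> nested s -> 0 <= theta ->
  (forall Q, Q \in s -> theta%:E * mu (B Q) <= \int[mu]_(x in B Q) (g x)%:E)%E ->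
  (theta%:E * mu (\bigcup_(Q in [set` s]) B Q) <=
    \int[mu]_(x in \bigcup_(Q in [set` s]) B Q) (g x)%:E)%E.
Proof.
move=> mg g0 ns th0; move: s ns; apply: nested_ind => [s1 s2 s12 H1 H2||Q s nQs sQ IH H].
- have -> : [set` s2] = [set` s1].
    by apply/seteqP; split=> P /=; rewrite (perm_mem s12).
  by apply: H1 => Q Qs; apply: H2; rewrite -(perm_mem s12).
- by move=> _; rewrite set_nil bigcup_set0 measure0 mule0 integral_set0.
have {}IH := IH (fun P Ps => H P (sub_behead _ Ps)).
set U := \bigcup_(P in [set` s]) B P in IH *.
have mU : measurable U by rewrite /U bigcup_seq; exact: bigsetU_measurable.
have -> : \bigcup_(P in [set` Q :: s]) B P = B Q `|` U.
  by rewrite !bigcup_seq big_cons /U bigcup_seq.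
have [QU0|/set0P[x [BQx [P /= Ps BPx]]]] := eqVneq (B Q `&` U) set0; last first.
  suff -> : B Q `|` U = U by [].
  apply/seteqP; split=> [y [BQy|//]|y Uy]; last by right.
  exists P => //=; apply: (nQs Q P) BQy; rewrite ?mem_head ?sub_behead ?sQ//.
  by exists x.
rewrite measureU// ge0_integral_setU//; last 3 first.
- by apply/measurable_EFinP; exact: measurable_funTS.
- by move=> x _; rewrite lee_fin.
- by apply/disj_setPS; rewrite QU0.
by rewrite ge0_muleDr ?measure_ge0// leeD// H// mem_head.
Qed.

Variables (f w : T -> R) (avg : I -> R) (q : R).
Hypotheses (mf : measurable_fun setT f) (mw : measurable_fun setT w).
Hypotheses (f0 : forall x, 0 <= f x) (w0 : forall x, 0 < w x).
Hypotheses (avg0 : forall Q, 0 <= avg Q) (q1 : 1 < q).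

Definition family_max (s : seq I) (x : T) : R :=
  \big[Num.max/0]_(Q <- s) (avg Q * \1_(B Q) x).

Lemma family_max_ge0 s x : 0 <= family_max s x.
Proof.
rewrite /family_max; elim/big_ind : _ => // [u v u0 v0|Q _].
  by rewrite le_max u0.
by rewrite mulr_ge0// indicE.
Qed.

Lemma measurable_family_max s : measurable_fun setT (family_max s).
Proof.
rewrite /family_max; elim: s => [|Q s IH].
  by under eq_fun do rewrite big_nil; exact: measurable_cst.
under eq_fun do rewrite big_cons; apply: measurable_maxr => //.
by apply: measurable_funM => //; exact: measurable_indic.
Qed.

Lemma le_family_max (s : seq I) Q x : Q \in s -> B Q x -> avg Q <= family_max s x.
Proof.
move=> Qs BQx; rewrite /family_max; elim: s Qs => //= P s IH.
rewrite in_cons big_cons le_max => /orP[/eqP <-|/IH ->]; last by rewrite orbT.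
by rewrite indicE mem_set// mulr1 lexx.
Qed.

(** A priori finiteness, needed to absorb this integral in [nested_maximal]; for a finite family the
    maximum to the power [q] is below the sum of the powers. *)
Lemma integral_family_max_lty (s : seq I) :
  (forall Q, Q \in s -> \int[mu]_(x in B Q) (w x)%:E < +oo)%E ->
  (\int[mu]_x (family_max s x `^ q * w x)%:E < +oo)%E.
Proof.
move=> Hw.
have q0 : 0 < q by apply: lt_trans q1.
have mt Q : measurable_fun [set: T] (fun x => (avg Q `^ q)%:E * (w x * \1_(B Q) x)%:E)%E.
  by apply: measurable_funeM; apply/measurable_EFinP; apply: measurable_funM.
apply: (@le_lt_trans _ _ (\int[mu]_x \sum_(Q <- s)
    ((avg Q `^ q)%:E * (w x * \1_(B Q) x)%:E)))%E.
  apply: ge0_le_integral => //.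
  - by move=> x _; rewrite lee_fin mulr_ge0 ?powR_ge0// ltW.
  - apply/measurable_EFinP; apply: measurable_funM => //.
    apply: (@measurableT_comp _ _ _ _ _ _ (fun z => z `^ q)) => //.
    exact: measurable_family_max.
  - exact: emeasurable_sum.
  - move=> x _; rewrite sumEFin lee_fin.
    apply: (@le_trans _ _ (\sum_(Q <- s) (avg Q * \1_(B Q) x) `^ q * w x)).
      rewrite -mulr_suml ler_wpM2r//; first exact: ltW.
      rewrite /family_max; elim: s {Hw} => [|Q s IH]; first by rewrite !big_nil powR0// gt_eqF.
      rewrite !big_cons /Num.max; case: ifPn => _.
        by apply: le_trans IH _; rewrite lerDr powR_ge0.
      by rewrite lerDl sumr_ge0// => P _; exact: powR_ge0.
    apply: ler_sum => Q _; rewrite indicE; case: (x \in B Q).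
      by rewrite !mulr1.
    by rewrite !mulr0 powR0 ?mul0r// gt_eqF.
rewrite ge0_integral_sum//; last first.
  by move=> Q x _; rewrite mule_ge0// lee_fin ?powR_ge0// mulr_ge0 ?indicE// ltW.
rewrite big_seq; apply: lte_sum_pinfty => Q Qs.
rewrite ge0_integralZl//; last 3 first.
- by apply/measurable_EFinP; apply: measurable_funM.
- by move=> x _; rewrite lee_fin mulr_ge0 ?indicE// ltW.
- by rewrite lee_fin powR_ge0.
by rewrite -integral_indicM lte_mul_pinfty// ?lee_fin ?powR_ge0// Hw.
Qed.

(* Adding the sets from the coarsest to the finest, the maximum is constant on
   each new set, so that both sides change by explicit amounts. *)
Lemma integral_family_max_le s : nested s ->
  (forall Q, Q \in s -> \int[mu]_(x in B Q) (w x)%:E < +oo)%E ->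
  (forall Q, Q \in s -> (avg Q)%:E * \int[mu]_(x in B Q) (w x)%:E <=
     \int[mu]_(x in B Q) (f x)%:E)%E ->
  (\int[mu]_x (family_max s x `^ q * w x)%:E <=
    (q / (q - 1))%:E * \int[mu]_x (f x * family_max s x `^ (q - 1))%:E)%E.
Proof.
have q0 : 0 < q by apply: lt_trans q1.
have qm0 : 0 < q - 1 by rewrite subr_gt0.
have qq0 : 0 <= q / (q - 1) by rewrite divr_ge0// ltW.
move=> ns; move: s ns; apply: nested_ind => [s1 s2 s12 H1 Hw H2||Q s nQs sQ IH Hw H].
- have -> : family_max s2 = family_max s1.
    by apply/funext => x; rewrite /family_max (perm_big _ s12).
  by apply: H1 => Q Qs; [apply: Hw|apply: H2]; rewrite -(perm_mem s12).
- move=> _ _; rewrite integral0_eq; last first.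
    by move=> x _; rewrite /family_max big_nil powR0 ?mul0r// gt_eqF.
  rewrite mule_ge0 ?lee_fin//; apply: integral_ge0 => x _.
  by rewrite lee_fin mulr_ge0 ?powR_ge0.
have {}IH := IH (fun P Ps => Hw P (sub_behead _ Ps)) (fun P Ps => H P (sub_behead _ Ps)).
have {Hw}wQ := Hw Q (mem_head _ _).
have {H}HQ := H Q (mem_head _ _).
have [BQ0|/set0P[y BQy]] := eqVneq (B Q) set0.
  suff -> : family_max (Q :: s) = family_max s by [].
  apply/funext => x; rewrite /family_max big_cons BQ0 indic0 mulr0.
  by apply/max_idPr; exact: family_max_ge0.
pose b := family_max s y; pose a := Num.max (avg Q) b.
have b0 : 0 <= b by exact: family_max_ge0.
have ba : b <= a by rewrite /a le_max lexx orbT.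
(* Coarser sets cannot separate two points of [B Q], so the old maximum has a single value there. *)
have sQb x : B Q x -> family_max s x = b.
  move=> BQx; rewrite /b /family_max; apply: eq_big_seq => P Ps; congr (_ * _).
  have sub z z' : B Q z -> B Q z' -> B P z -> B P z'.
    move=> BQz BQz' BPz; apply: (nQs Q P) BQz'; rewrite ?mem_head ?sub_behead ?sQ//.
    by exists z.
  rewrite !indicE; congr (_ %:R)%R; congr nat_of_bool.
  by apply/idP/idP; rewrite !inE; exact: sub.
have new x : family_max (Q :: s) x = if x \in B Q then a else family_max s x.
  rewrite [LHS]big_cons indicE; case: ifPn => [|_].
    by rewrite inE => BQx; rewrite mulr1 -/(family_max s x) sQb.
  by rewrite mulr0; apply/max_idPr; exact: family_max_ge0.
have mp r : measurable_fun setT (fun x => family_max s x `^ r).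
  apply: (@measurableT_comp _ _ _ _ _ _ (fun z => z `^ r)) => //.
  exact: measurable_family_max.
have mi (h : T -> R) : measurable_fun setT h ->
    measurable_fun [set: T] (fun x => (h x * \1_(B Q) x)%:E).
  by move=> mh; apply/measurable_EFinP; apply: measurable_funM.
have aqbq : 0 <= a `^ q - b `^ q.
  by rewrite subr_ge0 ge0_ler_powR ?nnegrE ?(ltW q0)// (le_trans b0).
have aqbq1 : 0 <= a `^ (q - 1) - b `^ (q - 1).
  by rewrite subr_ge0 ge0_ler_powR ?nnegrE ?(ltW qm0)// (le_trans b0).
have -> : (\int[mu]_x (family_max (Q :: s) x `^ q * w x)%:E =
    \int[mu]_x (family_max s x `^ q * w x)%:E +
    (a `^ q - b `^ q)%:E * \int[mu]_(x in B Q) (w x)%:E)%E.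
  rewrite (integral_indicM mu (B Q) w) -ge0_integralZl//; last 2 first.
  - exact: mi.
  - by move=> x _; rewrite lee_fin mulr_ge0 ?indicE// ltW.
  rewrite -ge0_integralD//; last 4 first.
  - by move=> x _; rewrite lee_fin mulr_ge0 ?powR_ge0// ltW.
  - by apply/measurable_EFinP; exact: measurable_funM.
  - by move=> x _; rewrite mule_ge0 ?lee_fin// mulr_ge0 ?indicE// ltW.
  - by apply: measurable_funeM; exact: mi.
  apply: eq_integral => x _; rewrite -EFinM -EFinD new indicE; congr EFin.
  case: ifPn => [|_]; last by rewrite !mulr0 addr0.
  by rewrite inE => /sQb ->; rewrite mulr1; ring.
have -> : (\int[mu]_x (f x * family_max (Q :: s) x `^ (q - 1))%:E =
    \int[mu]_x (f x * family_max s x `^ (q - 1))%:E +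
    (a `^ (q - 1) - b `^ (q - 1))%:E * \int[mu]_(x in B Q) (f x)%:E)%E.
  rewrite (integral_indicM mu (B Q) f) -ge0_integralZl//; last 2 first.
  - exact: mi.
  - by move=> x _; rewrite lee_fin mulr_ge0 ?indicE.
  rewrite -ge0_integralD//; last 4 first.
  - by move=> x _; rewrite lee_fin mulr_ge0 ?powR_ge0.
  - by apply/measurable_EFinP; exact: measurable_funM.
  - by move=> x _; rewrite mule_ge0 ?lee_fin// mulr_ge0 ?indicE.
  - by apply: measurable_funeM; exact: mi.
  apply: eq_integral => x _; rewrite -EFinM -EFinD new indicE; congr EFin.
  case: ifPn => [|_]; last by rewrite !mulr0 addr0.
  by rewrite inE => /sQb ->; rewrite mulr1; ring.
rewrite [leRHS]ge0_muleDr; last 2 first.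
- by apply: integral_ge0 => x _; rewrite lee_fin mulr_ge0 ?powR_ge0.
- by rewrite mule_ge0// ?lee_fin//; apply: integral_ge0 => x _; rewrite lee_fin.
apply: leeD => //.
have W0 : (0 <= \int[mu]_(x in B Q) (w x)%:E)%E.
  by apply: integral_ge0 => x _; rewrite lee_fin ltW.
apply: (@le_trans _ _ ((q / (q - 1) * a * (a `^ (q - 1) - b `^ (q - 1)))%:E *
    \int[mu]_(x in B Q) (w x)%:E)%E).
  by apply: lee_wpmul2r => //; rewrite lee_fin powR_increment_le.
(* If [Q] does not raise the maximum, both increments vanish. Otherwise [a = avg Q], and [HQ]
   exchanges [a] times the [w]-mass of [B Q] for its [f]-mass. *)
have [avgb|bavg] := leP (avg Q) b.
  have -> : a = b by apply/max_idPr.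
  by rewrite subrr mulr0 !mul0e mule0.
have -> : a = avg Q by apply/max_idPl/ltW.
rewrite -mulrA EFinM -muleA; apply: lee_wpmul2l; first by rewrite lee_fin.
rewrite mulrC EFinM -muleA; apply: lee_wpmul2l => //.
by rewrite lee_fin; move: aqbq1; rewrite /a max_l// ltW.
Qed.

(** With k = q/(q - 1) and t = 1/(2k), the inequality Y <= k (t^(1 - q) X + t Y) absorbs half of Y
    and leaves Y <= 2 k t^(1 - q) X. *)
Definition maximal_constant : R :=
  2 * (q / (q - 1)) * ((2 * (q / (q - 1)))^-1) `^ (1 - q).

(** The L^q(w) bound for the maximal function of f/w relative to the measure w dx: the right side
    integrates (f/w)^q w. [mulr_powR_le] is applied to f/w and the maximum, and the part containing
    the maximum is absorbed. *)
Lemma nested_maximal s : nested s ->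
  (forall Q, Q \in s -> \int[mu]_(x in B Q) (w x)%:E < +oo)%E ->
  (forall Q, Q \in s -> (avg Q)%:E * \int[mu]_(x in B Q) (w x)%:E <=
     \int[mu]_(x in B Q) (f x)%:E)%E ->
  (\int[mu]_x (family_max s x `^ q * w x)%:E <=
    maximal_constant%:E * \int[mu]_x (f x `^ q * w x `^ (1 - q))%:E)%E.
Proof.
move=> ns Hw H; have fin := integral_family_max_lty Hw.
have := integral_family_max_le ns Hw H.
have q0 : 0 < q by apply: lt_trans q1.
have qm0 : 0 < q - 1 by rewrite subr_gt0.
have qq0 : 0 < q / (q - 1) by rewrite divr_gt0.
rewrite /maximal_constant; set k := q / (q - 1) in qq0 *; set t := (2 * k)^-1.
have t0 : 0 < t by rewrite invr_gt0 mulr_gt0.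
have mp r : measurable_fun setT (fun x => family_max s x `^ r).
  apply: (@measurableT_comp _ _ _ _ _ _ (fun z => z `^ r)) => //.
  exact: measurable_family_max.
have mpw (h : T -> R) r : measurable_fun setT h -> measurable_fun setT (fun x => h x `^ r).
  by move=> mh; apply: (@measurableT_comp _ _ _ _ _ _ (fun z => z `^ r)).
have mX : measurable_fun [set: T] (fun x => (f x `^ q * w x `^ (1 - q))%:E).
  by apply/measurable_EFinP; apply: measurable_funM; exact: mpw.
have mM : measurable_fun [set: T] (fun x => (family_max s x `^ q * w x)%:E).
  by apply/measurable_EFinP; apply: measurable_funM.
have X0 x : (0 <= (f x `^ q * w x `^ (1 - q))%:E)%E.
  by rewrite lee_fin mulr_ge0 ?powR_ge0.
have M0 x : (0 <= (family_max s x `^ q * w x)%:E)%E.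
  by rewrite lee_fin mulr_ge0 ?powR_ge0// ltW.
have le1 : (\int[mu]_x (f x * family_max s x `^ (q - 1))%:E <=
    (t `^ (1 - q))%:E * \int[mu]_x (f x `^ q * w x `^ (1 - q))%:E +
    t%:E * \int[mu]_x (family_max s x `^ q * w x)%:E)%E.
  rewrite -!ge0_integralZl// ?lee_fin ?powR_ge0 ?(ltW t0)//.
  rewrite -ge0_integralD//; last 4 first.
  - by move=> x _; rewrite mule_ge0// lee_fin powR_ge0.
  - exact: measurable_funeM.
  - by move=> x _; rewrite mule_ge0// lee_fin ltW.
  - exact: measurable_funeM.
  apply: ge0_le_integral => //.
  - by move=> x _; rewrite lee_fin mulr_ge0 ?powR_ge0.
  - by apply/measurable_EFinP; apply: measurable_funM.
  - by apply: emeasurable_funD; exact: measurable_funeM.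
  - move=> x _; rewrite -!EFinM -EFinD lee_fin.
    have wx := w0 x.
    have fw0 : 0 <= f x / w x by rewrite divr_ge0// ltW.
    have -> : f x * family_max s x `^ (q - 1) =
      f x / w x * family_max s x `^ (q - 1) * w x by field; rewrite gt_eqF.
    apply: le_trans (ler_wpM2r (ltW wx) (mulr_powR_le q1 fw0 _ t0)) _.
      exact: family_max_ge0.
    rewrite mulrDl -!mulrA lerD2r ler_wpM2l ?powR_ge0//.
    rewrite powRM ?invr_ge0 ?(ltW wx)// -(powR_inv1 (ltW wx)) -powRrM.
    rewrite -[X in _ * X <= _]mulr1 -mulrA ler_wpM2l ?powR_ge0//.
    rewrite mulr1 -[X in _ * X <= _](powRr1 (ltW wx)) -powRD ?(gt_eqF wx) ?implybT//.
    by rewrite mulN1r addrC.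
set Y := (\int[mu]_x (family_max s x `^ q * w x)%:E)%E in fin le1 *.
set X := (\int[mu]_x (f x `^ q * w x `^ (1 - q))%:E)%E in le1 *.
move=> /le_trans/(_ (lee_wpmul2l (ltW qq0 : (0 <= k%:E)%E) le1)).
have Y0 : (0 <= Y)%E by apply: integral_ge0 => x _; exact: M0.
have X0' : (0 <= X)%E by apply: integral_ge0 => x _; exact: X0.
have [->|Xfin] := eqVneq X +oo%E.
  move=> _; rewrite gt0_muley ?leey// lte_fin mulr_gt0 ?powR_gt0//.
  by rewrite mulr_gt0.
have {}Xfin : X \is a fin_num by rewrite ge0_fin_numE// lt_neqAle Xfin leey.
have {}fin : Y \is a fin_num by rewrite ge0_fin_numE.
clear le1 X0' Y0; clearbody X Y; move: Xfin fin.
case: X => [x| |]// _; case: Y => [y| |]// _.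
rewrite -!(EFinM, EFinD) !lee_fin mulrDr.
have -> : k * (t * y) = y / 2 by rewrite /t; field; rewrite gt_eqF.
rewrite -!mulrA; lra.
Qed.

(** On [E Q] the maximal function of the class of [Q] is at least [avg Q], and the [E Q] are
    disjoint, so each class contributes at most the integral bounded in [nested_maximal]. The
    classes are there for triples of dyadic cubes, which are nested only within one class. *)
Lemma carleson_embedding (C : finType) (cls : I -> C) (s : seq I) (E : I -> set T) :
  uniq s -> (forall Q, measurable (E Q)) -> (forall Q, E Q `<=` B Q) ->
  (forall P Q, P \in s -> Q \in s -> E P `&` E Q !=set0 -> P = Q) ->
  (forall c, nested [seq Q <- s | cls Q == c]) ->
  (forall Q, Q \in s -> \int[mu]_(x in B Q) (w x)%:E < +oo)%E ->
  (forall Q, Q \in s -> (avg Q)%:E * \int[mu]_(x in B Q) (w x)%:E <=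
     \int[mu]_(x in B Q) (f x)%:E)%E ->
  (\sum_(Q <- s) (avg Q `^ q)%:E * \int[mu]_(x in E Q) (w x)%:E <=
    #|C|%:R%:E * (maximal_constant%:E * \int[mu]_x (f x `^ q * w x `^ (1 - q))%:E))%E.
Proof.
move=> us mE EB disjE ns Hw H.
set X := (maximal_constant%:E * _)%E.
rewrite (partition_big cls xpredT)//=.
apply: (@le_trans _ _ (\sum_(c : C) X)%E); last first.
  rewrite big_const; elim: #|C| => [|k IH]; first by rewrite mul0e.
  rewrite iterS -natr1 EFinD ge0_muleDl ?lee_fin// mul1e addeC.
  exact: leeD.
apply: lee_sum => c _; rewrite -big_filter.
set t := [seq Q <- s | cls Q == c].
have ts : {subset t <= s} by move=> Q; rewrite mem_filter => /andP[].
apply: le_trans (nested_maximal (ns c) (fun Q Qt => Hw Q (ts Q Qt))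
  (fun Q Qt => H Q (ts Q Qt))).
have mM : measurable_fun [set: T] (fun x => (family_max t x `^ q * w x)%:E).
  apply/measurable_EFinP; apply: measurable_funM => //.
  apply: (@measurableT_comp _ _ _ _ _ _ (fun z => z `^ q)) => //.
  exact: measurable_family_max.
have M0 x : (0 <= (family_max t x `^ q * w x)%:E)%E.
  by rewrite lee_fin mulr_ge0 ?powR_ge0// ltW.
have ut : uniq t by exact: filter_uniq.
apply: (@le_trans _ _ (\int[mu]_(x in \big[setU/set0]_(Q <- t) E Q)
    (family_max t x `^ q * w x)%:E)%E); last first.
  by apply: ge0_subset_integral => //; exact: bigsetU_measurable.
rewrite ge0_integral_bigsetU//; last 2 first.
- by move=> P Q Pt Qt; apply: disjE; exact: ts.
- exact: measurable_funTS.
rewrite big_seq [leRHS]big_seq; apply: lee_sum => Q Qt.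
rewrite -ge0_integralZl//; last 3 first.
- by apply/measurable_EFinP; exact: measurable_funTS.
- by move=> x _; rewrite lee_fin ltW.
- by rewrite lee_fin powR_ge0.
apply: ge0_le_integral => //.
- by move=> x _; rewrite mule_ge0 ?lee_fin ?powR_ge0// ltW.
- by apply: measurable_funeM; apply/measurable_EFinP; exact: measurable_funTS.
- exact: measurable_funTS.
- move=> x Ex; rewrite -EFinM lee_fin ler_wpM2r//; first exact: ltW.
  have q0 : 0 <= q by apply: le_trans (ltW q1).
  apply: ge0_ler_powR; rewrite ?nnegrE ?family_max_ge0//.
  by apply: le_family_max => //; exact: EB.
Qed.

End nested_families.

(** * Dyadic cubes *)

Section dyadic_cubes.
Context (R : realType) (n : nat) (x0 : 'rV[R]_n) (l0 : R) (l0_gt0 : 0 < l0).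
Local Notation Rn := 'rV[R]_n.
Local Notation mu := (lebesgue_rV R n).

Lemma measurable_cube (x : Rn) (l : R) : measurable (cube x l).
Proof.
rewrite (_ : cube x l = \bigcap_(i in [set: 'I_n])
    ((fun z : Rn => z ord0 i) @^-1` `[x ord0 i, x ord0 i + l[%classic)); last first.
  apply/seteqP; split=> [z zi i _ /=|z zi i]; first by rewrite in_itv /= zi.
  by have := zi i I; rewrite /= in_itv.
apply: fin_bigcap_measurable => // i _.
by rewrite -[X in measurable X]setTI; apply: measurable_coord.
Qed.

(* [(j, a)] is the cube of side [l0 / 2 ^ j] and lower corner [x0 + l0 / 2 ^ j * a];
   [dy] is this cube, [tri] its concentric triple, and [at_ j x] the cube of
   generation [j] containing [x]. *)
Definition cubeidx := (nat * {ffun 'I_n -> int})%type.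

Definition side (j : nat) : R := l0 / 2 ^+ j.

Definition coord (j : nat) (x : Rn) (i : 'I_n) : R := (x ord0 i - x0 ord0 i) / side j.

Definition corner (Q : cubeidx) (k : int) : Rn :=
  \row_i (x0 ord0 i + side Q.1 * (Q.2 i + k)%:~R).

Definition dy (Q : cubeidx) : set Rn := cube (corner Q 0) (side Q.1).

Definition tri (Q : cubeidx) : set Rn := cube (corner Q (-1)) (3 * side Q.1).

Definition at_ (j : nat) (x : Rn) : cubeidx := (j, [ffun i => Num.floor (coord j x i)]).

Lemma side_gt0 j : 0 < side j.
Proof. by rewrite divr_gt0// exprn_gt0. Qed.

Lemma side_shift j d : side j = 2 ^+ d * side (j + d).
Proof.
by rewrite /side exprD; field; rewrite !expf_neq0.
Qed.

Lemma coord_shift j d x i : coord (j + d) x i = 2 ^+ d * coord j x i.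
Proof.
rewrite /coord (side_shift j d); field.
by rewrite (gt_eqF (side_gt0 _)) expf_neq0.
Qed.

Lemma cube_coordP (Q : cubeidx) (k h : int) x :
  cube (corner Q k) (h%:~R * side Q.1) x <->
  forall i, (Q.2 i + k)%:~R <= coord Q.1 x i < (Q.2 i + k + h)%:~R.
Proof.
have s0 := side_gt0 Q.1.
split=> H i; have := H i; rewrite /coord mxE ler_pdivlMr// ltr_pdivrMr//
  => /andP[A B]; apply/andP; split; move: A B; rewrite !rmorphD /=; nra.
Qed.

Lemma dy_coordP Q x : dy Q x <->
  forall i, (Q.2 i)%:~R <= coord Q.1 x i < (Q.2 i + 1)%:~R.
Proof.
rewrite /dy -[X in cube _ X]mul1r; split=> [/(cube_coordP _ _ 1) H i|H].
  by have := H i; rewrite addr0.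
by apply/(cube_coordP _ _ 1) => i; rewrite addr0.
Qed.

Lemma tri_coordP Q x : tri Q x <->
  forall i, (Q.2 i - 1)%:~R <= coord Q.1 x i < (Q.2 i + 2)%:~R.
Proof.
split=> [/(cube_coordP _ _ 3) H i|H]; last apply/(cube_coordP _ _ 3) => i.
  by have := H i; rewrite -addrA.
by have := H i; rewrite -addrA.
Qed.

Lemma dyP Q x : dy Q x <-> at_ Q.1 x = Q.
Proof.
rewrite dy_coordP; case: Q => j a /=; split=> [H|[<-] i].
  by congr (_, _); apply/ffunP => i; rewrite ffunE; apply/floor_def/H.
by rewrite ffunE floor_itv.
Qed.

Lemma dy_at j x : dy (at_ j x) x.
Proof. exact/dyP. Qed.

Lemma dy_sub_tri Q : dy Q `<=` tri Q.
Proof.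
move=> x /dy_coordP H; apply/tri_coordP => i; have /andP[A B] := H i.
move: A B; rewrite !rmorphD/= => A B; apply/andP; split; lra.
Qed.

(** In integer terms, the floor of 2^d u determines the floor of u: if the floor of u is below that
    of v, the integer 2^d times the latter separates the scaled floors. *)
Lemma at_coarser j d x y : at_ (j + d) x = at_ (j + d) y -> at_ j x = at_ j y.
Proof.
case=> /ffunP H; congr (_, _); apply/ffunP => i; have := H i; rewrite !ffunE.
rewrite !coord_shift; move: (coord j x i) (coord j y i) => u v.
have d0 : (0 < 2 ^+ d :> R) by rewrite exprn_gt0.
wlog : u v / Num.floor u < Num.floor v.
  move=> W; case: (ltgtP (Num.floor u) (Num.floor v)) => // uv; first exact: W.
  by move=> e; apply/esym; apply: W => //.
move=> uv e; exfalso.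
have : Num.floor (2 ^+ d * u) < 2 ^+ d * Num.floor v.
  rewrite -(ltr_int R) rmorphM rmorphXn /=.
  apply: le_lt_trans (floor_le_tmp _) _.
  by rewrite ltr_pM2l// -floor_lt_int.
apply/negP; rewrite -leNgt e floor_ge_int rmorphM rmorphXn /=.
by rewrite ler_pM2l// floor_le_tmp.
Qed.

Lemma at_le j k x y : (j <= k)%N -> at_ k x = at_ k y -> at_ j x = at_ j y.
Proof. by move=> /subnKC <-; exact: at_coarser. Qed.

Lemma dy_nested (P Q : cubeidx) : (Q.1 <= P.1)%N -> dy P `&` dy Q !=set0 ->
  dy P `<=` dy Q.
Proof.
move=> QP [x [/dyP Px /dyP Qx]] y /dyP Py; apply/dyP; rewrite -Qx.
by apply: at_le QP _; rewrite Py.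
Qed.

Lemma measurable_dy Q : measurable (dy Q). Proof. exact: measurable_cube. Qed.

Lemma measurable_tri Q : measurable (tri Q). Proof. exact: measurable_cube. Qed.

Lemma lebesgue_dy Q : mu (dy Q) = (side Q.1 ^+ n)%:E.
Proof. by rewrite lebesgue_rV_cube// side_gt0. Qed.

Lemma lebesgue_tri Q : mu (tri Q) = ((3 * side Q.1) ^+ n)%:E.
Proof. by rewrite lebesgue_rV_cube// mulr_gt0// side_gt0. Qed.

Lemma dy_nonempty Q : dy Q (corner Q 0).
Proof.
by move=> i; rewrite !mxE lexx ltrDl side_gt0.
Qed.

(** With E = 2^(P.1 - Q.1), inclusion of the cubes says E b <= a < E (b + 1) in integers. One side
    of [P] added at either end is at most one side of [Q], since E >= 1. *)
Lemma tri_sub (P Q : cubeidx) : (Q.1 <= P.1)%N -> dy P `<=` dy Q -> tri P `<=` tri Q.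
Proof.
move=> QP PQ x /tri_coordP Px; apply/tri_coordP => i.
have := Px i; have /dy_coordP/(_ i) := PQ _ (dy_nonempty P).
have /dy_coordP/(_ i) := dy_nonempty P.
rewrite -(subnKC QP) !coord_shift; move: (coord _ _ _) (coord _ _ _) => u v.
set D := 2 ^+ (P.1 - Q.1).
have -> : D = (2 ^+ (P.1 - Q.1) : int)%:~R by rewrite rmorphXn.
have : 0 < (2 ^+ (P.1 - Q.1) : int) by rewrite exprn_gt0.
move: (2 ^+ _ : int) (P.2 i) (Q.2 i) => E a b E0 /andP[ua ub] /andP[uc ud] /andP[va vb].
have E0' : (0 < E%:~R :> R) by rewrite ltr0z.
have H1 : E * b < a + 1.
  rewrite -(ltr_int R) rmorphM /=; apply: le_lt_trans ub.
  by rewrite ler_pM2l.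
have H2 : a < E * (b + 1).
  rewrite -(ltr_int R) rmorphM /=; apply: le_lt_trans ua _.
  by rewrite ltr_pM2l.
have H3 : E * (b - 1) <= a - 1 by nia.
have H4 : a + 2 <= E * (b + 2) by nia.
rewrite -(ler_pM2l E0') -(ltr_pM2l E0') -!intrM; apply/andP; split.
  by apply: le_trans va; rewrite ler_int.
by apply: lt_le_trans vb _; rewrite ler_int.
Qed.

(* The triple of [(j, a)] starts at [l0 / 2 ^ j * (a - 1)]. Triples of generations
   [j <= k] are nested or disjoint when [b - 1] and [2 ^ (k - j) * (a - 1)] agree
   modulo 3; as [4 = 1] modulo 3, this says that [2 ^ j * (a - 1)] and
   [2 ^ k * (b - 1)] agree modulo 3. *)
Definition tri_class (Q : cubeidx) : {ffun 'I_n -> 'I_3} :=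
  [ffun i => inord `|((2 ^+ Q.1 * (Q.2 i - 1)) %% 3)%Z|%N].

Lemma tri_nested (P Q : cubeidx) : tri_class P = tri_class Q -> (Q.1 <= P.1)%N ->
  tri P `&` tri Q !=set0 -> tri P `<=` tri Q.
Proof.
move=> /ffunP PQ QP [y [/tri_coordP Py /tri_coordP Qy]] x /tri_coordP Px.
apply/tri_coordP => i; have := PQ i; rewrite !ffunE => eqc.
have mod3 (z : int) : (`|(z %% 3)%Z| < 3)%N by lia.
have {}eqc : ((2 ^+ P.1 * (P.2 i - 1)) = (2 ^+ Q.1 * (Q.2 i - 1)) %[mod 3])%Z.
  have := congr1 val eqc; rewrite /= !inordK ?mod3//; lia.
have := Px i; have := Py i; have := Qy i.
move: eqc; rewrite -(subnKC QP) !coord_shift exprD.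
have pow4 k : exists c : int, 2 ^+ k * 2 ^+ k = 3 * c + 1.
  elim: k => [|k [c IH]]; first by exists 0.
  by exists (4 * c + 1); rewrite !exprS; lia.
have [c1 e1] := pow4 Q.1; have [c2 e2] := pow4 (P.1 - Q.1)%N.
have -> : 2 ^+ (P.1 - Q.1) = (2 ^+ (P.1 - Q.1) : int)%:~R :> R by rewrite rmorphXn.
have : 0 < (2 ^+ (P.1 - Q.1) : int) by rewrite exprn_gt0.
move: (coord _ _ _) (coord _ _ _) e1 e2 => u v.
move: (2 ^+ Q.1 : int) (2 ^+ (P.1 - Q.1) : int) (P.2 i) (Q.2 i).
move=> J E a b e1 e2 E0 eqc /andP[u1 u2] /andP[u3 u4] /andP[v1 v2].
have [c3 e3] : exists c, J * E * (a - 1) - J * (b - 1) = 3 * c.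
  exists (((J * E * (a - 1)) %/ 3)%Z - ((J * (b - 1)) %/ 3)%Z).
  by rewrite {1}(divz_eq (J * E * (a - 1)) 3) {1}(divz_eq (J * (b - 1)) 3) eqc; ring.
(* Multiplying by J E, and using that J J and E E are 1 modulo 3, shows that a - 1 and E (b - 1)
   agree modulo 3; the witness collects the quotients. *)
have [k ek] : exists k, a - 1 = E * (b - 1) + 3 * k.
  exists (J * E * c3 - (a - 1) * (3 * c1 * c2 + c1 + c2) + c1 * E * (b - 1)).
  have : J * E * (J * E * (a - 1) - J * (b - 1)) = J * E * (3 * c3) by rewrite e3.
  have -> : J * E * (J * E * (a - 1) - J * (b - 1)) =
    (J * J) * (E * E) * (a - 1) - (J * J) * E * (b - 1) by ring.
  rewrite e1 e2 => H; nia.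
have E0' : (0 < E%:~R :> R) by rewrite ltr0z.
(* In units of the side of [P], the triple of [Q] is tiled by E blocks of length 3 starting at E (b
   - 1). As the triples meet, that of [P] is the block number k, with 0 <= k < E. *)
have k1 : 0 <= k.
  rewrite leNgt; apply/negP => k0.
  have : a + 2 <= E * (b - 1) by nia.
  rewrite -(ler_int R) => /(lt_le_trans u4); rewrite rmorphM /= ltr_pM2l// ltNge.
  by rewrite u1.
have k2 : k < E.
  rewrite ltNge; apply/negP => k0.
  have : E * (b + 2) <= a - 1 by nia.
  rewrite -(ler_int R) rmorphM /= => /le_trans/(_ u3); rewrite ler_pM2l// leNgt.
  by rewrite u2.
have H3 : E * (b - 1) <= a - 1 by nia.
have H4 : a + 2 <= E * (b + 2) by nia.
rewrite -(ler_pM2l E0') -(ltr_pM2l E0') -!intrM; apply/andP; split.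
  by apply: le_trans v1; rewrite ler_int.
by apply: lt_le_trans v2 _; rewrite ler_int.
Qed.

End dyadic_cubes.

(** * Sets of small density in all dyadic subcubes are null *)

Section dyadic_density.
Context (R : realType) (n : nat) (x0 : 'rV[R]_n) (l0 : R) (l0_gt0 : 0 < l0).
Local Notation Rn := 'rV[R]_n.
Local Notation mu := (lebesgue_rV R n).
Local Notation dy := (dy x0 l0).
Local Notation at_ := (at_ x0 l0).

(** Unions of dyadic cubes of generation [j], expressed without naming the cubes. *)
Definition saturated (j : nat) (U : set Rn) := forall x y, at_ j x = at_ j y -> U x -> U y.

Lemma saturated_le j k U : (j <= k)%N -> saturated j U -> saturated k U.
Proof. by move=> jk Uj x y xy; apply: Uj; exact: at_le jk xy. Qed.

Lemma at_fiber_measurable j (P : set (cubeidx n)) : measurable [set x | P (at_ j x)].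
Proof.
rewrite (_ : [set x | P (at_ j x)] =
    \bigcup_(Q in [set Q | P Q /\ Q.1 = j]) dy Q); last first.
  apply/seteqP; split=> [x Px|x [Q [PQ <-]] /dyP Qx] /=.
    by exists (at_ j x) => //; exact: dy_at.
  by rewrite Qx.
by apply: countable_bigcup_measurable => Q; exact: measurable_dy.
Qed.

Lemma saturated_measurable j U : saturated j U -> measurable U.
Proof.
move=> Uj; rewrite (_ : U = [set x | [set Q | exists2 y, at_ j y = Q & U y] (at_ j x)]).
  exact: at_fiber_measurable.
apply/seteqP; split=> [x Ux|x [y yx Uy]] /=; first by exists x.
exact: Uj yx Uy.
Qed.

(** The cubes of generation [j] partition the space. Indexing them by the code of [at_ j x] makes
    the partition a sequence, possibly with empty members, to which countable additivity applies. *)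
Lemma dy_partition_le (j : nat) (c : R) (X Y : set Rn) :
  0 <= c -> measurable X -> measurable Y ->
  (forall P, P.1 = j -> mu (X `&` dy P) <= c%:E * mu (Y `&` dy P))%E ->
  (mu X <= c%:E * mu Y)%E.
Proof.
move=> c0 mX mY H.
pose F k := [set x | pickle (at_ j x) = k].
have mF k : measurable (F k) by exact: (at_fiber_measurable j [set Q | pickle Q = k]).
have part Z : measurable Z -> mu Z = (\sum_(0 <= k <oo) mu (Z `&` F k))%E.
  move=> mZ; have ZE : Z = \bigcup_k (Z `&` F k).
    apply/seteqP; split=> [x Zx|x [k _ []]//].
    by exists (pickle (at_ j x)).
  rewrite {1}ZE measure_bigcup//.
  - by apply: eq_eseriesl => k; rewrite in_setT.
  - by move=> k _; exact: measurableI.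
  - by move=> k h _ _ [x [[_ <-] [_ <-]]].
rewrite (part X)// (part Y)// -nneseriesZl; last by move=> k _.
apply: lee_nneseries => // k _.
have [->|/set0P[x Fx]] := eqVneq (F k) set0; first by rewrite !setI0 measure0 mule0.
have -> : F k = dy (at_ j x).
  apply/seteqP; split=> y.
    by rewrite /F /= -Fx => /(pcan_inj pickleK) yx; apply/dyP.
  by move=> /dyP /= yx; rewrite /F /= yx.
exact: H.
Qed.

Section approximation.
Variable Q0 : cubeidx n.

(* Approximation by finite unions of dyadic cubes; these sets form a sigma-algebra. *)
Definition approximable (B : set Rn) := measurable B /\ forall e : R, 0 < e ->
  exists j U, saturated j U /\
    (mu (((B `\` U) `|` (U `\` B)) `&` dy Q0) <= e%:E)%E.

Lemma approximable_saturated j U : saturated j U -> approximable U.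
Proof.
move=> Uj; split=> [|e e0]; first exact: saturated_measurable Uj.
by exists j, U; split=> //; rewrite setDv setU0 set0I measure0 lee_fin ltW.
Qed.

Lemma approximableC B : approximable B -> approximable (~` B).
Proof.
move=> [mB H]; split=> [|e e0]; first exact: measurableC.
have [j [U [Uj UB]]] := H e e0; exists j, (~` U); split.
  by move=> x y xy nUx Uy; apply: nUx; apply: Uj Uy.
have swap (C D : set Rn) : ~` C `\` ~` D = D `\` C by rewrite setDE setCK setIC -setDE.
by rewrite !swap setUC.
Qed.

Lemma approximableU B1 B2 : approximable B1 -> approximable B2 ->
  approximable (B1 `|` B2).
Proof.
move=> [mB1 H1] [mB2 H2]; split=> [|e e0]; first exact: measurableU.
have e20 : 0 < e / 2 by rewrite divr_gt0.
have [j1 [U1 [Uj1 UB1]]] := H1 _ e20; have [j2 [U2 [Uj2 UB2]]] := H2 _ e20.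
exists (maxn j1 j2), (U1 `|` U2); split.
  move=> x y xy [Ux|Ux]; [left|right].
    by apply: (saturated_le (leq_maxl j1 j2) Uj1) Ux.
  by apply: (saturated_le (leq_maxr j1 j2) Uj2) Ux.
have mU1 := saturated_measurable Uj1; have mU2 := saturated_measurable Uj2.
have mD A B : measurable A -> measurable B ->
    measurable (((A `\` B) `|` (B `\` A)) `&` dy Q0).
  move=> mA mB; apply: measurableI; last exact: measurable_dy.
  by apply: measurableU; exact: measurableD.
have -> : e = e / 2 + e / 2 by field.
rewrite EFinD; apply: le_trans (leeD UB1 UB2).
apply: le_trans (measureU2 _ _ _); [|exact: mD|exact: mD].
apply: le_measure; rewrite ?inE; [apply: mD; exact: measurableU| |].
  by apply: measurableU; exact: mD.
move=> x [[[[B1x|B2x] nU]|[[U1x|U2x] nB]] Qx].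
- by left; split=> //; left; split=> // ?; apply: nU; left.
- by right; split=> //; left; split=> // ?; apply: nU; right.
- by left; split=> //; right; split=> // ?; apply: nB; left.
- by right; split=> //; right; split=> // ?; apply: nB; right.
Qed.

(** Errors are measured inside [dy Q0], which has finite measure, so continuity from above applies:
    some [B k] misses at most e/2 of the union there, and an approximation of [B k] within e/2
    serves for the union. *)
Lemma approximable_nondecreasing (B : (set Rn)^nat) :
  (forall k, approximable (B k)) -> {homo B : i j / (i <= j)%N >-> i `<=` j} ->
  approximable (\bigcup_k B k).
Proof.
move=> H ndB; have mB k : measurable (B k) by case: (H k).
have mU : measurable (\bigcup_k B k) by exact: bigcupT_measurable.
split=> // e e0; have e20 : 0 < e / 2 by rewrite divr_gt0.
pose F k := ((\bigcup_k B k) `\` B k) `&` dy Q0.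
have mF k : measurable (F k).
  by apply: measurableI; [exact: measurableD|exact: measurable_dy].
have F0 : \bigcap_k F k = set0.
  apply/seteqP; split=> // x Fx; have [[[k _ Bx] _] _] := Fx 0%N I.
  by have [[_ +] _] := Fx k I; exact.
have [k Fk] : exists k, (mu (F k) <= (e / 2)%:E)%E.
  apply: contrapT => /forallNP nF.
  have cv : mu (F k) @[k --> \oo] --> 0%E.
    rewrite -(measure0 mu) -F0; apply: nonincreasing_cvg_mu => //.
    - apply: (@le_lt_trans _ _ (mu (dy Q0))).
        by apply: le_measure; rewrite ?inE//; [exact: measurable_dy|exact: subIsetr].
      by rewrite lebesgue_dy// ltry.
    - by rewrite F0.
    - move=> i j ij; apply/subsetPset => x [[Ux nBx] Qx]; split=> //; split=> //.
      by move=> Bx; apply: nBx; apply: ndB ij _ Bx.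
  have : ((e / 2)%:E <= limn (fun k => mu (F k)))%E.
    apply: lime_ge; first by apply/cvg_ex; eexists; exact: cv.
    by near=> k; apply/ltW; rewrite ltNge; apply/negP; exact: nF.
  by rewrite (cvg_lim _ cv)// lee_fin leNgt e20.
have [_ /(_ _ e20)[j [U [Uj UB]]]] := H k.
exists j, U; split=> //.
have mUU := saturated_measurable Uj.
have mD A C : measurable A -> measurable C ->
    measurable (((A `\` C) `|` (C `\` A)) `&` dy Q0).
  move=> mA mC; apply: measurableI; last exact: measurable_dy.
  by apply: measurableU; exact: measurableD.
have -> : e = e / 2 + e / 2 by field.
rewrite EFinD; apply: le_trans (leeD Fk UB).
apply: le_trans (measureU2 _ _ _) => //; last exact: mD.
apply: le_measure; rewrite ?inE; [exact: mD| |].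
  by apply: measurableU => //; exact: mD.
move=> x [[[Ux nUx]|[Ux nBx]] Qx].
- have [Bx|nBx] := pselect (B k x); last by left.
  by right; split=> //; left.
- by right; split=> //; right; split=> // Bx; apply: nBx; exists k.
Unshelve. all: by end_near. Qed.

Lemma approximable_bigcup (B : (set Rn)^nat) :
  (forall k, approximable (B k)) -> approximable (\bigcup_k B k).
Proof.
move=> H; rewrite -bigcup_bigsetU_bigcup.
apply: approximable_nondecreasing => [k|i j ij].
  elim: k => [|k IH]; first by rewrite big_ord_recl big_ord0 setU0.
  by rewrite big_ord_recr /=; exact: approximableU.
by apply: subset_bigsetU; rewrite ltnS.
Qed.

Lemma approximable_set0 : approximable set0.
Proof. by apply: (@approximable_saturated 0). Qed.

(** Exact exhaustion: the half-space is the union over j of the cubes of generation j whose right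
    end in direction i is at most a; the cubes being half-open, equality is allowed. *)
Lemma approximable_halfspace (i : 'I_n) (a : R) :
  approximable [set x : Rn | x ord0 i < a].
Proof.
rewrite (_ : [set x : Rn | x ord0 i < a] = \bigcup_j [set x : Rn |
    x0 ord0 i + side l0 j * ((at_ j x).2 i + 1)%:~R <= a]); last first.
  have split_coord j (x : Rn) : x ord0 i = x0 ord0 i + side l0 j * coord x0 l0 j x i.
    by rewrite /coord; field; rewrite gt_eqF// side_gt0.
  apply/seteqP; split=> [x /= xa|x [j _ /= H]]; last first.
    rewrite (split_coord j); apply: lt_le_trans H.
    rewrite ltrD2l ltr_pM2l ?side_gt0//.
    by rewrite ffunE; have /andP[] := floor_itv (coord x0 l0 j x i).
  have [j Hj] : exists j, side l0 j <= a - x ord0 i.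
    have ax0 : 0 < a - x ord0 i by rewrite subr_gt0.
    (* Large enough because 2^j >= j. *)
    pose j := (Num.truncn (l0 / (a - x ord0 i))).+1.
    exists j; rewrite /side ler_pdivrMr ?exprn_gt0// mulrC -ler_pdivrMr//.
    apply: (@le_trans _ _ j%:R); first by apply/ltW/truncnS_gt.
    by rewrite -natrX ler_nat ltnW// ltn_expl.
  exists j => //=; rewrite ffunE.
  move: Hj; rewrite lerBrDl; apply: le_trans.
  have /andP[+ _] := floor_itv (coord x0 l0 j x i).
  rewrite -(ler_pM2l (side_gt0 l0_gt0 j)) rmorphD /= mulrDr mulr1 addrA lerD2r.
  by move=> H; rewrite [leRHS](split_coord j) lerD2l.
apply: approximable_bigcup => j; apply: (@approximable_saturated j) => x y xy.
by rewrite /mkset xy.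
Qed.

Lemma measurable_approximable B : measurable B -> approximable B.
Proof.
apply: smallest_sub.
  split=> [|A HA|F HF]; first exact: approximable_set0.
    by rewrite setTD; exact: approximableC.
  exact: approximable_bigcup.
move=> A; rewrite -bigcup_seq => -[i _ [C mC <-]]; rewrite setTI.
have mE : measurable = (RGenInftyO.G (R:=R)).-sigma.-measurable :> set (set R).
  exact: RGenInftyO.measurableE.
move: C mC; rewrite mE.
apply: smallest_sub.
  split=> [|A' HA|F HF]; rewrite /=.
  - by rewrite preimage_set0; exact: approximable_set0.
  - by rewrite setTD preimage_setC; exact: approximableC.
  - by rewrite preimage_bigcup; exact: approximable_bigcup.
move=> _ [a ->] /=.
rewrite (_ : _ @^-1` _ = [set x : Rn | x ord0 i < a]); first exact: approximable_halfspace.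
by apply/seteqP; split=> x /=; rewrite in_itv.
Qed.

End approximation.

(** Approximating [A] within e by a union [U] of dyadic cubes and applying the density bound in each
    cube of [U] gives mu A <= c (mu A + e) + e. As c < 1, letting e tend to 0 forces mu A = 0. *)
Lemma dyadic_density (Q0 : cubeidx n) (c : R) (A : set Rn) :
  0 <= c -> c < 1 -> measurable A -> A `<=` dy Q0 ->
  (forall P, (Q0.1 <= P.1)%N -> dy P `<=` dy Q0 ->
     (mu (A `&` dy P) <= c%:E * mu (dy P))%E) ->
  mu A = 0%E.
Proof.
move=> c0 c1 mA AQ H.
have Afin : (mu A < +oo)%E.
  apply: (@le_lt_trans _ _ (mu (dy Q0))); last by rewrite lebesgue_dy// ltry.
  by apply: le_measure; rewrite ?inE//; exact: measurable_dy.
have key (e : R) : 0 < e -> (mu A <= c%:E * (mu A + e%:E) + e%:E)%E.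
  move=> e0; have [_ /(_ e e0)[j [U [Uj UA]]]] := measurable_approximable Q0 mA.
  (* Refined to the generation of [Q0] at least, so that the cubes meeting [A] lie in [dy Q0], where
     the density hypothesis applies. *)
  have {}Uj := saturated_le (leq_maxl j Q0.1) Uj.
  have mU := saturated_measurable Uj.
  have mD : measurable (((A `\` U) `|` (U `\` A)) `&` dy Q0).
    apply: measurableI; last exact: measurable_dy.
    by apply: measurableU; exact: measurableD.
  have AU : (mu (A `&` U) <= c%:E * mu (U `&` dy Q0))%E.
    apply: (@dy_partition_le (maxn j Q0.1)) => //.
    - exact: measurableI.
    - by apply: measurableI => //; exact: measurable_dy.
    - move=> P Pj.
      have [->|/set0P[x [[Ax Ux] Px]]] := eqVneq (A `&` U `&` dy P) set0.
        by rewrite measure0 mule_ge0.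
      have PQ : dy P `<=` dy Q0.
        apply: dy_nested => //; first by rewrite Pj leq_maxr.
        by exists x; split=> //; exact: AQ.
      have PU : dy P `<=` U.
        move=> y /(dyP _ l0_gt0) Py; apply: Uj Ux; move/(dyP _ l0_gt0) : Px.
        by rewrite -Pj Py.
      rewrite -setIA (setIidr PU) -setIA (setIidr PQ) (setIidr PU).
      by apply: H => //; rewrite Pj leq_maxr.
  apply: (@le_trans _ _ (mu (A `&` U) + e%:E)%E).
    apply: le_trans (leeD (lexx _) UA).
    apply: le_trans (measureU2 _ _ _) => //; last exact: measurableI.
    apply: le_measure; rewrite ?inE//; first by apply: measurableU => //; exact: measurableI.
    move=> x Ax; have [Ux|nUx] := pselect (U x); first by left.
    by right; split; [left|exact: AQ].
  rewrite leeD2r//; apply: le_trans AU _; rewrite lee_wpmul2l ?lee_fin//.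
  apply: le_trans (leeD (lexx _) UA).
  apply: le_trans (measureU2 _ _ _) => //.
  apply: le_measure; rewrite ?inE//.
  - by apply: measurableI => //; exact: measurable_dy.
  - exact: measurableU.
  - move=> x [Ux Qx]; have [Ax|nAx] := pselect (A x); first by left.
    by right; split=> //; right.
have Af : mu A \is a fin_num by rewrite ge0_fin_numE.
rewrite -(fineK Af); congr EFin; apply/eqP; rewrite eq_le fine_ge0// andbT.
rewrite leNgt; apply/negP => a0; set a := fine _ in a0.
have c1' : 0 < 1 - c by rewrite subr_gt0.
(* With this e the inequality gives (1 - c) a <= (1 + c) e < 2 e = (1 - c) a / 2, a
   contradiction. *)
have z0 : 0 < (1 - c) * a / 4 by rewrite divr_gt0// mulr_gt0.
have := key _ z0; rewrite -(fineK Af) -/a -!(EFinM, EFinD) lee_fin.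
have : c * ((1 - c) * a / 4) < (1 - c) * a / 4 by rewrite -[ltRHS]mul1r ltr_pM2r.
nra.
Qed.

End dyadic_density.

(** * Oscillation of the localized operator *)

Lemma integral_power_measure d (T : measurableType d) (R : realType)
    (mu : {sigma_finite_measure set T -> \bar R}) m (h : 'I_m -> T -> R) :
  (forall i, measurable_fun [set: T] (h i)) -> (forall i x, 0 <= h i x) ->
  (\int[power_measure mu m]_y (\prod_i h i (tnth y i))%:E =
    \prod_i \int[mu]_x (h i x)%:E)%E.
Proof.
elim: m h => [|m IH] h mh h0.
  rewrite [RHS]big_ord0; under eq_integral do rewrite big_ord0.
  transitivity (1%:E * power_measure mu 0 setT)%E; first exact: integral_cst.
  by rewrite /= diracT mul1e.
have mprod k (g : 'I_k -> T -> R) : (forall i, measurable_fun [set: T] (g i)) ->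
    measurable_fun [set: k.-tuple T] (fun y => (\prod_i g i (tnth y i))).
  move=> mg; apply: measurable_prod => i _; apply: measurableT_comp => //.
  exact: measurable_tnth.
have mf := mprod _ _ mh.
transitivity (\int[pushforward (mu \x power_measure mu m)%E (@tuple_cons _ T m)]_y
    (\prod_i h i (tnth y i))%:E)%E.
  by apply: eq_measure_integral => [|A mA _]; first exact: measurable_tuple_cons.
rewrite ge0_integral_pushforward//; last 3 first.
- exact: measurable_tuple_cons.
- exact/measurable_EFinP.
- by move=> y _; rewrite lee_fin prodr_ge0.
rewrite preimage_setT fubini_tonelli1; last 2 first.
- apply: measurableT_comp; first exact/measurable_EFinP.
  exact: measurable_tuple_cons.
- by move=> z; rewrite /= lee_fin prodr_ge0.
rewrite big_ord_recl -IH//.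
set c := (\int[_]_y (\prod_i h (lift ord0 i) (tnth y i))%:E)%E.
transitivity (\int[mu]_x ((h ord0 x)%:E * c))%E; last first.
  rewrite ge0_integralZr//.
  - exact/measurable_EFinP.
  - by move=> x _; rewrite lee_fin.
  - by apply: integral_ge0 => y _; rewrite lee_fin prodr_ge0.
apply: eq_integral => x _; rewrite /fubini_F /c -ge0_integralZl//; last 3 first.
- by apply/measurable_EFinP; apply: (mprod m (fun i => h (lift ord0 i))).
- by move=> y _; rewrite lee_fin prodr_ge0.
- by rewrite lee_fin.
apply: eq_integral => y _; rewrite /= big_ord_recl EFinM (_ : tnth _ ord0 = x)//.
congr (_ * _%:E)%E; apply: eq_bigr => i _; congr (h _ _).
by rewrite (tnth_nth x) [RHS](tnth_nth x).
Qed.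

Section restriction.
Context (R : realType) (n : nat).
Local Notation Rn := 'rV[R]_n.
Local Notation mu := (lebesgue_rV R n).

Definition restr (f : Rn -> R) (B : set Rn) : Rn -> R := fun z => f z * \1_B z.

Lemma restr_in f (B : set Rn) z : B z -> restr f B z = f z.
Proof. by move=> Bz; rewrite /restr indicE mem_set// mulr1. Qed.

Lemma restr_out f (B : set Rn) z : ~ B z -> restr f B z = 0.
Proof. by move=> Bz; rewrite /restr indicE memNset// mulr0. Qed.

Lemma L1_restr f (B : set Rn) : measurable B -> L1 f -> L1 (restr f B).
Proof.
move=> mB; rewrite /L1 => fi; apply: (le_integrable _ _ _ fi) => //.
  apply/measurable_EFinP; apply: measurable_funM => //.
  by apply/measurable_EFinP; exact: measurable_int fi.
move=> x _ /=; rewrite lee_fin /restr indicE.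
by case: (x \in B); rewrite ?mulr1 ?mulr0 ?normr0.
Qed.

Lemma L1_measurable (f : Rn -> R) : L1 f -> measurable_fun [set: Rn] f.
Proof. by move=> fi; apply/measurable_EFinP; exact: measurable_int fi. Qed.

Definition mass (f : Rn -> R) (B : set Rn) : R := fine (\int[mu]_(x in B) `|f x|%:E).

Lemma mass_ge0 f B : 0 <= mass f B.
Proof. by rewrite fine_ge0//; apply: integral_ge0 => x _; rewrite lee_fin. Qed.

Lemma massE f B : measurable B -> L1 f -> (\int[mu]_(x in B) `|f x|%:E = (mass f B)%:E)%E.
Proof.
move=> mB fi; rewrite fineK// ge0_fin_numE; last first.
  by apply: integral_ge0 => x _; rewrite lee_fin.
have := integrableS measurableT mB (@subsetT _ _) fi.
by move=> /integrableP[_].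
Qed.

End restriction.

Section kernel_oscillation.
Context (R : realType) (n m : nat) (x0 : 'rV[R]_n) (l0 : R) (l0_gt0 : 0 < l0).
Local Notation Rn := 'rV[R]_n.
Local Notation mu := (lebesgue_rV R n).
Local Notation dy := (dy x0 l0).
Local Notation tri := (tri x0 l0).
Local Notation at_ := (at_ x0 l0).
Local Notation side := (side l0).

(** The ancestor [k] generations above [P], found from the lower corner of [P]. The truncated
    subtraction stops at generation 0, whence the conditions [k <= P.1] wherever the side
    matters. *)
Definition up (P : cubeidx n) (k : nat) : cubeidx n :=
  at_ (P.1 - k) (corner x0 l0 P 0).

Lemma up0 P : up P 0 = P.
Proof. by rewrite /up subn0; apply/dyP => //; exact: dy_nonempty. Qed.

Lemma up_level P k : (up P k).1 = (P.1 - k)%N. Proof. by []. Qed.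

Lemma dy_up P k : dy P `<=` dy (up P k).
Proof.
apply: dy_nested => //; first by rewrite up_level leq_subr.
exists (corner x0 l0 P 0); split; first exact: dy_nonempty.
exact: dy_at.
Qed.

Lemma up_ancestor P Q : (Q.1 <= P.1)%N -> dy P `<=` dy Q -> Q = up P (P.1 - Q.1).
Proof.
move=> QP PQ; rewrite /up subKn//; apply/esym/dyP => //.
exact/PQ/dy_nonempty.
Qed.

Lemma dy_up_le P k h : (k <= h)%N -> dy (up P k) `<=` dy (up P h).
Proof.
move=> kh; apply: dy_nested => //; first by rewrite !up_level leq_sub2l.
exists (corner x0 l0 P 0); split; exact/dy_up/dy_nonempty.
Qed.

Lemma tri_up_le P k h : (k <= h)%N -> tri (up P k) `<=` tri (up P h).
Proof.
move=> kh; apply: tri_sub => //; first by rewrite !up_level leq_sub2l.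
exact: dy_up_le.
Qed.

Lemma side_up P k : (k <= P.1)%N -> side (up P k).1 = 2 ^+ k * side P.1.
Proof. by move=> kP; rewrite up_level (side_shift l0 _ k) subnK. Qed.

Lemma dy_center P : dy P (cube_center (corner x0 l0 P 0) (side P.1)).
Proof.
have s0 := side_gt0 l0_gt0 P.1.
by move=> i; rewrite !mxE; apply/andP; split; lra.
Qed.

(** The dilate extends by one side of [up P k] in each direction from the center of [P], a point of
    that ancestor, hence stays in its triple. This links the dilates of [kernel_regularity], for t =
    2^(k + 1), to triples of ancestors. *)
Lemma dilate_sub_tri_up P k : (k <= P.1)%N ->
  cube_dilate (corner x0 l0 P 0) (side P.1) (2 ^+ k.+1) `<=` tri (up P k).
Proof.
move=> kP _ [z Pz <-] i.
have := dy_up k Pz i; have := Pz i.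
have := dy_up k (dy_center P) i.
have := dy_up k (dy_nonempty x0 l0_gt0 P) i.
rewrite /cube_center !mxE !(side_up kP).
have := side_gt0 l0_gt0 P.1; move: (side P.1) => s s0.
rewrite exprS; have : 1 <= 2 ^+ k :> R by rewrite exprn_ege1// ler1n.
move: (2 ^+ k : R) (x0 _ _) (z _ _) ((up P k).2 i) (P.2 i) => t u w a b t1.
rewrite !rmorphD /= rmorphN1 !addr0 => /andP[h1 _] /andP[_ h2] /andP[h3 h4] _.
have ts : 0 < t * s by apply: mulr_gt0 => //; exact: lt_le_trans t1.
have t0 : 0 < t by exact: lt_le_trans t1.
have h7 : 0 <= t * (w - (u + s * b%:~R)) by rewrite mulr_ge0 ?subr_ge0// ltW.
have h8 : t * (w - (u + s * b%:~R)) < t * s by rewrite ltr_pM2l// ltrBlDl.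
have -> : 2 * t * (w - (u + s * b%:~R + s / 2)) =
  2 * (t * (w - (u + s * b%:~R))) - t * s by field.
move: (t * (w - _)) h7 h8 => y h7 h8.
have -> : u + t * s * (a%:~R + -1) = u + t * s * a%:~R - t * s by ring.
move: (t * s) (t * s * a%:~R) (s * b%:~R) h1 h2 h8 ts => e f g *.
apply/andP; split; lra.
Qed.

Variables (K : Rn -> m.-tuple Rn -> R) (rho : R -> R) (C : R).
Hypothesis mK : measurable_fun [set: Rn * m.-tuple Rn]
  (fun z : Rn * m.-tuple Rn => K z.1 z.2).
Hypotheses (C_ge0 : 0 <= C) (rho_ge0 : forall t, 0 <= t -> 0 <= rho t).
Hypotheses (sizeK : kernel_size K C) (regK : kernel_regularity K rho C).

Definition kernel_integrand (F : 'I_m -> Rn -> R) x (y : m.-tuple Rn) : R :=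
  K x y * \prod_(i < m) F i (tnth y i).

Lemma measurable_tensor (F : 'I_m -> Rn -> R) : (forall i, measurable_fun setT (F i)) ->
  measurable_fun [set: m.-tuple Rn] (fun y => \prod_(i < m) F i (tnth y i)).
Proof.
move=> mF; apply: measurable_prod => i _; apply: measurableT_comp => //.
exact: measurable_tnth.
Qed.

Lemma measurable_kernel_integrand F x : (forall i, measurable_fun setT (F i)) ->
  measurable_fun [set: m.-tuple Rn] (kernel_integrand F x).
Proof.
move=> mF; apply: measurable_funM; last exact: measurable_tensor.
exact: (measurable_fun_pair2 x mK).
Qed.

Lemma euclidean_norm_ge (x : Rn) i : `|x ord0 i| <= euclidean_norm x.
Proof.
rewrite -sqrtr_sqr ler_wsqrtr// (bigD1 i)//= lerDl.
by apply: sumr_ge0 => j _; exact: sqr_ge0.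
Qed.

Lemma far_from_tri P x y : dy P x -> ~ tri P y -> side P.1 <= euclidean_norm (x - y).
Proof.
move=> Px; apply: contra_notP => /negP; rewrite -ltNge => xy i.
have := le_lt_trans (euclidean_norm_ge (x - y) i) xy.
rewrite ltr_norml !mxE; have := Px i; rewrite !mxE !rmorphD /=.
move: (side_gt0 l0_gt0 P.1) => s0.
move=> /andP[h1 h2] /andP[h3 h4]; apply/andP; split; nra.
Qed.

Lemma kernel_bound P x y i : dy P x -> ~ tri P (tnth y i) ->
  `|K x y| <= C / side P.1 ^+ (n * m).
Proof.
move=> Px yi; have far := far_from_tri Px yi.
have s0 := side_gt0 l0_gt0 P.1.
apply: le_trans (sizeK _) _.
  by exists i; apply: contra_notN yi => /eqP ->; exact: dy_sub_tri.
have le : side P.1 <= \big[Num.max/0]_(i0 < m) euclidean_norm (x - tnth y i0).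
  by apply: le_trans far _; rewrite (bigD1 i)//= le_max lexx.
apply: ler_wpM2l => //; rewrite lef_pV2 ?posrE ?exprn_gt0//; last exact: lt_le_trans le.
by apply: lerXn2r; rewrite ?nnegrE//; [exact: ltW|apply: le_trans le; exact: ltW].
Qed.

(** Since [F i0] vanishes on the triple of [P], the integration stays away from the singularity,
    where [kernel_bound] makes the kernel bounded. *)
Lemma kernel_integrable P x F i0 : dy P x -> (forall i, L1 (F i)) ->
  (forall z, tri P z -> F i0 z = 0) ->
  (power_measure mu m).-integrable setT (EFin \o kernel_integrand F x).
Proof.
move=> Px FL1 F0; have mF i := L1_measurable (FL1 i).
apply/integrableP; split; first by apply/measurable_EFinP; exact: measurable_kernel_integrand.
have mnF : measurable_fun [set: m.-tuple Rn]
    (fun y => \prod_i `|F i (tnth y i)|).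
  by apply: (@measurable_tensor (fun i z => `|F i z|)) => i; exact: measurableT_comp.
apply: (@le_lt_trans _ _ (\int[power_measure mu m]_y
    ((C / side P.1 ^+ (n * m))%:E * (\prod_i `|F i (tnth y i)|)%:E))%E).
  apply: ge0_le_integral => //.
  - apply: measurableT_comp => //.
    by apply/measurable_EFinP; exact: measurable_kernel_integrand.
  - by apply: measurable_funeM; exact/measurable_EFinP.
  - move=> y _; rewrite /= -EFinM lee_fin /kernel_integrand normrM normr_prod.
    have [yi|yi] := pselect (tri P (tnth y i0)).
      by rewrite (bigD1 i0)//= F0// normr0 mul0r !mulr0.
    by rewrite ler_wpM2r ?prodr_ge0// (kernel_bound Px yi).
have s0 := side_gt0 l0_gt0 P.1.
rewrite ge0_integralZl//; last 3 first.
- exact/measurable_EFinP.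
- by move=> y _; rewrite lee_fin prodr_ge0.
- by rewrite lee_fin divr_ge0// exprn_ge0// ltW.
rewrite (@integral_power_measure _ _ _ mu m (fun i x => `|F i x|))//; last first.
  by move=> i; exact: measurableT_comp.
rewrite (eq_bigr (fun i => (mass (F i) setT)%:E)) => [|i _]; last by rewrite massE.
by rewrite prodEFin -EFinM ltry.
Qed.

(** Where the integrand does not vanish, all y_i lie in the triple of [up P s] and y_i0 lies off
    that of [P]. Hence some k < s has all y_i in the triple of [up P k.+1] and one of them off that
    of [up P k]. There regularity with t = 2^(k + 1) gives the k-th term. *)
Lemma kernel_oscillation P s x1 x2 F i0 : (s <= P.1)%N -> dy P x1 -> dy P x2 ->
  (forall i, L1 (F i)) -> (forall z, tri P z -> F i0 z = 0) ->
  (forall i z, ~ tri (up P s) z -> F i z = 0) ->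
  `|fine (\int[power_measure mu m]_y (kernel_integrand F x1 y)%:E) -
    fine (\int[power_measure mu m]_y (kernel_integrand F x2 y)%:E)| <=
  \sum_(k < s) C / (2 ^+ k.+1 * side P.1) ^+ (m * n) * rho (2 ^+ k.+1)^-1 *
    \prod_i mass (F i) (tri (up P k.+1)).
Proof.
move=> sP Px1 Px2 FL1 F0 FQ; have mF i := L1_measurable (FL1 i).
have int1 := kernel_integrable Px1 FL1 F0; have int2 := kernel_integrable Px2 FL1 F0.
have s0 := side_gt0 l0_gt0 P.1.
pose c k := C / (2 ^+ k.+1 * side P.1) ^+ (m * n) * rho (2 ^+ k.+1)^-1.
have c0 k : 0 <= c k.
  by rewrite mulr_ge0 ?rho_ge0 ?divr_ge0 ?exprn_ge0 ?mulr_ge0// ltW// ?exprn_gt0// invr_gt0 exprn_gt0.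
pose g k i z := `|restr (F i) (tri (up P k.+1)) z|.
have g0 k i z : 0 <= g k i z by rewrite /g.
have mg k i : measurable_fun setT (g k i).
  apply: measurableT_comp => //; apply: measurable_funM => //.
  by apply: measurable_indic; exact: measurable_tri.
have mt k : measurable_fun [set: m.-tuple Rn] (fun y => \prod_i g k i (tnth y i)).
  exact: measurable_tensor.
rewrite -lee_fin -/c.
have -> : (`|fine (\int[power_measure mu m]_y (kernel_integrand F x1 y)%:E) -
    fine (\int[power_measure mu m]_y (kernel_integrand F x2 y)%:E)|%:E =
    `|\int[power_measure mu m]_y (kernel_integrand F x1 y - kernel_integrand F x2 y)%:E|)%E.
  under [in RHS]eq_integral do rewrite EFinB.
  rewrite integralB_EFin//.
  rewrite -[X in (`|X - _|)%E]fineK; last exact: integrable_fin_num.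
  by rewrite -[X in (`|_ - X|)%E]fineK//; exact: integrable_fin_num.
have mdiff : measurable_fun [set: m.-tuple Rn]
    (fun y => (kernel_integrand F x1 y - kernel_integrand F x2 y)%:E).
  apply/measurable_EFinP; apply: measurable_funB; exact: measurable_kernel_integrand.
apply: le_trans (le_abse_integral _ _ _) _ => //.
apply: (@le_trans _ _ (\int[power_measure mu m]_y
    \sum_(k < s) ((c k)%:E * (\prod_i g k i (tnth y i))%:E))%E).
  apply: ge0_le_integral => //.
  - exact: measurableT_comp.
  - apply: emeasurable_sum => k; apply: measurable_funeM; exact/measurable_EFinP.
  - move=> y _; under eq_bigr do rewrite -EFinM.
    rewrite sumEFin abse_EFin lee_fin -mulrBl normrM normr_prod.
    have term0 k : 0 <= c k * \prod_i g k i (tnth y i) by rewrite mulr_ge0// prodr_ge0//.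
    have [/existsP[i /eqP yi]|/existsPn yn] := boolP [exists i, F i (tnth y i) == 0].
      rewrite [X in _ * X](bigD1 i)//= yi normr0 mul0r mulr0.
      by apply: sumr_ge0 => k _.
    have y0 : ~ tri (up P 0) (tnth y i0).
      by rewrite up0 => /F0 /eqP; rewrite (negbTE (yn i0)).
    have ys i : tri (up P s) (tnth y i).
      by apply: contrapT => /(FQ i) /eqP; rewrite (negbTE (yn i)).
    have [k [ks yk yk1]] : exists k, [/\ (k < s)%N,
        exists i, ~ tri (up P k) (tnth y i) & forall i, tri (up P k.+1) (tnth y i)].
      elim: s ys {sP FQ term0} => [/(_ i0)//|s IH ys].
      have [ys'|/existsNP yk] := pselect (forall i, tri (up P s) (tnth y i)).
        by have [k [ks yk yk1]] := IH ys'; exists k; split=> //; exact: ltnW.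
      by exists s.
    rewrite (bigD1 (Ordinal ks))//= -[leLHS]addr0; apply: lerD; last by apply: sumr_ge0.
    apply: ler_pM => //; first by rewrite prodr_ge0.
      apply: regK Px1 Px2 _ _ => //; first by rewrite exprS ler_peMr// exprn_ege1// ler1n.
      have [i yi] := yk; exists i => /dilate_sub_tri_up; apply: contra_not yi => H.
      by apply: H; exact: (leq_trans (ltnW ks)).
    by apply: ler_prod => i _; rewrite normr_ge0 /= /g restr_in.
rewrite ge0_integral_sum//; last 2 first.
- move=> k; apply: measurable_funeM; exact/measurable_EFinP.
- by move=> k y _; rewrite mule_ge0 ?lee_fin ?prodr_ge0.
rewrite -sumEFin; apply: lee_sum => k _.
rewrite ge0_integralZl//; last 3 first.
- exact/measurable_EFinP.
- by move=> y _; rewrite lee_fin prodr_ge0.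
- by rewrite lee_fin.
rewrite integral_power_measure//.
rewrite -/(c k) [leRHS]EFinM -prodEFin; apply: lee_wpmul2l; first by rewrite lee_fin.
rewrite le_eqVlt; apply/orP; left; apply/eqP; apply: eq_bigr => i _.
rewrite -massE//; last exact: measurable_tri.
rewrite [RHS]integral_mkcond; apply: eq_integral => z _.
by rewrite /g /restr /patch indicE; case: ifP; rewrite ?mulr1 ?mulr0 ?normr0.
Qed.

End kernel_oscillation.

(** * Change of the operator between a cube and an ancestor *)

Section localization_difference.
Context (R : realType) (n m : nat) (x0 : 'rV[R]_n) (l0 : R) (l0_gt0 : 0 < l0).
Local Notation Rn := 'rV[R]_n.
Local Notation mu := (lebesgue_rV R n).
Local Notation dy := (dy x0 l0).
Local Notation tri := (tri x0 l0).
Local Notation up := (up x0 l0).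
Local Notation side := (side l0).
Variables (T : ('I_m -> Rn -> R) -> Rn -> R).
Variables (K : Rn -> m.-tuple Rn -> R) (rho : R -> R) (C : R).
Hypothesis T_multilinear : multilinear T.
Hypothesis mK : measurable_fun [set: Rn * m.-tuple Rn]
  (fun z : Rn * m.-tuple Rn => K z.1 z.2).
Hypothesis T_kernel : associated_kernel T K.
Hypotheses (C_ge0 : 0 <= C) (rho_ge0 : forall t, 0 <= t -> 0 <= rho t).
Hypotheses (sizeK : kernel_size K C) (regK : kernel_regularity K rho C).

Lemma mass_le (f g : Rn -> R) (B : set Rn) : measurable B -> L1 f -> L1 g ->
  (forall z, `|f z| <= `|g z|) -> mass f B <= mass g B.
Proof.
move=> mB fL1 gL1 fg; rewrite -lee_fin -!massE//.
have mabs (h : Rn -> R) : L1 h -> measurable_fun B (fun z => `|h z|%:E).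
  move=> hL1; apply: measurable_funTS; apply/measurable_EFinP.
  by apply: measurableT_comp => //; exact: L1_measurable.
by apply: ge0_le_integral => //; [exact: mabs|exact: mabs|move=> z _; rewrite lee_fin].
Qed.

(* The difference telescopes into [m] terms, in each of which one of the
   functions vanishes near the cube, so that the kernel representation applies. *)
Lemma localization_difference P s f : (s <= P.1)%N -> (forall i, L1 (f i)) ->
  exists2 G : Rn -> R,
    {ae mu, forall x, dy P x ->
      T (fun i => restr (f i) (tri (up P s))) x -
      T (fun i => restr (f i) (tri P)) x = G x} &
    forall x1 x2, dy P x1 -> dy P x2 -> `|G x1 - G x2| <=
      m%:R * \sum_(k < s) C / (2 ^+ k.+1 * side P.1) ^+ (m * n) *
        rho (2 ^+ k.+1)^-1 * \prod_i mass (f i) (tri (up P k.+1)).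
Proof.
move=> sP fL1; have [_ _ lin] := T_multilinear.
pose a i := restr (f i) (tri (up P s)); pose b i := restr (f i) (tri P).
have aL1 i : L1 (a i) by apply: L1_restr => //; exact: measurable_tri.
have bL1 i : L1 (b i) by apply: L1_restr => //; exact: measurable_tri.
pose D := tri (up P s) `\` tri P.
have mD : measurable D by apply: measurableD; exact: measurable_tri.
pose d i := restr (f i) D.
have dL1 i : L1 (d i) by exact: L1_restr.
have tPs : tri P `<=` tri (up P s).
  by rewrite -{1}(up0 x0 l0_gt0 P); exact: tri_up_le.
have adb i z : a i z = 1 * d i z + b i z.
  rewrite mul1r /a /b /d; have [Pz|nPz] := pselect (tri P z).
    by rewrite [restr _ D _]restr_out ?add0r ?restr_in//; [exact: tPs|case].
  rewrite [restr _ (tri P) _]restr_out// addr0.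
  have [Qz|nQz] := pselect (tri (up P s) z); first by rewrite !restr_in.
  by rewrite !restr_out//; case.
(* [h j] interpolates between the two localizations by switching the first j functions to the small
   triple. [F j] is the change from [h j] to [h j.+1]: its j-th function lives off the small
   triple. *)
pose h (j : nat) (i : 'I_m) := if (i < j)%N then b i else a i.
pose F (j : 'I_m) : 'I_m -> Rn -> R := dfwith (h j) j (d j).
have hL1 j i : L1 (h j i) by rewrite /h; case: ifP.
have FL1 j i : L1 (F j i) by rewrite /F; case: dfwithP.
have F0 j z : tri P z -> F j j z = 0.
  by move=> Pz; rewrite /F dfwithin /d restr_out//; case.
have FQ j i z : ~ tri (up P s) z -> F j i z = 0.
  rewrite /F => nQz; case: dfwithP => [|i' _]; first by rewrite /d restr_out//; case.
  by rewrite /h; case: ifP => _; rewrite /a /b restr_out// => /tPs.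
have Ff j i z : `|F j i z| <= `|f i z|.
  have rf g (B : set Rn) : `|restr g B z| <= `|g z|.
    have [Bz|nBz] := pselect (B z); first by rewrite restr_in.
    by rewrite restr_out// normr0.
  by rewrite /F; case: dfwithP => [|i' _]; rewrite /h ?rf//; case: ifP; rewrite rf.
pose I j x := fine (\int[power_measure mu m]_y (kernel_integrand K (F j) x y)%:E).
exists (fun x => \sum_(j < m) I j x); last first.
  move=> x1 x2 Px1 Px2; rewrite -sumrB; apply: le_trans (ler_norm_sum _ _ _) _.
  set X := \sum_(k < s) _.
  apply: (@le_trans _ _ (\sum_(j < m) X)); last by rewrite sumr_const card_ord mulr_natl.
  apply: ler_sum => j _.
  have /= := kernel_oscillation l0_gt0 mK C_ge0 rho_ge0 sizeK regK sP Px1 Px2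
    (FL1 j) (F0 j) (FQ j).
  move=> /le_trans; apply; apply: ler_sum => k _; apply: ler_wpM2l.
    have s0 := side_gt0 l0_gt0 P.1.
    by rewrite mulr_ge0 ?rho_ge0 ?invr_ge0 ?exprn_ge0// divr_ge0// exprn_ge0// mulr_ge0// ?exprn_ge0// ltW.
  apply: ler_prod => i _; rewrite mass_ge0 /=.
  by apply: mass_le => //; exact: measurable_tri.
have step (j : 'I_m) : {ae mu, forall x, dy P x ->
    T (h j) x - T (h j.+1) x = I j x}.
  have := lin (h j) j (d j) (b j) 1 (hL1 j) (dL1 j) (bL1 j).
  have -> : dfwith (h j) j (fun z => 1 * d j z + b j z) = h j.
    apply/funext => i; case: dfwithP => [|i' _//].
    by rewrite /h ltnn; apply/funext => z; rewrite adb.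
  have -> : dfwith (h j) j (b j) = h j.+1.
    apply/funext => i; case: dfwithP => [|i' ji]; first by rewrite /h ltnSn.
    by rewrite /h ltnS [(i' <= j)%N]leq_eqVlt -[val i' == _]/(i' == j) eq_sym (negbTE ji).
  rewrite -/(F j) => lin1; have := T_kernel (FL1 j).
  apply: filterS2 lin1 => x -> /= ker Px.
  rewrite mul1r addrK /I /kernel_integrand -ker//.
  exact: (kernel_integrable l0_gt0 mK C_ge0 sizeK Px (FL1 j) (F0 j)).
have all_steps : {ae mu, forall x, forall j : 'I_m, dy P x ->
    T (h j) x - T (h j.+1) x = I j x}.
  have : {ae mu, forall x, forall k : nat, forall j : 'I_m, j = k :> nat ->
      dy P x -> T (h j) x - T (h j.+1) x = I j x}.
    apply: ae_foralln => k; case: (ltnP k m) => km; last first.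
      by apply: aeW => x j jk; have := ltn_ord j; rewrite jk ltnNge km.
    apply: filterS (step (Ordinal km)) => x Hx j jk.
    by have -> : j = Ordinal km by apply: val_inj.
  by apply: filterS => x Hx j; exact: Hx.
apply: filterS all_steps => x Hx Px.
have -> : (fun i => restr (f i) (tri (up P s))) = h 0%N by [].
have -> : (fun i => restr (f i) (tri P)) = h m.
  by apply/funext => i; rewrite /h ltn_ord.
rewrite -(eq_bigr _ (fun j _ => Hx j Px)) -opprB.
rewrite -(telescope_sumr (fun j => T (h j) x) (leq0n m)) big_mkord -sumrN.
by apply: eq_bigr => j _; rewrite opprB.
Qed.

End localization_difference.

(** * Sparse domination *)

Lemma ae_countable d (T : measurableType d) (R : realType) (mu : {measure set T -> \bar R})
    (I : countType) (P : I -> T -> Prop) :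
  (forall i, {ae mu, forall x, P i x}) -> {ae mu, forall x, forall i, P i x}.
Proof.
move=> H; have : {ae mu, forall x, forall k : nat, forall i, pickle i = k -> P i x}.
  apply: ae_foralln => k; case e : (@pickle_inv I k) => [i|]; last first.
    by apply: aeW => x j jk; move: e; rewrite -jk pickleK_inv.
  apply: filterS (H i) => x Px j jk.
  by move: e; rewrite -jk pickleK_inv => -[->].
by apply: filterS => x Hx i; exact: Hx.
Qed.

Lemma measure_fin_bigcup_le d (T : measurableType d) (R : realType)
    (mu : {measure set T -> \bar R}) (I : finType) (F : I -> set T) (b : R) :
  (forall i, measurable (F i)) -> (forall i, mu (F i) <= b%:E)%E ->
  (mu (\bigcup_i F i) <= (#|I|%:R * b)%:E)%E.
Proof.
move=> mF Fb; rewrite (_ : \bigcup_i F i = \big[setU/set0]_(i <- enum I) F i); last first.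
  rewrite -bigcup_seq; apply/seteqP; split=> x [i _ Fx]; exists i => //=.
  by rewrite mem_enum.
rewrite cardE; elim: (enum I) => [|i s IH] /=.
  by rewrite big_nil measure0 mul0r.
rewrite big_cons -natr1 mulrDl mul1r addrC EFinD.
apply: le_trans (measureU2 _ _ _) _; [by []|exact: bigsetU_measurable|].
exact: leeD (Fb i) IH.
Qed.

Section stopping_cubes.
Context (R : realType) (n m : nat) (x0 : 'rV[R]_n) (l0 : R).
Hypotheses (l0_gt0 : 0 < l0) (m_gt0 : (0 < m)%N).
Local Notation Rn := 'rV[R]_n.
Local Notation mu := (lebesgue_rV R n).
Local Notation dy := (dy x0 l0).
Local Notation tri := (tri x0 l0).
Local Notation at_ := (at_ x0 l0).
Local Notation up := (up x0 l0).
Local Notation side := (side l0).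
Variables (T : ('I_m -> Rn -> R) -> Rn -> R).
Variables (K : Rn -> m.-tuple Rn -> R) (rho : R -> R) (C Cw Cr : R).
Hypothesis T_multilinear : multilinear T.
Hypothesis mK : measurable_fun [set: Rn * m.-tuple Rn]
  (fun z : Rn * m.-tuple Rn => K z.1 z.2).
Hypothesis T_kernel : associated_kernel T K.
Hypotheses (C_ge0 : 0 <= C) (rho_ge0 : forall t, 0 <= t -> 0 <= rho t).
Hypotheses (sizeK : kernel_size K C) (regK : kernel_regularity K rho C).
Hypothesis T_weak : weak_type_bound T Cw.
Hypothesis rho_sum : forall s, \sum_(k < s) rho (2 ^+ k.+1)^-1 <= Cr.
Variables (f : 'I_m -> Rn -> R).
Hypothesis fL1 : forall i, L1 (f i).

Definition avg i (Q : cubeidx n) : R := mass (f i) (tri Q) / (3 * side Q.1) ^+ n.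

Definition prod_avg (Q : cubeidx n) : R := \prod_i avg i Q.

Definition local_op (Q : cubeidx n) : Rn -> R := T (fun i => restr (f i) (tri Q)).

(* Chosen so that the weak type bound gives [measure_exceptional]; [growth] plays the
   same role for the maximal function in [avg_type_measure]. *)
Definition lam : R := (Num.max Cw 1 * 3 ^+ n * 2 ^+ (n + 3)) ^+ m.

Definition growth : R := 4 * m%:R * 9 ^+ n.

Definition exceptional (Q : cubeidx n) : set Rn :=
  dy Q `&` [set x | lam * prod_avg Q < `|local_op Q x|].

Definition strict_sub (P Q : cubeidx n) := (Q.1 < P.1)%N /\ dy P `<=` dy Q.

(** The threshold 2^-(n + 1) leaves room for the factor 2^n lost between a cube and its dyadic
    parent in [child_exceptional], so that 1/2 remains. *)
Definition bad (Q P : cubeidx n) :=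
  (exists i, growth * avg i Q < avg i P) \/
  ((2 ^- n.+1)%:E * mu (dy P) < mu (dy P `&` exceptional Q))%E.

Definition child (Q P : cubeidx n) := [/\ strict_sub P Q, bad Q P &
  forall S, strict_sub P S -> strict_sub S Q -> ~ bad Q S].

Lemma lam_gt0 : 0 < lam.
Proof.
rewrite /lam exprn_gt0// !mulr_gt0 ?exprn_gt0//.
by rewrite lt_max ltr01 orbT.
Qed.

Lemma growth_ge1 : 1 <= growth.
Proof.
rewrite /growth -[leLHS]mul1r ler_pM//.
  have : 1 <= m%:R :> R by rewrite ler1n.
  lra.
by rewrite exprn_ege1// ler1n.
Qed.

Lemma triple_side_gt0 j : 0 < (3 * side j) ^+ n.
Proof. by rewrite exprn_gt0// mulr_gt0// side_gt0. Qed.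

Lemma avg_ge0 i Q : 0 <= avg i Q.
Proof. by rewrite divr_ge0 ?mass_ge0// ltW// triple_side_gt0. Qed.

Lemma prod_avg_ge0 Q : 0 <= prod_avg Q.
Proof. by apply: prodr_ge0 => i _; exact: avg_ge0. Qed.

Lemma massE_avg i Q : mass (f i) (tri Q) = avg i Q * (3 * side Q.1) ^+ n.
Proof. by rewrite /avg divfK// gt_eqF// triple_side_gt0. Qed.

Lemma restr_tri_L1 Q i : L1 (restr (f i) (tri Q)).
Proof. by apply: L1_restr => //; exact: measurable_tri. Qed.

Lemma measurable_local_op Q : measurable_fun [set: Rn] (local_op Q).
Proof. by have [mT _ _] := T_multilinear; apply: mT => i; exact: restr_tri_L1. Qed.

Lemma measurable_level_set Q (a : R) : measurable [set x | a < `|local_op Q x|].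
Proof.
have mo : measurable_fun setT (fun x => `|local_op Q x|).
  by apply: measurableT_comp => //; exact: measurable_local_op.
rewrite (_ : [set x | _] = setT `&` (fun x => `|local_op Q x|) @^-1` `]a, +oo[%classic).
  exact: mo.
by rewrite setTI; apply/seteqP; split=> x /=; rewrite in_itv/= andbT.
Qed.

Lemma measurable_exceptional Q : measurable (exceptional Q).
Proof. by apply: measurableI; [exact: measurable_dy|exact: measurable_level_set]. Qed.

Lemma integral_restr_tri i Q :
  (\int[mu]_x `|restr (f i) (tri Q) x|%:E = (mass (f i) (tri Q))%:E)%E.
Proof.
rewrite -massE//; last exact: measurable_tri.
rewrite [RHS]integral_mkcond; apply: eq_integral => z _.
by rewrite /restr /patch indicE; case: ifP; rewrite ?mulr1 ?mulr0 ?normr0.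
Qed.

Lemma weak_type_local Q (a : R) : 0 < a ->
  (mu [set x | (a < `|local_op Q x|)%R] <=
   (Cw * (a^-1 * \prod_i mass (f i) (tri Q)) `^ m%:R^-1)%:E)%E.
Proof.
move=> a0; apply: le_trans (T_weak a0 (restr_tri_L1 Q)) _.
rewrite (eq_bigr (fun i => (mass (f i) (tri Q))%:E)) => [|i _]; last exact: integral_restr_tri.
by rewrite prodEFin -EFinM.
Qed.

Lemma measure_exceptional Q : (mu (exceptional Q) <= (2 ^- (n + 3))%:E * mu (dy Q))%E.
Proof.
have m0 : (0 < m%:R :> R) by rewrite ltr0n.
have s0 := side_gt0 l0_gt0 Q.1.
apply: (@le_trans _ _ (mu [set x | (lam * prod_avg Q < `|local_op Q x|)%R])).
  apply: le_measure; rewrite ?inE; [exact: measurable_exceptional|exact: measurable_level_set|].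
  exact: subIsetr.
(* The weak type bound requires a positive level. Here the product of the masses is 0, so every
   level 1/(k + 1) gives a null set, and so does their union. *)
have [g0|gn0] := eqVneq (prod_avg Q) 0.
  rewrite g0 mulr0.
  have M0 : \prod_i mass (f i) (tri Q) = 0.
    under eq_bigr do rewrite massE_avg.
    by rewrite big_split/= -/(prod_avg Q) g0 mul0r.
  have -> : [set x | 0 < `|local_op Q x|] =
      \bigcup_k [set x | (k.+1%:R)^-1 < `|local_op Q x|].
    apply/seteqP; split=> [x /= x0'|x [k _ /=]]; last by apply: lt_trans; rewrite invr_gt0.
    exists (Num.truncn (`|local_op Q x|^-1)) => //=.
    rewrite -[ltRHS]invrK ltf_pV2 ?posrE ?invr_gt0//.
    exact: truncnS_gt.
  rewrite measure_negligible ?mule_ge0 ?lee_fin ?invr_ge0 ?exprn_ge0//.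
    by apply: bigcupT_measurable => k; exact: measurable_level_set.
  apply: negligible_bigcup => k; apply/negligibleP; first exact: measurable_level_set.
  apply/eqP; rewrite eq_le measure_ge0 andbT.
  have k0 : (0 < (k.+1%:R)^-1 :> R) by rewrite invr_gt0.
  apply: le_trans (weak_type_local Q k0) _.
  by rewrite M0 mulr0 powR0 ?mulr0// gt_eqF// invr_gt0.
have g0 : 0 < prod_avg Q by rewrite lt_def gn0 prod_avg_ge0.
apply: le_trans (weak_type_local Q (mulr_gt0 lam_gt0 g0)) _.
rewrite lebesgue_dy// -EFinM lee_fin.
(* The power [m] in [lam] is undone by the exponent 1/m, and its factor 3^n by the volume of the
   triple. The maximum with 1 in [lam] is there because nothing is assumed on the sign of [Cw]. *)
have -> : (lam * prod_avg Q)^-1 * \prod_i mass (f i) (tri Q) =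
    ((3 * side Q.1) ^+ n / (Num.max Cw 1 * 3 ^+ n * 2 ^+ (n + 3))) ^+ m.
  under eq_bigr do rewrite massE_avg.
  rewrite big_split/= -/(prod_avg Q) prodr_const card_ord expr_div_n -/lam.
  by field; rewrite !gt_eqF// lam_gt0.
have c0 : 0 < Num.max Cw 1 by rewrite lt_max ltr01 orbT.
rewrite -powR_mulrn; last by rewrite divr_ge0 ?exprn_ge0 ?mulr_ge0 ?exprn_ge0// ltW.
rewrite -powRrM divff ?gt_eqF// powRr1; last first.
  by rewrite divr_ge0 ?exprn_ge0 ?mulr_ge0 ?exprn_ge0// ltW.
apply: (@le_trans _ _ (Num.max Cw 1 * ((3 * side Q.1) ^+ n /
    (Num.max Cw 1 * 3 ^+ n * 2 ^+ (n + 3))))).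
  rewrite ler_wpM2r ?le_max ?lexx//.
  by rewrite divr_ge0 ?exprn_ge0 ?mulr_ge0 ?exprn_ge0// ltW.
rewrite le_eqVlt; apply/orP; left; apply/eqP; rewrite exprMn; field.
by rewrite !expf_neq0 ?gt_eqF.
Qed.

(** Among the cubes between [P] and [Q], the bad one of least generation is the maximal one. *)
Lemma bad_child Q P : strict_sub P Q -> bad Q P ->
  exists S, [/\ child Q S, (S.1 <= P.1)%N & dy P `<=` dy S].
Proof.
move=> [QP PQ] bQP; pose z := corner x0 l0 P 0.
have Pz : dy P z by exact: dy_nonempty.
pose good j := `[< (Q.1 < j <= P.1)%N /\ bad Q (at_ j z) >].
have exj : exists j, good j.
  exists P.1; apply/asboolP; rewrite QP leqnn; split=> //.
  by move/(dyP _ l0_gt0) : Pz => ->.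
case: (ex_minnP exj) => j /asboolP[/andP[Qj jP] bj] jmin.
have dP k : (k <= P.1)%N -> dy P `<=` dy (at_ k z).
  by move=> kP; apply: dy_nested => //; exists z; split=> //; exact: dy_at.
have dQ k : (Q.1 <= k)%N -> dy (at_ k z) `<=` dy Q.
  by move=> Qk; apply: dy_nested => //; exists z; split; [exact: dy_at|exact: PQ].
exists (at_ j z); split=> //; last exact: dP.
split=> //; first by split=> //; exact/dQ/ltnW.
move=> S [Sj jS] [QS SQ] bS.
have /(dyP _ l0_gt0) Sz : dy S z by apply: jS; exact: dy_at.
have : good S.1 by apply/asboolP; rewrite QS (leq_trans (ltnW Sj))//= Sz.
by move/jmin; rewrite leqNgt Sj.
Qed.

(** Weak type bound for the maximal function over triples: within one class the triples are nested
    and [nested_weak] applies; the classes are then added. *)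
Lemma avg_type_measure Q i :
  (mu (\bigcup_(P in [set P | strict_sub P Q /\ (growth * avg i Q < avg i P)%R]) dy P) <=
    (#|{: {ffun 'I_n -> 'I_3}}|%:R * ((3 * side Q.1) ^+ n / growth))%:E)%E.
Proof.
have gr0 : 0 < growth by apply: lt_le_trans growth_ge1.
have V0 := triple_side_gt0 Q.1.
have mf : measurable_fun setT (fun z => `|f i z|).
  by apply: measurableT_comp => //; exact: L1_measurable.
pose S c := [set P | [/\ strict_sub P Q, growth * avg i Q < avg i P & tri_class P = c]].
apply: (@le_trans _ _ (mu (\bigcup_c \bigcup_(P in S c) tri P))).
  apply: le_measure; rewrite ?inE.
  - by apply: countable_bigcup_measurable => P; exact: measurable_dy.
  - apply: countable_bigcup_measurable => c.
    by apply: countable_bigcup_measurable => P; exact: measurable_tri.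
  - move=> x [P [PQ aP] Px]; exists (tri_class P) => //; exists P => //.
    exact: dy_sub_tri.
apply: measure_fin_bigcup_le => c.
  by apply: countable_bigcup_measurable => P; exact: measurable_tri.
apply: countable_bigcup_le => [P|s sS]; first exact: measurable_tri.
(* With zero mass on the triple of [Q] no smaller triple has a positive mean, so the family is
   empty; otherwise the threshold is positive and can be divided out. *)
have [a0|an0] := eqVneq (avg i Q) 0.
  case: s sS => [|P s] sS; first by rewrite set_nil bigcup_set0 measure0 lee_fin divr_ge0// ltW.
  have [[QP PQ] + _] := sS P (mem_head _ _).
  have mQ0 : mass (f i) (tri Q) = 0 by rewrite massE_avg a0 mul0r.
  rewrite a0 mulr0 ltNge /avg mulr_le0_ge0 ?invr_ge0 ?(ltW (triple_side_gt0 _))//.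
  rewrite -mQ0 -lee_fin -!massE//; try exact: measurable_tri.
  apply: ge0_subset_integral => //; [exact: measurable_tri|exact: measurable_tri| |].
    by apply: measurable_funTS; exact/measurable_EFinP.
  by apply: tri_sub => //; exact: ltnW.
have a0 : 0 < avg i Q by rewrite lt_def an0 avg_ge0.
have th0 : 0 < growth * avg i Q by rewrite mulr_gt0.
have mU : measurable (\bigcup_(P in [set` s]) tri P).
  by apply: countable_bigcup_measurable => P; exact: measurable_tri.
have nest : nested (fun P : cubeidx n => P.1) tri s.
  move=> P P' Ps P's; apply: tri_nested => //.
  by have [_ _ ->] := sS _ Ps; have [_ _ ->] := sS _ P's.
have H := nested_weak (mu := mu) (measurable_tri x0 l0) mf (fun z => normr_ge0 _)
  nest (ltW th0).
have : ((growth * avg i Q)%:E * mu (\bigcup_(P in [set` s]) tri P) <=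
    (mass (f i) (tri Q))%:E)%E.
  apply: le_trans (H _) _.
    move=> P /sS[_ aP _].
    suff : ((growth * avg i Q)%:E * mu (tri P) <= \int[mu]_(x in tri P) `|f i x|%:E)%E by [].
    rewrite lebesgue_tri// massE//; last exact: measurable_tri.
    rewrite -EFinM lee_fin massE_avg ler_wpM2r ?(ltW aP)//.
    exact/ltW/triple_side_gt0.
  rewrite -massE//; last exact: measurable_tri.
  apply: ge0_subset_integral => //; first exact: measurable_tri.
    by apply: measurable_funTS; exact/measurable_EFinP.
  move=> x [P /= /sS[[QP PQ] _ _]]; apply: tri_sub => //; exact: ltnW.
rewrite massE_avg => H2.
rewrite -(@lee_pmul2l _ (growth * avg i Q)%:E) ?lte_fin// -EFinM; apply: le_trans H2 _.
by rewrite lee_fin le_eqVlt; apply/orP; left; apply/eqP; field; rewrite gt_eqF.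
Qed.

(** Weak type bound for the dyadic maximal function of the indicator of the exceptional set: 2^(n +
    1) times 2^-(n + 3) is 1/4. *)
Lemma density_type_measure Q :
  (mu (\bigcup_(P in [set P | strict_sub P Q /\
      ((2 ^- n.+1)%:E * mu (dy P) < mu (dy P `&` exceptional Q))%E]) dy P) <=
    (side Q.1 ^+ n / 4)%:E)%E.
Proof.
have mE := measurable_exceptional Q.
apply: countable_bigcup_le => [P|s sS]; first exact: measurable_dy.
have mU : measurable (\bigcup_(P in [set` s]) dy P).
  by apply: countable_bigcup_measurable => P; exact: measurable_dy.
have th0 : 0 < 2 ^- n.+1 :> R by rewrite invr_gt0 exprn_gt0.
have nest : nested (fun P : cubeidx n => P.1) dy s.
  by move=> P P' Ps P's; exact: dy_nested.
have H : ((2 ^- n.+1)%:E * mu (\bigcup_(P in [set` s]) dy P) <= mu (exceptional Q))%E.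
  apply: le_trans (nested_weak (measurable_dy x0 l0) (g := \1_(exceptional Q)) _ _ nest (ltW th0) _) _ => //.
  - move=> P /sS[_ /ltW]; rewrite integral_indic// 1?setIC//.
    exact: measurable_dy.
  - rewrite integral_indic//; apply: le_measure; rewrite ?inE//.
    exact: measurableI.
rewrite -(@lee_pmul2l _ (2 ^- n.+1)%:E) ?lte_fin//; apply: le_trans H _.
apply: le_trans (measure_exceptional Q) _.
rewrite lebesgue_dy// -!EFinM lee_fin.
rewrite le_eqVlt; apply/orP; left; apply/eqP.
rewrite exprD (exprS 2 n); field; rewrite expf_neq0//.
Qed.

Lemma measure_children Q :
  (mu (\bigcup_(P in child Q) dy P) <= (2^-1)%:E * mu (dy Q))%E.
Proof.
pose U1 := \bigcup_(i : 'I_m) \bigcup_(P in [set P | strict_sub P Q /\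
   growth * avg i Q < avg i P]) dy P.
pose U2 := \bigcup_(P in [set P | strict_sub P Q /\
      ((2 ^- n.+1)%:E * mu (dy P) < mu (dy P `&` exceptional Q))%E]) dy P.
have mdyU (S : set (cubeidx n)) : measurable (\bigcup_(P in S) dy P).
  by apply: countable_bigcup_measurable => P; exact: measurable_dy.
have mU1 : measurable U1 by apply: countable_bigcup_measurable => i; exact: mdyU.
apply: (@le_trans _ _ (mu (U1 `|` U2))).
  apply: le_measure; rewrite ?inE; [exact: mdyU|by apply: measurableU => //; exact: mdyU|].
  move=> x [P [PQ [[i bi]|b] _] Px]; [left|right; exists P => //].
  by exists i => //; exists P.
apply: le_trans (measureU2 _ mU1 (mdyU _)) _.
rewrite lebesgue_dy//.
have -> : ((2^-1)%:E * (side Q.1 ^+ n)%:E = (side Q.1 ^+ n / 4)%:E + (side Q.1 ^+ n / 4)%:E)%E.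
  by rewrite -EFinM -EFinD; congr EFin; field.
apply: leeD (density_type_measure Q).
apply: le_trans (measure_fin_bigcup_le (fun i => mdyU _) (avg_type_measure Q)) _.
(* [growth] compensates [m] functions, 3^n classes and the volume factor 3^n of the triple, leaving
   1/4. *)
rewrite card_ord card_ffun !card_ord lee_fin le_eqVlt; apply/orP; left; apply/eqP.
rewrite /growth natrX exprMn (_ : 9 = 3 * 3 :> R) ?exprMn; last by rewrite -natrM.
field; rewrite expf_neq0//= pnatr_eq0 -lt0n m_gt0.
by [].
Qed.

(** Only the child itself is bad: by its maximality every cube strictly between it and [Q] is not.
    Estimates at a child are therefore read off its proper ancestors. *)
Lemma child_ancestor Q P k : child Q P -> (0 < k <= P.1 - Q.1)%N ->
  up P k = Q \/ [/\ strict_sub (up P k) Q, ~ bad Q (up P k) & (k < P.1 - Q.1)%N].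
Proof.
move=> [[QP PQ] _ maxP] /andP[k0 ks].
have [->|kn] := eqVneq k (P.1 - Q.1)%N.
  by left; apply/esym/up_ancestor => //; exact: ltnW.
have {}ks : (k < P.1 - Q.1)%N by rewrite ltn_neqAle kn.
have Qu : (Q.1 < (up P k).1)%N by rewrite up_level ltn_subRL addnC -ltn_subRL.
have uQ : strict_sub (up P k) Q.
  split=> //; rewrite (up_ancestor l0_gt0 (ltnW QP) PQ).
  exact/dy_up_le/ltnW.
right; split=> //; apply: maxP => //; split; last exact: dy_up.
rewrite up_level ltn_subrL k0/=; exact: leq_ltn_trans QP.
Qed.

Lemma child_avg_le Q P k i : child Q P -> (0 < k <= P.1 - Q.1)%N ->
  avg i (up P k) <= growth * avg i Q.
Proof.
move=> QP ks; case: (child_ancestor QP ks) => [->|[_ + _]].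
  by rewrite -[leLHS]mul1r ler_wpM2r ?avg_ge0 ?growth_ge1.
by move=> nb; rewrite leNgt; apply/negP => b; apply: nb; left; exists i.
Qed.

(** [P] may have a high density, but its parent is either [Q] or not bad; passing from the parent to
    [P] costs a factor 2^n. *)
Lemma child_exceptional Q P : child Q P ->
  (mu (dy P `&` exceptional Q) <= (2^-1)%:E * mu (dy P))%E.
Proof.
move=> QP; have [[lQP _] _ _] := QP; have P0 : (0 < P.1)%N by exact: leq_ltn_trans lQP.
have mI S : measurable (dy S `&` exceptional Q).
  by apply: measurableI; [exact: measurable_dy|exact: measurable_exceptional].
apply: (@le_trans _ _ (mu (dy (up P 1) `&` exceptional Q))).
  by apply: le_measure; rewrite ?inE//; apply: setSI; exact: dy_up.
have key : (mu (dy (up P 1) `&` exceptional Q) <= (2 ^- n.+1)%:E * mu (dy (up P 1)))%E.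
  case: (child_ancestor QP (k := 1)) => [|->|[_ + _]]; first by rewrite subn_gt0.
    apply: (@le_trans _ _ (mu (exceptional Q))).
      by apply: le_measure; rewrite ?inE//; exact: measurable_exceptional.
    apply: le_trans (measure_exceptional Q) _.
    rewrite lee_wpmul2r// lee_fin lef_pV2 ?posrE ?exprn_gt0//.
    by rewrite ler_eXn2l ?ltr1n// -addn1 leq_add2l.
  by move=> nb; rewrite leNgt; apply/negP => b; apply: nb; right.
apply: le_trans key _; rewrite !lebesgue_dy// side_up// -!EFinM lee_fin.
rewrite le_eqVlt; apply/orP; left; apply/eqP; rewrite expr1 exprMn exprS; field.
by rewrite expf_neq0.
Qed.

(** [m] counts the telescoping terms and [Cr] sums the modulus. The other factors arise when the
    masses over triples of the ancestors of a child are bounded through [child_avg_le] and divided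
    by the volumes in the kernel bound. *)
Definition step_constant : R := m%:R * (C * growth ^+ m * 3 ^+ (n * m) * Cr).

(* The oscillation bound compares almost every point of [P] with a point outside the
   exceptional sets of both [Q] and [P]; such points exist because these sets cover
   less than all of [P]. *)
Lemma child_step Q P : child Q P -> {ae mu, forall x, dy P x ->
  `|local_op Q x| <= `|local_op P x| + lam * prod_avg P +
     (step_constant + lam) * prod_avg Q}.
Proof.
move=> QP; have [[lQP PQ] _ _] := QP.
pose s := (P.1 - Q.1)%N; have sP : (s <= P.1)%N by exact: leq_subr.
have Qup : Q = up P s by exact/up_ancestor/PQ/ltnW.
have [G aeG oscG] := localization_difference x0 l0_gt0 T_multilinear mK T_kernel
  C_ge0 rho_ge0 sizeK regK sP fL1.
have [x1 [Px1 nE1 nE2 Gx1]] : exists x1, [/\ dy P x1, ~ exceptional Q x1,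
    ~ exceptional P x1 & local_op Q x1 - local_op P x1 = G x1].
  apply: contrapT => /forallNP no.
  have [N [mN N0 subN]] := aeG.
  have PN : dy P `<=` (dy P `&` exceptional Q) `|` (exceptional P `|` N).
    move=> x Px; have [|nE1] := pselect (exceptional Q x); first by left.
    have [|nE2] := pselect (exceptional P x); first by right; left.
    right; right; apply: subN => /= H; apply: (no x); split=> //.
    by rewrite {1}Qup; exact: H.
  have mE S := measurable_exceptional S.
  have mdy S := measurable_dy x0 l0 S.
  have : (mu (dy P) <= (2^-1)%:E * mu (dy P) + ((2 ^- (n + 3))%:E * mu (dy P) + 0))%E.
    apply: (@le_trans _ _ (mu ((dy P `&` exceptional Q) `|` (exceptional P `|` N)))).
      apply: le_measure; rewrite ?inE//.
      by apply: measurableU; [exact: measurableI|exact: measurableU].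
    apply: le_trans (measureU2 _ _ _) _; [exact: measurableI|exact: measurableU|].
    apply: leeD; first exact: child_exceptional.
    apply: le_trans (measureU2 _ _ _) _ => //.
    apply: leeD; first exact: measure_exceptional.
    by rewrite le_eqVlt; apply/orP; left; apply/eqP; exact: N0.
  (* The two exceptional sets fill at most 1/2 + 1/8 of [P], since 2^-(n + 3) <= 1/8. *)
  rewrite adde0 lebesgue_dy// -!(EFinM, EFinD) lee_fin.
  have : 0 < side P.1 ^+ n by rewrite exprn_gt0// side_gt0.
  have : 2 ^- (n + 3) <= 8^-1 :> R.
    rewrite (_ : 8 = 2 ^+ 3 :> R); last by rewrite -natrX.
    by rewrite lef_pV2 ?posrE ?exprn_gt0// ler_eXn2l ?ltr1n// leq_addl.
  move: (2 ^- (n + 3)) (side P.1 ^+ n) => u v uv v0; nra.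
have local_le S : dy S x1 -> ~ exceptional S x1 -> `|local_op S x1| <= lam * prod_avg S.
  by move=> Sx nS; rewrite leNgt; apply/negP => H; apply: nS; split.
have Gx1le : `|G x1| <= lam * prod_avg Q + lam * prod_avg P.
  rewrite -Gx1; apply: le_trans (ler_normB _ _) _.
  by apply: lerD; apply: local_le => //; exact: PQ.
have s0 := side_gt0 l0_gt0 P.1.
have osc_le x : dy P x -> `|G x - G x1| <= step_constant * prod_avg Q.
  move=> Px; apply: le_trans (oscG _ _ Px Px1) _.
  rewrite /step_constant -mulrA ler_wpM2l//.
  apply: (@le_trans _ _ (\sum_(k < s) C * growth ^+ m * 3 ^+ (n * m) *
      rho (2 ^+ k.+1)^-1 * prod_avg Q)); last first.
    rewrite -mulr_suml -mulr_sumr; apply: ler_wpM2r; first exact: prod_avg_ge0.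
    apply: ler_wpM2l; last exact: rho_sum.
    by rewrite !mulr_ge0 ?exprn_ge0//; exact: le_trans growth_ge1.
  apply: ler_sum => k _.
  have ks : (0 < k.+1 <= P.1 - Q.1)%N by rewrite ltn_ord.
  have kP : (k.+1 <= P.1)%N by exact: leq_trans (ltn_ord k) sP.
  have massle : \prod_i mass (f i) (tri (up P k.+1)) <=
      growth ^+ m * prod_avg Q * (3 * (2 ^+ k.+1 * side P.1)) ^+ (n * m).
    rewrite exprM.
    have -> : growth ^+ m * prod_avg Q * ((3 * (2 ^+ k.+1 * side P.1)) ^+ n) ^+ m =
        \prod_i (growth * avg i Q * (3 * (2 ^+ k.+1 * side P.1)) ^+ n).
      rewrite big_split/= prodr_const card_ord.
      by rewrite big_split/= prodr_const card_ord.
    apply: ler_prod => i _; rewrite mass_ge0/= massE_avg side_up//.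
    rewrite ler_wpM2r ?child_avg_le//.
    by rewrite exprn_ge0// !mulr_ge0// ?exprn_ge0// ltW.
  have u0 : 0 < 2 ^+ k.+1 * side P.1 by rewrite mulr_gt0// exprn_gt0.
  apply: le_trans (ler_wpM2l _ massle) _.
    rewrite mulr_ge0 ?rho_ge0 ?invr_ge0 ?exprn_ge0//.
    by rewrite divr_ge0// exprn_ge0// ltW.
  rewrite le_eqVlt; apply/orP; left; apply/eqP.
  move: (2 ^+ k.+1 * side P.1) u0 (rho _) => u u0 r.
  have un0 : u ^+ (n * m) != 0 by rewrite expf_neq0// gt_eqF.
  rewrite [(m * n)%N]mulnC (_ : (3 * u) ^+ (n * m) = 3 ^+ (n * m) * u ^+ (n * m)).
    by move: (u ^+ _) un0 (3 ^+ _) (growth ^+ m) => a a0 b c; field.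
  exact: exprMn.
apply: filterS aeG => x Gx Px; have {}Gx := Gx Px.
have -> : local_op Q x = local_op P x + (G x - G x1) + G x1.
  by rewrite -Gx /local_op -Qup; ring.
apply: le_trans (ler_normD _ _) _.
have := ler_normD (local_op P x) (G x - G x1); have := osc_le x Px.
rewrite mulrDl; lra.
Qed.

(* Where there is no child, every smaller cube contains a small proportion of the
   exceptional set, so that it is null by [dyadic_density]. *)
Lemma childless_point Q : {ae mu, forall x, dy Q x ->
  (forall P, child Q P -> ~ dy P x) -> `|local_op Q x| <= lam * prod_avg Q}.
Proof.
pose A := exceptional Q `\` \bigcup_(P in child Q) dy P.
have mE := measurable_exceptional Q.
have mA : measurable A.
  by apply: measurableD => //; apply: countable_bigcup_measurable => P; exact: measurable_dy.
have AQ : A `<=` dy Q by move=> x [[]].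
have mI P : measurable (dy P `&` exceptional Q).
  by apply: measurableI => //; exact: measurable_dy.
have half : 2^-1 < 1 :> R by lra.
have half2 k : (0 < k)%N -> 2 ^- k <= 2^-1 :> R.
  move=> k0; rewrite lef_pV2 ?posrE ?exprn_gt0//.
  by rewrite -[leLHS]expr1 ler_eXn2l ?ltr1n.
have A0 : mu A = 0%E.
  apply: (dyadic_density l0_gt0 _ half mA AQ); first by rewrite invr_ge0.
  move=> P QP PQ.
  have mAP : measurable (A `&` dy P) by apply: measurableI => //; exact: measurable_dy.
  have le1 : (mu (A `&` dy P) <= mu (dy P `&` exceptional Q))%E.
    by apply: le_measure; rewrite ?inE// => x [[Ex _] Px]; split.
  have [eq1|ne1] := eqVneq P.1 Q.1.
    have PE : P = Q.
      have Pz := dy_nonempty x0 l0_gt0 P; have Qz := PQ _ Pz.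
      move/(dyP _ l0_gt0) : Pz; move/(dyP _ l0_gt0) : Qz.
      by rewrite eq1 => -> ->.
    rewrite PE in le1 *; apply: le_trans le1 _.
    apply: (@le_trans _ _ (mu (exceptional Q))).
      by apply: le_measure; rewrite ?inE.
    apply: le_trans (measure_exceptional Q) _.
    by rewrite lee_wpmul2r// lee_fin half2// addn3.
  have sPQ : strict_sub P Q by split=> //; rewrite ltn_neqAle eq_sym ne1.
  (* A bad cube lies inside a child and is disjoint from [A]; a cube that is not bad has the
     required density by definition. *)
  have [bP|nbP] := pselect (bad Q P).
    have [S [QS _ PS]] := bad_child sPQ bP.
    rewrite (_ : A `&` dy P = set0) ?measure0 ?mule_ge0 ?lee_fin ?invr_ge0//.
    by apply/seteqP; split=> // x [[_ nU] Px]; apply: nU; exists S => //; exact: PS.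
  apply: le_trans le1 _.
  apply: (@le_trans _ _ ((2 ^- n.+1)%:E * mu (dy P))%E).
    by rewrite leNgt; apply/negP => b; apply: nbP; right.
  by rewrite lee_wpmul2r// lee_fin half2.
exists A; split=> // x /= /not_implyP[Qx /not_implyP[noP nle]].
split; first by split=> //=; rewrite ltNge; apply/negP.
by move=> [P QP Px]; exact: noP QP Px.
Qed.

End stopping_cubes.

Lemma sum_uniq_sub_le (R : numDomainType) (I : eqType) (s1 s2 : seq I) (F : I -> R) :
  uniq s1 -> uniq s2 -> {subset s1 <= s2} -> (forall i, 0 <= F i) ->
  \sum_(i <- s1) F i <= \sum_(i <- s2) F i.
Proof.
move=> u1 u2 s12 F0.
have p : perm_eq s1 [seq i <- s2 | i \in s1].
  apply: uniq_perm => //; first exact: filter_uniq.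
  by move=> i; rewrite mem_filter; case: (boolP (i \in s1)) => //= /s12 ->.
rewrite (perm_big _ p) big_filter big_mkcond /=.
by apply: ler_sum => i _; case: ifP.
Qed.

(** * The family generated by repeated passage to children *)

Section sparse_family.
Context (R : realType) (n m : nat) (x0 : 'rV[R]_n) (l0 : R).
Hypotheses (l0_gt0 : 0 < l0) (m_gt0 : (0 < m)%N).
Local Notation Rn := 'rV[R]_n.
Local Notation mu := (lebesgue_rV R n).
Local Notation dy := (dy x0 l0).
Local Notation at_ := (at_ x0 l0).
Variables (T : ('I_m -> Rn -> R) -> Rn -> R).
Variables (K : Rn -> m.-tuple Rn -> R) (rho : R -> R) (C Cw Cr : R).
Hypothesis T_multilinear : multilinear T.
Hypothesis mK : measurable_fun [set: Rn * m.-tuple Rn]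
  (fun z : Rn * m.-tuple Rn => K z.1 z.2).
Hypothesis T_kernel : associated_kernel T K.
Hypotheses (C_ge0 : 0 <= C) (rho_ge0 : forall t, 0 <= t -> 0 <= rho t).
Hypotheses (sizeK : kernel_size K C) (regK : kernel_regularity K rho C).
Hypothesis T_weak : weak_type_bound T Cw.
Hypothesis rho_sum : forall s, \sum_(k < s) rho (2 ^+ k.+1)^-1 <= Cr.
Variables (f : 'I_m -> Rn -> R).
Hypothesis fL1 : forall i, L1 (f i).
Variable Q0 : cubeidx n.

Local Notation child := (child x0 l0 T Cw f).
Local Notation prod_avg := (prod_avg x0 l0 f).
Local Notation local_op := (local_op x0 l0 T f).
Local Notation lam := (lam n m Cw).

Inductive stopping : cubeidx n -> Prop :=
| stopping_root : stopping Q0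
| stopping_child Q P : stopping Q -> child Q P -> stopping P.

Definition core (Q : cubeidx n) : set Rn := dy Q `\` \bigcup_(P in child Q) dy P.

Lemma measurable_core Q : measurable (core Q).
Proof.
apply: measurableD; first exact: measurable_dy.
by apply: countable_bigcup_measurable => P; exact: measurable_dy.
Qed.

Lemma core_sub Q : core Q `<=` dy Q. Proof. by move=> x []. Qed.

Lemma measure_core Q : (mu (dy Q) <= 2%:E * mu (core Q))%E.
Proof.
have mU : measurable (\bigcup_(P in child Q) dy P).
  by apply: countable_bigcup_measurable => P; exact: measurable_dy.
have mC := measurable_core Q.
have : (mu (dy Q) <= mu (core Q) + (2^-1)%:E * mu (dy Q))%E.
  apply: (@le_trans _ _ (mu (core Q `|` \bigcup_(P in child Q) dy P))).
    apply: le_measure; rewrite ?inE; [exact: measurable_dy|exact: measurableU|].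
    move=> x Qx; have [Ux|nUx] := pselect ((\bigcup_(P in child Q) dy P) x); first by right.
    by left.
  apply: le_trans (measureU2 _ mC mU) _.
  by apply: leeD => //; exact: (measure_children x0 l0_gt0 m_gt0 T_multilinear T_weak fL1 Q).
have fC : mu (core Q) \is a fin_num.
  rewrite ge0_fin_numE//; apply: (@le_lt_trans _ _ (mu (dy Q))).
    by apply: le_measure; rewrite ?inE//; [exact: measurable_dy|exact: core_sub].
  by rewrite lebesgue_dy// ltry.
rewrite lebesgue_dy// -(fineK fC) -!(EFinM, EFinD) !lee_fin; lra.
Qed.

Lemma stopping_sub Q : stopping Q -> (Q0.1 <= Q.1)%N /\ dy Q `<=` dy Q0.
Proof.
elim=> [|S P _ [QS SQ] [[SP PS] _ _]]; first by split.
by split; [exact: leq_trans QS (ltnW SP)|exact: subset_trans PS SQ].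
Qed.

Lemma same_level_eq (P Q : cubeidx n) : P.1 = Q.1 -> dy P `&` dy Q !=set0 -> P = Q.
Proof.
by move=> PQ [x [/(dyP _ l0_gt0) <- /(dyP _ l0_gt0) <-]]; rewrite PQ.
Qed.

(** Induction on the generation of the finer cube, comparing the stopping parent [S] of [P] with
    [Q]. If they have the same generation they are equal and [P] itself is the child; if [S] is
    finer the induction applies to [S]; a coarser [S] is impossible. *)
Lemma stopping_in_child Q P : stopping Q -> stopping P -> (Q.1 < P.1)%N ->
  dy P `&` dy Q !=set0 -> exists S, [/\ child Q S, (S.1 <= P.1)%N & dy P `<=` dy S].
Proof.
move: {2}P.1 (leqnn P.1) => N; elim: N P Q => [|N IH] P Q.
  by rewrite leqn0 => /eqP -> _ _; rewrite ltn0.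
move=> PN sQ sP; case: sP PN => [PN QP|S {}P sS SP PN QP] PQ.
  by have [] := stopping_sub sQ; rewrite leqNgt QP.
have [[lSP PS] _ maxP] := SP.
have SQ : dy S `&` dy Q !=set0 by have [x [Px Qx]] := PQ; exists x; split=> //; exact: PS.
have [eqSQ|lSQ|lQS] := ltngtP S.1 Q.1; last first.
- by exists P; split=> //; rewrite -(same_level_eq lQS SQ).
- have [|U [QU US SU]] := IH S Q _ sQ sS lSQ SQ.
    by rewrite -ltnS; exact: leq_trans PN.
  by exists U; split=> //; [exact: leq_trans US (ltnW lSP)|exact: subset_trans PS SU].
have QS : dy Q `&` dy S !=set0 by rewrite setIC.
have QN : (Q.1 <= N)%N by rewrite -ltnS; exact: leq_trans PN.
(* Here [Q] would lie in a child [U] of [S]; then [U] is a bad cube strictly between [P] and [S],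
   against the maximality of [P]. *)
have [U [SU UQ QU]] := IH Q S QN sS sQ eqSQ QS.
exfalso; have [sUS bU _] := SU; apply: (maxP U) => //; split.
  exact: leq_ltn_trans QP.
by apply: subset_trans QU; apply: dy_nested => //; exact: ltnW.
Qed.

(** Of two stopping cubes of different generations that meet, the finer lies in a child of the
    coarser, which the core of the latter omits. *)
Lemma core_disjoint P Q : stopping P -> stopping Q -> core P `&` core Q !=set0 -> P = Q.
Proof.
move=> sP sQ [x [[Px nPx] [Qx nQx]]].
have key P' Q' : stopping P' -> stopping Q' -> dy P' x -> core Q' x -> ~ (Q'.1 < P'.1)%N.
  move=> sP' sQ' P'x [Q'x nQ'x] lPQ; apply: nQ'x.
  have [|S [QS _ PS]] := stopping_in_child sQ' sP' lPQ; first by exists x.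
  by exists S => //; exact: PS.
apply: same_level_eq; last by exists x.
apply/eqP; rewrite eqn_leq; apply/andP; split; rewrite leqNgt; apply/negP.
  by apply: key => //; split.
by apply: key => //; split.
Qed.

(** Borel-Cantelli: the stopping cubes of one generation have at most twice the measure of their
    cores, and the cores of all generations are disjoint subsets of [dy Q0], so these measures have
    a finite sum. *)
Lemma finitely_many_stopping : {ae mu, forall x, dy Q0 x ->
  exists N, forall j, (N <= j)%N -> ~ stopping (at_ j x)}.
Proof.
pose F j := dy Q0 `&` [set x | stopping (at_ j x)].
pose E j := dy Q0 `&` [set x | stopping (at_ j x) /\ core (at_ j x) x].
have mF j : measurable (F j).
  apply: measurableI; first exact: measurable_dy.
  exact: (at_fiber_measurable x0 l0_gt0 j stopping).
have EE j : E j = \bigcup_(Q in [set Q | stopping Q /\ Q.1 = j]) core Q.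
  apply/seteqP; split=> [x [Q0x [sx cx]]|x [Q [sQ Qj] cx]].
    by exists (at_ j x).
  have Qx := core_sub cx; have atx : at_ j x = Q by rewrite -Qj; exact/dyP.
  by split; [exact: (stopping_sub sQ).2|rewrite /= atx].
have mE j : measurable (E j).
  by rewrite EE; apply: countable_bigcup_measurable => Q; exact: measurable_core.
have FE j : (mu (F j) <= 2%:E * mu (E j))%E.
  apply: (dy_partition_le (x0 := x0) l0_gt0 (j := j)) => // P Pj.
  have [sP|nsP] := pselect (stopping P); last first.
    rewrite (_ : F j `&` dy P = set0) ?measure0 ?mule_ge0//.
    apply/seteqP; split=> // x [[_ /= sx] /(dyP _ l0_gt0)].
    by rewrite Pj => xP; apply: nsP; rewrite -xP.
  apply: (@le_trans _ _ (mu (dy P))).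
    apply: le_measure; rewrite ?inE; [|exact: measurable_dy|exact: subIsetr].
    by apply: measurableI => //; exact: measurable_dy.
  apply: le_trans (measure_core P) _; rewrite lee_wpmul2l//.
  apply: le_measure; rewrite ?inE; [exact: measurable_core| |].
    by apply: measurableI => //; exact: measurable_dy.
  move=> x cx; split; last exact: core_sub.
  by rewrite EE; exists P.
have tE : trivIset setT E.
  move=> i j _ _ [x [Ei Ej]]; move: Ei Ej; rewrite !EE.
  by move=> [P [sP <-] Px] [Q [sQ <-] Qx]; rewrite (@core_disjoint P Q)//; exists x.
have fin : (\sum_(0 <= j <oo) mu (F j) < +oo)%E.
  apply: (@le_lt_trans _ _ (\sum_(0 <= j <oo) (2%:E * mu (E j)))%E).
    by apply: lee_nneseries => // j _; exact: FE.
  rewrite nneseriesZl; last by move=> j _.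
  have -> : (\sum_(0 <= j <oo) mu (E j) = mu (\bigcup_j E j))%E.
    rewrite measure_bigcup//.
    by apply: eq_eseriesl => k; rewrite in_setT.
  apply: (@le_lt_trans _ _ (2%:E * mu (dy Q0))%E).
    rewrite lee_wpmul2l//; apply: le_measure; rewrite ?inE.
    - exact: bigcupT_measurable.
    - exact: measurable_dy.
    - by move=> x [j _ []].
  by rewrite lebesgue_dy// -EFinM ltry.
have lim0 := lim_sup_set_cvg0 mF fin.
exists (lim_sup_set F); split=> //.
  by apply: bigcapT_measurable => k; exact: bigcup_measurable.
move=> x /= /not_implyP[Q0x nfin] k _.
apply: contrapT => noj; apply: nfin; exists k => j kj sj.
by apply: noj; exists j.
Qed.

(** [child_step] charges [step_constant + lam] to each cube; the second [lam] is the extra term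
    carried through the induction in [sparse_domination]. *)
Definition sparse_constant : R := step_constant n m C Cr + 2 * lam.

Lemma sparse_constant_ge0 : 0 <= Cr -> 0 <= sparse_constant.
Proof.
move=> Cr0; apply: addr_ge0; last by rewrite mulr_ge0// ltW// lam_gt0.
have g0 : 0 <= growth R n m by apply: le_trans (growth_ge1 R n m_gt0).
by rewrite /step_constant !mulr_ge0// exprn_ge0.
Qed.

(** For almost every [x] the stopping cubes containing [x] form a finite chain: [child_step] is
    added along it, and [childless_point] bounds the last member. The number [N] of terms depends on
    [x]. *)
Lemma sparse_domination : {ae mu, forall x, dy Q0 x -> exists N,
  `|local_op Q0 x| <= sparse_constant *
    \sum_(Q <- first_terms stopping N) prod_avg Q * \1_(dy Q) x}.
Proof.
have steps : {ae mu, forall x, forall Q P, child Q P -> dy P x ->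
  `|local_op Q x| <= `|local_op P x| + lam * prod_avg P +
     (step_constant n m C Cr + lam) * prod_avg Q}.
  have H := ae_countable (mu := mu) (I := (cubeidx n * cubeidx n)%type)
    (P := fun QP x => child QP.1 QP.2 -> dy QP.2 x ->
      `|local_op QP.1 x| <= `|local_op QP.2 x| + lam * prod_avg QP.2 +
      (step_constant n m C Cr + lam) * prod_avg QP.1).
  have {}H := H _; apply: filterS (H _) => [x Hx Q P|[Q P]] /=; first exact: (Hx (Q, P)).
  have [QP|nQP] := pselect (child Q P); last by apply: aeW => x /nQP.
  apply: filterS (child_step l0_gt0 m_gt0 T_multilinear mK T_kernel C_ge0 rho_ge0
    sizeK regK T_weak rho_sum fL1 QP) => x Hx _; exact: Hx.
have leaves := ae_countable (childless_point x0 l0_gt0 m_gt0 T_multilinear T_weak fL1).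
apply: filterS3 steps leaves finitely_many_stopping => x step leaf fin Q0x.
have [N nostop] := fin Q0x.
have lam0 := lam_gt0 n m Cw.
pose chain j := \sum_(k < N | (j <= k)%N && `[< stopping (at_ k x) >]) prod_avg (at_ k x).
have g0 Q : 0 <= prod_avg Q by exact: prod_avg_ge0.
have chain_step j i : (i < j)%N -> (i < N)%N -> stopping (at_ i x) ->
    prod_avg (at_ i x) + chain j <= chain i.
  move=> ij iN si; rewrite /chain [leRHS](bigD1 (Ordinal iN)) /=; last first.
    by rewrite leqnn; apply/asboolP.
  rewrite lerD2l [leLHS]big_mkcond [leRHS]big_mkcond; apply: ler_sum => k _ /=.
  case: ifP => [/andP[jk ->]|_]; last by case: ifP.
  have ik := leq_trans ij jk.
  by rewrite (ltnW ik)/= -val_eqE /= gtn_eqF.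
(* The summand [lam * prod_avg (at_ j x)] is included so that the induction hypothesis for a child
   also covers the [lam * prod_avg P] produced by [child_step]. *)
have key d j : (N - j <= d)%N -> stopping (at_ j x) ->
    `|local_op (at_ j x) x| + lam * prod_avg (at_ j x) <= sparse_constant * chain j.
  elim: d j => [|d IH] j Nj sj.
    exfalso; apply: (nostop j) => //; by rewrite -subn_eq0 -leqn0.
  have jN : (j < N)%N by rewrite ltnNge; apply/negP => /nostop.
  have sc : lam + lam <= sparse_constant.
    rewrite /sparse_constant mulr_natl mulr2n lerDr /step_constant.
    have Cr0 : 0 <= Cr by have := rho_sum 0; rewrite big_ord0.
    have gr0 : 0 <= growth R n m by apply: le_trans (growth_ge1 R n m_gt0).
    by rewrite mulr_ge0// !mulr_ge0// exprn_ge0.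
  have [[P jP Px]|noP] := pselect (exists2 P, child (at_ j x) P & dy P x).
    have /(dyP _ l0_gt0) PE := Px.
    have [[/= jlt _] _ _] := jP.
    have sP : stopping (at_ P.1 x) by rewrite PE; exact: stopping_child sj jP.
    have := IH P.1 _ sP; rewrite PE => /(_ _)/[dup] _ IHP.
    have {}IHP : `|local_op P x| + lam * prod_avg P <= sparse_constant * chain P.1.
      by apply: IHP; lia.
    have st := step _ _ jP Px.
    have := chain_step _ _ jlt jN sj.
    have sc0 : 0 <= sparse_constant by apply: le_trans sc; rewrite addr_ge0// ltW.
    move=> /(ler_wpM2l sc0); rewrite mulrDr; apply: le_trans.
    apply: le_trans (lerD (lexx _) IHP).
    move: st; rewrite /sparse_constant.
    move: (prod_avg (at_ j x)) (prod_avg P) => u v; lra.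
  apply: (@le_trans _ _ (sparse_constant * prod_avg (at_ j x))).
    apply: le_trans (ler_wpM2r (g0 _) sc).
    rewrite mulrDl lerD2r; apply: leaf; first exact: dy_at.
    by move=> P jP Px; apply: noP; exists P.
  have sc0 : 0 <= sparse_constant by apply: le_trans sc; rewrite addr_ge0// ltW.
  rewrite ler_wpM2l//; apply: le_trans (chain_step j.+1 j _ jN sj) => //.
  by rewrite lerDl; apply: sumr_ge0.
have Q0E : at_ Q0.1 x = Q0 by exact/dyP.
have := key _ Q0.1 (leqnn _); rewrite Q0E => /(_ stopping_root) H.
pose s := [seq at_ k x | k <- iota 0 N & `[< stopping (at_ k x) >]].
(* Large enough for [first_terms] to list every cube of the chain. *)
exists (\max_(Q <- s) pickle Q).+1.
have sc0 : 0 <= sparse_constant.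
  by apply: sparse_constant_ge0; have := rho_sum 0; rewrite big_ord0.
apply: (@le_trans _ _ (sparse_constant * chain Q0.1)).
  by apply: le_trans H; rewrite lerDl mulr_ge0// ltW.
rewrite ler_wpM2l//.
apply: (@le_trans _ _ (\sum_(Q <- s) prod_avg Q * \1_(dy Q) x)); last first.
  apply: sum_uniq_sub_le => //.
  - rewrite map_inj_uniq; last by move=> i j [].
    exact/filter_uniq/iota_uniq.
  - exact: first_terms_uniq.
  - move=> Q Qs; rewrite mem_first_terms ltnS; apply/andP; split.
      by move/mapP : Qs => [k]; rewrite mem_filter => /andP[sk _] ->.
    exact: leq_bigmax_seq.
  - by move=> Q; rewrite mulr_ge0// indicE.
rewrite big_map big_filter /chain.
rewrite (eq_bigr (fun k => prod_avg (at_ k x))) => [|k _]; last first.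
  by rewrite indicE mem_set ?mulr1//; exact: dy_at.
have -> : iota 0 N = index_iota 0 N by rewrite /index_iota subn0.
rewrite big_mkord.
rewrite big_mkcond [leRHS]big_mkcond; apply: ler_sum => k _.
by case: ifP => [/andP[_ ->]//|_]; case: ifP.
Qed.

End sparse_family.

(** * Weighted bound of a sparse sum *)

Section sparse_weighted.
Context (R : realType) (n : nat) (x0 : 'rV[R]_n) (l0 : R) (l0_gt0 : 0 < l0).
Local Notation Rn := 'rV[R]_n.
Local Notation mu := (lebesgue_rV R n).
Local Notation dy := (dy x0 l0).
Local Notation tri := (tri x0 l0).
Local Notation side := (side l0).
Variables (s : seq (cubeidx n)) (E : cubeidx n -> set Rn).
Hypotheses (uniq_s : uniq s) (mE : forall Q, measurable (E Q)).
Hypotheses (Edy : forall Q, E Q `<=` dy Q).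
Hypothesis Edisj : forall P Q, P \in s -> Q \in s -> E P `&` E Q !=set0 -> P = Q.
Hypothesis Ebig : forall Q, Q \in s -> (mu (dy Q) <= 2%:E * mu (E Q))%E.

Definition wint (w : Rn -> R) (B : set Rn) : R := fine (\int[mu]_(x in B) (w x)%:E).

Definition finite_weight (w : Rn -> R) := [/\ measurable_fun setT w,
  forall x, 0 < w x & forall Q, (\int[mu]_(x in tri Q) (w x)%:E < +oo)%E].

Lemma Etri Q : E Q `<=` tri Q.
Proof. by move=> x /Edy; exact: dy_sub_tri. Qed.

Lemma integral_subset (w : Rn -> R) (A B : set Rn) : measurable A -> measurable B ->
  measurable_fun setT w -> (forall x, 0 <= w x) -> A `<=` B ->
  (\int[mu]_(x in A) (w x)%:E <= \int[mu]_(x in B) (w x)%:E)%E.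
Proof.
move=> mA mB mw w0 AB; apply: ge0_subset_integral => //.
  by apply: measurable_funTS; exact/measurable_EFinP.
by move=> x _; rewrite lee_fin.
Qed.

Lemma wintE (w : Rn -> R) Q (B : set Rn) : measurable_fun setT w -> (forall x, 0 <= w x) ->
  (\int[mu]_(x in tri Q) (w x)%:E < +oo)%E -> measurable B -> B `<=` tri Q ->
  (\int[mu]_(x in B) (w x)%:E = (wint w B)%:E)%E.
Proof.
move=> mw w0 fw mB BQ; rewrite fineK// ge0_fin_numE.
  by apply: le_lt_trans fw; apply: integral_subset => //; exact: measurable_tri.
by apply: integral_ge0 => x _; rewrite lee_fin.
Qed.

Lemma integral_weight_gt0 (w : Rn -> R) (B : set Rn) : measurable B ->
  measurable_fun setT w -> (forall x, 0 < w x) -> (0 < mu B)%E ->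
  (0 < \int[mu]_(x in B) (w x)%:E)%E.
Proof.
move=> mB mw w0 B0; rewrite lt_def; apply/andP; split; last first.
  by apply: integral_ge0 => x _; rewrite lee_fin ltW.
apply/negP => /eqP I0.
have : ae_eq mu B (EFin \o w) (cst 0%E).
  apply/(ae_eq_integral_abs mu mB).
    by apply: measurable_funTS; exact/measurable_EFinP.
  rewrite -I0; apply: eq_integral => x _ /=.
  by rewrite gtr0_norm.
move=> [N [mN N0 BN]]; move: B0; rewrite ltNge => /negP; apply.
apply: (@le_trans _ _ (mu N)); last by rewrite le_eqVlt; apply/orP; left; apply/eqP; exact: N0.
apply: le_measure; rewrite ?inE// => x Bx; apply: BN => /= H.
by have := H Bx; move=> [] /eqP; rewrite gt_eqF.
Qed.

(** From triple to cube costs 3^n, from cube to core 2: this is the constant [c] of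
    [joint_weight_term]. *)
Lemma core_volume Q : Q \in s -> exists2 e : R, mu (E Q) = e%:E &
  0 < e /\ (3 * side Q.1) ^+ n <= 2 * 3 ^+ n * e.
Proof.
move=> Qs; have fE : mu (E Q) \is a fin_num.
  rewrite ge0_fin_numE//; apply: (@le_lt_trans _ _ (mu (dy Q))).
    by apply: le_measure; rewrite ?inE//; exact: measurable_dy.
  by rewrite lebesgue_dy// ltry.
have := Ebig Qs; rewrite lebesgue_dy// -(fineK fE) -EFinM lee_fin => H.
exists (fine (mu (E Q))) => //.
have s0 : 0 < side Q.1 ^+ n by rewrite exprn_gt0// side_gt0.
split; first lra.
by rewrite exprMn [2 * _]mulrC -mulrA ler_wpM2l// exprn_ge0.
Qed.

Definition carleson_constant (r : R) : R :=
  #|{: {ffun 'I_n -> 'I_3}}|%:R * maximal_constant r.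

Lemma carleson_constant_gt0 r : 1 < r -> 0 < carleson_constant r.
Proof.
move=> r1; rewrite /carleson_constant /maximal_constant card_ffun !card_ord natrX.
have r10 : 0 < r - 1 by rewrite subr_gt0.
have r0 : 0 < r by apply: lt_trans r1.
by rewrite !mulr_gt0 ?exprn_gt0 ?powR_gt0 ?invr_gt0 ?mulr_gt0 ?invr_gt0.
Qed.

Lemma carleson_real (w F : Rn -> R) (r X : R) : finite_weight w ->
  measurable_fun setT F -> (forall x, 0 <= F x) ->
  (forall Q, Q \in s -> \int[mu]_(x in tri Q) (F x)%:E < +oo)%E -> 1 < r ->
  (\int[mu]_x (F x `^ r * w x `^ (1 - r))%:E = X%:E)%E ->
  \sum_(Q <- s) (wint F (tri Q) / wint w (tri Q)) `^ r * wint w (E Q) <=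
    carleson_constant r * X.
Proof.
move=> [mw w0 wfin] mF F0 Ffin r1 FX.
have w0' x : 0 <= w x by exact: ltW.
have wge0 B : 0 <= wint w B by rewrite fine_ge0// integral_ge0// => x _; rewrite lee_fin.
have Fge0 B : 0 <= wint F B by rewrite fine_ge0// integral_ge0// => x _; rewrite lee_fin.
rewrite -lee_fin /carleson_constant -mulrA 2!EFinM -FX -sumEFin.
apply: le_trans (carleson_embedding (mu := mu) (lvl := fun Q : cubeidx n => Q.1)
  (measurable_tri x0 l0) mF mw F0 w0
  (avg := fun Q => wint F (tri Q) / wint w (tri Q)) _ r1
  (cls := @tri_class n) uniq_s mE Etri Edisj _ _ _).
- rewrite le_eqVlt; apply/orP; left; apply/eqP; apply: eq_bigr => Q _.
  by rewrite EFinM (wintE mw w0' (wfin Q))//; exact: Etri.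
- by move=> Q; rewrite divr_ge0.
- move=> c P Q; rewrite !mem_filter => /andP[/eqP Pc _] /andP[/eqP Qc _].
  by apply: tri_nested => //; rewrite Pc.
- by move=> Q _; exact: wfin.
- move=> Q Qs.
  have wQ : (\int[mu]_(x in tri Q) (w x)%:E = (wint w (tri Q))%:E)%E.
    by apply: (wintE (Q := Q)) => //; exact: measurable_tri.
  have FQ : (\int[mu]_(x in tri Q) (F x)%:E = (wint F (tri Q))%:E)%E.
    by apply: (wintE (Q := Q)) => //; [exact: Ffin|exact: measurable_tri].
  rewrite wQ FQ -EFinM lee_fin.
  have [->|wn0] := eqVneq (wint w (tri Q)) 0; first by rewrite mulr0.
  by rewrite divfK.
Qed.

Lemma carleson_holder (I : finType) (th X : I -> R) (A W : I -> cubeidx n -> R) (c : R) :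
  (forall k, 0 < th k) -> \sum_k th k = 1 ->
  (forall k Q, 0 <= A k Q) -> (forall k Q, 0 <= W k Q) ->
  (forall k, \sum_(Q <- s) A k Q `^ (c / th k) * W k Q <= X k) ->
  \sum_(Q <- s) \prod_k (A k Q `^ c * W k Q `^ th k) <= \prod_k X k `^ th k.
Proof.
move=> th0 th1 A0 W0 AX.
have xge0 k Q : 0 <= A k Q `^ (c / th k) * W k Q by rewrite mulr_ge0 ?powR_ge0.
apply: (@le_trans _ _ (\sum_(Q <- s) \prod_k (A k Q `^ (c / th k) * W k Q) `^ th k)).
  rewrite le_eqVlt; apply/orP; left; apply/eqP; apply: eq_bigr => Q _.
  apply: eq_bigr => k _; rewrite powRM ?powR_ge0// -powRrM divfK//.
  by rewrite gt_eqF.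
apply: le_trans (holder_sum _ th0 th1 xge0) _.
apply: ler_prod => k _; rewrite powR_ge0/=.
have S0 : 0 <= \sum_(Q <- s) A k Q `^ (c / th k) * W k Q by apply: sumr_ge0.
apply: ge0_ler_powR; rewrite ?nnegrE//; [exact: ltW|exact: le_trans (AX k)].
Qed.

Section joint_weights.
Variables (I : finType) (w : I -> Rn -> R) (q : I -> R) (M G : R).
Hypotheses (M_gt0 : 0 < M) (q_gt0 : forall k, 0 < q k) (sum_q : \sum_k q k = M).
Hypothesis w_finite : forall k, finite_weight (w k).
Hypothesis w_dual : forall x, \prod_k w k x `^ q k = 1.
Hypothesis w_joint : forall Q,
  \prod_k (wint (w k) (tri Q) / (3 * side Q.1) ^+ n) `^ q k <= G.

Lemma wint_core k Q : Q \in s ->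
  (\int[mu]_(x in E Q) (w k x)%:E)%E = (wint (w k) (E Q))%:E /\ 0 < wint (w k) (E Q).
Proof.
move=> Qs; have [mw w0 wfin] := w_finite k; have [e eE [e0 _]] := core_volume Qs.
have wQ : (\int[mu]_(x in E Q) (w k x)%:E)%E = (wint (w k) (E Q))%:E.
  by apply: (wintE (Q := Q)) => //; [move=> x; exact: ltW|exact: Etri].
split=> //; rewrite -lte_fin -wQ; apply: integral_weight_gt0 => //.
suff : (0 < mu (E Q))%E by [].
by rewrite eE lte_fin.
Qed.

(** [joint_weight_term] for masses over 3Q and over the core. The required bound on the volume of
    the core is [holder_measure]: by [w_dual] the geometric mean of the weights with exponents
    [q k / M] is 1. *)
Lemma sparse_weight_term (a : I -> R) (sg : R) Q : Q \in s -> 0 <= sg ->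
  (forall k, a k <= sg * q k) -> \sum_k a k <= 1 + sg * M ->
  (3 * side Q.1) ^+ n * \prod_k (wint (w k) (tri Q) / (3 * side Q.1) ^+ n) `^ a k <=
    (2 * 3 ^+ n) `^ (1 + sg * M - \sum_k a k) * G `^ sg *
    \prod_k wint (w k) (E Q) `^ (a k + q k * (1 - \sum_k a k) / M).
Proof.
move=> Qs sg0 asg sM; have [e eE [e0 Ve]] := core_volume Qs.
apply: (joint_weight_term (e := e)) => //; try exact: ltW.
- by rewrite exprn_gt0// mulr_gt0// side_gt0.
- by move=> k; case: (wint_core k Qs).
- move=> k; have [mw w0 wfin] := w_finite k.
  have w0' x : 0 <= w k x by exact: ltW.
  rewrite -lee_fin -!(wintE mw w0' (wfin Q))//.
  + by apply: integral_subset => //; [exact: measurable_tri|exact: Etri].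
  + exact: measurable_tri.
  + exact: Etri.
- rewrite -lee_fin -eE.
  apply: (@holder_measure _ _ _ _ _ _ w) => //.
  + by move=> k; rewrite divr_gt0.
  + by rewrite -mulr_suml sum_q divff// gt_eqF.
  + by move=> k; case: (w_finite k).
  + by move=> k x; case: (w_finite k).
  + move=> x; rewrite (eq_bigr (fun k => (w k x `^ q k) `^ M^-1)) => [|k _].
      rewrite -powR_prod_seq; last by move=> k; rewrite powR_ge0.
      by rewrite w_dual powR1.
    by rewrite powRrM.
  + by move=> k; case: (wint_core k Qs).
  + by move=> k; case: (wint_core k Qs).
Qed.

End joint_weights.

(** * Sparse sums for [p <= 1] and for [p > 1] *)

Section sparse_operator.
Variables (m : nat) (ps : 'I_m -> R) (p : R) (vs : 'I_m -> Rn -> R) (e G : R).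
Variables (f : 'I_m -> Rn -> R) (Nf : 'I_m -> R).
Hypotheses (m_gt0 : (0 < m)%N) (ps_gt1 : forall i, 1 < ps i) (p_gt0 : 0 < p).
Hypothesis pE : 1 / p = \sum_(i < m) 1 / ps i.
Local Notation v := (product_weight ps vs p).
Local Notation w := (extend (fun i x => vs i x `^ (- (1 / (ps i - 1)))) v).
Local Notation q := (extend (fun i => 1 / conjugate_exponent (ps i)) (1 / p)).
Hypotheses (e_ge : forall i, conjugate_exponent (ps i) <= e) (e_gep : p <= e).
Hypothesis vs_measurable : forall i, measurable_fun setT (vs i).
Hypothesis vs_gt0 : forall i x, 0 < vs i x.
Hypothesis w_finite : forall k Q, (\int[mu]_(x in tri Q) (w k x)%:E < +oo)%E.
Hypothesis w_joint : forall Q,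
  \prod_k (wint (w k) (tri Q) / (3 * side Q.1) ^+ n) `^ q k <= G.
Hypothesis fL1 : forall i, L1 (f i).
Hypotheses (Nf_ge0 : forall i, 0 <= Nf i).
Hypothesis fN : forall i,
  (\int[mu]_x (`|f i x| `^ ps i * vs i x)%:E = (Nf i `^ ps i)%:E)%E.
Local Notation prod_avg := (prod_avg x0 l0 f).

Lemma extend_widen (A : Type) (a : 'I_m -> A) (b : A) i :
  extend a b (widen_ord (leqnSn m) i) = a i.
Proof.
rewrite /extend (_ : widen_ord _ i = lift ord_max i) ?liftK//.
by apply: val_inj; rewrite /= /bump leqNgt ltn_ord.
Qed.

Lemma extend_max (A : Type) (a : 'I_m -> A) (b : A) : extend a b ord_max = b.
Proof. by rewrite /extend unlift_none. Qed.

Lemma extendP (A : Type) (a : 'I_m -> A) (b : A) (P : A -> Prop) :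
  (forall i, P (a i)) -> P b -> forall k, P (extend a b k).
Proof. by move=> Pa Pb k; rewrite /extend; case: unlift. Qed.

Definition sparse_sum (x : Rn) : R := \sum_(Q <- s) prod_avg Q * \1_(dy Q) x.

Lemma ps_gt0 i : 0 < ps i. Proof. by apply: lt_trans (ps_gt1 i). Qed.

Lemma psB1_gt0 i : 0 < ps i - 1. Proof. by rewrite subr_gt0. Qed.

Lemma conj_gt0 i : 0 < conjugate_exponent (ps i).
Proof. by rewrite divr_gt0 ?ps_gt0 ?psB1_gt0. Qed.

Lemma conj_inv i : 1 / conjugate_exponent (ps i) = 1 - 1 / ps i.
Proof.
rewrite /conjugate_exponent; field.
by rewrite !gt_eqF ?ps_gt0 ?psB1_gt0.
Qed.

Lemma sum_q : \sum_k q k = m%:R.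
Proof.
rewrite big_ord_recr /= extend_max; under eq_bigr do rewrite extend_widen conj_inv.
by rewrite sumrB -pE sumr_const card_ord subrK.
Qed.

Lemma q_gt0 k : 0 < q k.
Proof.
by apply: (extendP (P := fun z => 0 < z)) => [i|]; rewrite divr_gt0// conj_gt0.
Qed.

Lemma v_gt0 x : 0 < v x.
Proof. by apply: prodr_gt0 => i _; exact: powR_gt0. Qed.

Lemma w_gt0 k x : 0 < w k x.
Proof.
move: k; apply: (extendP (P := fun z => 0 < z x)) => [i|]; last exact: v_gt0.
exact: powR_gt0.
Qed.

Lemma measurable_powRc (g : Rn -> R) r : measurable_fun setT g ->
  measurable_fun setT (fun x => g x `^ r).
Proof. by move=> mg; apply: (@measurableT_comp _ _ _ _ _ _ (fun z => z `^ r)). Qed.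

Lemma measurable_v : measurable_fun setT v.
Proof. by apply: measurable_prod => i _; exact: measurable_powRc. Qed.

Lemma measurable_w k : measurable_fun setT (w k).
Proof.
apply: (extendP (P := fun z => measurable_fun setT z)) => [i|]; last exact: measurable_v.
exact: measurable_powRc.
Qed.

Lemma finite_weight_w k : finite_weight (w k).
Proof. by split; [exact: measurable_w|exact: w_gt0|exact: w_finite]. Qed.

(** The i-th dual weight contributes v_i to the power -1/p_i, and [v] contributes v_i to the power
    1/p_i. *)
Lemma w_dual x : \prod_k w k x `^ q k = 1.
Proof.
rewrite big_ord_recr /= !extend_max powR_prod_seq; last by move=> i; rewrite powR_ge0.
rewrite -big_split big1// => i _ /=.
rewrite !extend_widen -!powRrM -powRD; last by rewrite (gt_eqF (vs_gt0 i x)) implybT.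
rewrite (_ : _ + _ = 0) ?powRr0// conj_inv; field.
by rewrite !gt_eqF ?ps_gt0 ?psB1_gt0.
Qed.

Lemma e_gt0 : 0 < e. Proof. exact: lt_le_trans e_gep. Qed.

Lemma e_ge1 : 1 <= e.
Proof.
have i : 'I_m := Ordinal m_gt0; apply: le_trans (e_ge i).
rewrite /conjugate_exponent ler_pdivlMr ?psB1_gt0// mul1r; lra.
Qed.

(** The place where the maximum of the p_i' and p enters: these numbers are the inverses of the
    [q k]. *)
Lemma e_q_ge1 k : 1 <= e * q k.
Proof.
apply: (extendP (P := fun z => 1 <= e * z)) => [i|].
  by rewrite mulrA mulr1 ler_pdivlMr ?conj_gt0// mul1r.
by rewrite mulrA mulr1 ler_pdivlMr// mul1r.
Qed.

Lemma absf_measurable i : measurable_fun setT (fun x => `|f i x|).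
Proof. by apply: measurableT_comp => //; exact: L1_measurable. Qed.

Lemma absf_finite i Q : (\int[mu]_(x in tri Q) `|f i x|%:E < +oo)%E.
Proof. by rewrite massE ?ltry//; exact: measurable_tri. Qed.

(** The power 1 - p_i of the dual weight is v_i again, so the norm required by the Carleson
    embedding is the one given. *)
Lemma absf_norm i : (\int[mu]_x
   (`|f i x| `^ ps i * (vs i x `^ (- (1 / (ps i - 1)))) `^ (1 - ps i))%:E =
   (Nf i `^ ps i)%:E)%E.
Proof.
rewrite -fN; apply: eq_integral => x _; congr (_ * _)%:E.
rewrite -powRrM (_ : _ * _ = 1) ?powRr1//; first exact: ltW.
by field; rewrite gt_eqF ?psB1_gt0.
Qed.

Lemma volume_gt0 (Q : cubeidx n) : 0 < (3 * side Q.1) ^+ n.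
Proof. by rewrite exprn_gt0// mulr_gt0// side_gt0. Qed.

Lemma wint_tri_gt0 k Q : Q \in s -> 0 < wint (w k) (tri Q).
Proof.
move=> Qs; have [mw w0 wfin] := finite_weight_w k.
have w0' x : 0 <= w k x by exact: ltW.
rewrite -lte_fin -(wintE mw w0' (wfin Q))//; last exact: measurable_tri.
apply: integral_weight_gt0 => //; first exact: measurable_tri.
suff : (0 < mu (tri Q))%E by [].
by rewrite lebesgue_tri// lte_fin volume_gt0.
Qed.

Lemma wint_ge0 (g : Rn -> R) B : (forall x, 0 <= g x) -> 0 <= wint g B.
Proof. by move=> g0; rewrite fine_ge0// integral_ge0// => x _; rewrite lee_fin. Qed.

(** The mean over 3Q of |f_i| / w_i with respect to the measure w_i dx. *)
Definition weighted_avg i Q := mass (f i) (tri Q) / wint (w (widen_ord (leqnSn m) i)) (tri Q).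

Lemma weighted_avg_ge0 i Q : 0 <= weighted_avg i Q.
Proof. by rewrite divr_ge0 ?mass_ge0// wint_ge0// => x; rewrite ltW// w_gt0. Qed.

Lemma carleson_f i : \sum_(Q <- s) weighted_avg i Q `^ ps i *
    wint (w (widen_ord (leqnSn m) i)) (E Q) <= carleson_constant (ps i) * Nf i `^ ps i.
Proof.
apply: (@carleson_real _ (fun x => `|f i x|)) => //.
- exact: finite_weight_w.
- exact: absf_measurable.
- by move=> Q _; exact: absf_finite.
- by rewrite -absf_norm; apply: eq_integral => x _; rewrite extend_widen.
Qed.

Lemma measurable_sparse_sum : measurable_fun setT sparse_sum.
Proof.
apply: measurable_sum => Q; apply: measurable_funM => //.
by apply: measurable_indic; exact: measurable_dy.
Qed.

Lemma sparse_sum_ge0 x : 0 <= sparse_sum x.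
Proof.
apply: sumr_ge0 => Q _; rewrite mulr_ge0 ?indicE//; exact: prod_avg_ge0.
Qed.

Lemma prod_avgE Q : Q \in s -> prod_avg Q = \prod_i
  (weighted_avg i Q * (wint (w (widen_ord (leqnSn m) i)) (tri Q) / (3 * side Q.1) ^+ n)).
Proof.
move=> Qs; apply: eq_bigr => i _; rewrite /avg /weighted_avg; field.
by rewrite !gt_eqF ?wint_tri_gt0 ?side_gt0 ?volume_gt0.
Qed.

(** The exponent of 2 3^n is the one of [sparse_weight_term] for the total power p m + 1 of the
    weights and [sg = p * e]. *)
Definition sparse_constant_le1 : R := (2 * 3 ^+ n) `^ (p * e * m%:R - p * m%:R) *
  \prod_i carleson_constant (ps i) `^ (p / ps i).

(** As p <= 1 the power p passes inside the sum. Each term has the dual weights to the power p and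
    [v] to the power 1; over the core [sparse_weight_term] leaves [v] with power 0 and w_i with
    p/p_i. These powers sum to 1, as [carleson_holder] requires. *)
Lemma sparse_bound_le1 : p <= 1 ->
  (\int[mu]_x (sparse_sum x `^ p * v x)%:E <=
    (sparse_constant_le1 * G `^ (p * e) * \prod_i Nf i `^ p)%:E)%E.
Proof.
move=> p1; have vfin := w_finite ord_max; rewrite extend_max in vfin.
have v0 x : 0 <= v x by rewrite ltW// v_gt0.
have mt Q : measurable_fun [set: Rn] (fun x => ((prod_avg Q `^ p)%:E * (v x * \1_(dy Q) x)%:E))%E.
  apply: measurable_funeM; apply/measurable_EFinP; apply: measurable_funM.
    exact: measurable_v.
  by apply: measurable_indic; exact: measurable_dy.
apply: (@le_trans _ _ (\int[mu]_x \sum_(Q <- s)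
    ((prod_avg Q `^ p)%:E * (v x * \1_(dy Q) x)%:E)))%E.
  apply: ge0_le_integral => //.
  - by move=> x _; rewrite lee_fin mulr_ge0 ?powR_ge0.
  - apply/measurable_EFinP; apply: measurable_funM; last exact: measurable_v.
    by apply: measurable_powRc; exact: measurable_sparse_sum.
  - exact: emeasurable_sum.
  - move=> x _; rewrite sumEFin lee_fin.
    apply: (@le_trans _ _ (\sum_(Q <- s) (prod_avg Q * \1_(dy Q) x) `^ p * v x)).
      rewrite -mulr_suml ler_wpM2r//; apply: powR_sum_le => // Q.
      by rewrite mulr_ge0 ?indicE// prod_avg_ge0.
    apply: ler_sum => Q _; rewrite indicE; case: (x \in dy Q).
      by rewrite !mulr1.
    by rewrite !mulr0 powR0 ?mul0r// gt_eqF.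
rewrite ge0_integral_sum//; last first.
  by move=> Q x _; rewrite mule_ge0 ?lee_fin ?powR_ge0// mulr_ge0// indicE.
pose th i := p / ps i.
have th0 i : 0 < th i by rewrite divr_gt0// ps_gt0.
have th1 : \sum_i th i = 1.
  have -> : \sum_i th i = p * \sum_(i < m) 1 / ps i.
    by rewrite mulr_sumr; apply: eq_bigr => i _; rewrite mulrA mulr1.
  by rewrite -pE mulrA mulr1 divff// gt_eqF.
pose a := extend (fun=> p) (1 : R) : 'I_m.+1 -> R.
have sum_a : \sum_k a k = p * m%:R + 1.
  rewrite big_ord_recr /= /a extend_max; under eq_bigr do rewrite extend_widen.
  by rewrite sumr_const card_ord mulr_natr.
have key Q : Q \in s -> prod_avg Q `^ p * wint v (dy Q) <=
    (2 * 3 ^+ n) `^ (p * e * m%:R - p * m%:R) * G `^ (p * e) *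
    \prod_i (weighted_avg i Q `^ p * wint (w (widen_ord (leqnSn m) i)) (E Q) `^ th i).
  move=> Qs; apply: (@le_trans _ _ (prod_avg Q `^ p * wint v (tri Q))).
    rewrite ler_wpM2l ?powR_ge0// -lee_fin -!(wintE measurable_v v0 (vfin Q))//.
    + apply: integral_subset => //; [exact: measurable_dy|exact: measurable_tri|exact: measurable_v|].
      exact: dy_sub_tri.
    + exact: measurable_tri.
    + exact: measurable_dy.
    + exact: dy_sub_tri.
  have m0 : (0 < m%:R :> R) by rewrite ltr0n.
  have pe0 : 0 <= p * e by rewrite mulr_ge0// ltW// e_gt0.
  have ale k : a k <= p * e * q k.
    rewrite -mulrA /a /extend; have := e_q_ge1 k; rewrite /extend.
    case: unlift => [i|] H; first by rewrite ler_peMr// ltW.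
    by rewrite (_ : p * _ = e) ?e_ge1//; field; rewrite gt_eqF.
  have asum : \sum_k a k <= 1 + p * e * m%:R.
    rewrite sum_a addrC lerD2l ler_wpM2r// ler_peMr ?e_ge1//; exact: ltW.
  have := sparse_weight_term m0 q_gt0 sum_q finite_weight_w w_dual w_joint Qs pe0 ale asum.
  have -> : 1 + p * e * m%:R - \sum_k a k = p * e * m%:R - p * m%:R by rewrite sum_a; ring.
  have aw i : a (widen_ord (leqnSn m) i) = p by exact: extend_widen.
  have am : a ord_max = 1 by exact: extend_max.
  have qw i : q (widen_ord (leqnSn m) i) = 1 - 1 / ps i.
    by rewrite extend_widen conj_inv.
  have wm : w ord_max = v by exact: extend_max.
  have qm : q ord_max = 1 / p by exact: extend_max.
  clearbody a; rewrite [X in _ * X <= _ -> _]big_ord_recr [X in _ <= _ * X -> _]big_ord_recr /=.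
  rewrite wm qm am sum_a powRr1; last first.
    by rewrite divr_ge0 ?wint_ge0// ltW// volume_gt0.
  rewrite (_ : 1 + 1 / p * (1 - (p * m%:R + 1)) / m%:R = 0); last by field; rewrite !gt_eqF.
  rewrite powRr0 mulr1.
  rewrite (eq_bigr (fun i => (wint (w (widen_ord (leqnSn m) i)) (tri Q) /
    (3 * side Q.1) ^+ n) `^ p)) => [|i _]; last by rewrite aw.
  rewrite [X in _ <= _ * X -> _](eq_bigr (fun i =>
    wint (w (widen_ord (leqnSn m) i)) (E Q) `^ th i)) => [|i _]; last first.
    by rewrite aw qw; congr powR; rewrite /th; field; rewrite !gt_eqF ?ps_gt0.
  move=> H.
  have A0 : 0 <= \prod_i weighted_avg i Q `^ p.
    by apply: prodr_ge0 => i _; rewrite powR_ge0.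
  have := ler_wpM2l A0 H; congr (_ <= _); last by rewrite big_split/=; ring.
  rewrite (prod_avgE Qs) powR_prod_seq; last first.
    move=> i; rewrite mulr_ge0 ?weighted_avg_ge0// divr_ge0 ?(ltW (volume_gt0 _))//.
    exact/ltW/wint_tri_gt0.
  under [in RHS]eq_bigr => i _.
    rewrite powRM ?weighted_avg_ge0//; last first.
      by rewrite divr_ge0 ?(ltW (volume_gt0 _))//; exact/ltW/wint_tri_gt0.
    over.
  rewrite big_split /=; field.
  by rewrite gt_eqF// ?side_gt0// volume_gt0.
apply: (@le_trans _ _ (\sum_(Q <- s) (prod_avg Q `^ p * wint v (dy Q))%:E)%E).
  rewrite le_eqVlt; apply/orP; left; apply/eqP; apply: eq_bigr => Q _.
  rewrite ge0_integralZl//; last 3 first.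
  - apply/measurable_EFinP; apply: measurable_funM; first exact: measurable_v.
    by apply: measurable_indic; exact: measurable_dy.
  - by move=> x _; rewrite lee_fin mulr_ge0// indicE.
  - by rewrite lee_fin powR_ge0.
  rewrite -integral_indicM EFinM (wintE measurable_v v0 (vfin Q))//.
    exact: measurable_dy.
  exact: dy_sub_tri.
rewrite sumEFin lee_fin.
set B := (2 * 3 ^+ n) `^ _ * _ in key.
apply: (@le_trans _ _ (\sum_(Q <- s) B * \prod_i (weighted_avg i Q `^ p *
   wint (w (widen_ord (leqnSn m) i)) (E Q) `^ th i))).
  by rewrite big_seq [leRHS]big_seq; apply: ler_sum => Q; exact: key.
rewrite -mulr_sumr.
have := @carleson_holder _ th (fun i => carleson_constant (ps i) * Nf i `^ ps i)
  weighted_avg (fun i Q => wint (w (widen_ord (leqnSn m) i)) (E Q)) p th0 th1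
  weighted_avg_ge0.
move=> /(_ _ _)/[dup] _ H.
apply: le_trans (ler_wpM2l _ (H _ _)) _.
- by rewrite mulr_ge0 ?powR_ge0.
- by move=> k Q; apply: wint_ge0 => x; rewrite ltW// w_gt0.
- move=> i; have -> : p / th i = ps i by rewrite /th; field; rewrite !gt_eqF ?ps_gt0.
  exact: carleson_f.
- rewrite /B /sparse_constant_le1 le_eqVlt; apply/orP; left; apply/eqP.
  rewrite (eq_bigr (fun i => carleson_constant (ps i) `^ (p / ps i) * Nf i `^ p)).
    by rewrite big_split/=; ring.
  move=> i _; rewrite powRM ?powR_ge0//; last exact/ltW/carleson_constant_gt0.
  by rewrite -powRrM /th; congr (_ * _ `^ _); field; rewrite gt_eqF ?ps_gt0.
Qed.

Lemma sparse_sum_bounded x : sparse_sum x <= \sum_(Q <- s) prod_avg Q.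
Proof.
by apply: ler_sum => Q _; rewrite ler_piMr ?prod_avg_ge0// indicE; case: (x \in _).
Qed.

Lemma sparse_sum_power_le (r : R) x : 0 < r -> sparse_sum x `^ r <=
  (\sum_(Q <- s) prod_avg Q) `^ r * \sum_(Q <- s) \1_(dy Q) x.
Proof.
move=> r0.
have [/hasP[Q Qs /asboolP Qx]|/hasPn nQ] := boolP (has (fun Q => `[< dy Q x >]) s).
  apply: (@le_trans _ _ ((\sum_(Q <- s) prod_avg Q) `^ r)).
    apply: ge0_ler_powR; rewrite ?nnegrE ?(ltW r0) ?sparse_sum_ge0 ?sparse_sum_bounded//.
    by apply: sumr_ge0 => P _; exact: prod_avg_ge0.
  rewrite ler_peMr ?powR_ge0// (bigD1_seq Q)//= indicE mem_set// lerDl.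
  by apply: sumr_ge0 => P _; rewrite indicE.
rewrite (_ : sparse_sum x = 0).
  by rewrite powR0 ?gt_eqF// mulr_ge0 ?powR_ge0// sumr_ge0// => Q _; rewrite indicE.
rewrite /sparse_sum big_seq big1// => Q /nQ /asboolPn nQx.
by rewrite indicE memNset// mulr0.
Qed.

(** The last index carries the conjugate exponent of p, since its function is the sparse sum to the
    power p - 1 times [v]. *)
Definition sparse_weight_constant (k : 'I_m.+1) : R :=
  carleson_constant (extend ps (p / (p - 1)) k) `^ (1 - q k).

Definition sparse_constant_gt1 : R := (2 * 3 ^+ n) `^ (e * m%:R - m%:R) *
  \prod_k sparse_weight_constant k.

(** A finite sparse sum is bounded, so its power times [v] has finite mass on triples and may enter
    the Carleson embedding. *)
Lemma sparse_power_lty (r : R) B : 0 < r -> measurable B ->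
  (\int[mu]_(x in B) (v x)%:E < +oo)%E ->
  (\int[mu]_(x in B) (sparse_sum x `^ r * v x)%:E < +oo)%E.
Proof.
move=> r0 mB vB; have v0 x : 0 <= v x by rewrite ltW// v_gt0.
pose M := (\sum_(Q <- s) prod_avg Q) `^ r * \sum_(Q <- s) 1.
have M0 : 0 <= M by rewrite mulr_ge0 ?powR_ge0// sumr_ge0.
apply: (@le_lt_trans _ _ (\int[mu]_(x in B) (M%:E * (v x)%:E))%E).
  apply: ge0_le_integral => //.
  - by move=> x _; rewrite lee_fin mulr_ge0 ?powR_ge0.
  - apply: measurable_funTS; apply/measurable_EFinP.
    apply: measurable_funM; last exact: measurable_v.
    by apply: measurable_powRc; exact: measurable_sparse_sum.
  - apply: measurable_funeM; apply: measurable_funTS; apply/measurable_EFinP.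
    exact: measurable_v.
  - move=> x _; rewrite -EFinM lee_fin ler_wpM2r//.
    apply: le_trans (sparse_sum_power_le x r0) _; rewrite ler_wpM2l ?powR_ge0//.
    by apply: ler_sum => Q _; rewrite indicE; case: (x \in _).
rewrite ge0_integralZl//; last 2 first.
- by apply: measurable_funTS; apply/measurable_EFinP; exact: measurable_v.
- by move=> x _; rewrite lee_fin.
by rewrite lte_mul_pinfty ?lee_fin.
Qed.

(** With S the sparse sum and g = S^(p - 1) v, the integral J of S^p v is the sum of [prod_avg Q]
    times the g-mass of Q. Thus g plays the part of a further function with weight v and exponent
    p'. All m + 1 weights enter with power 1 and keep 1 - q_k over the core; these powers sum to 1.
    The result is J <= D J^(1 - 1/p), with J finite. *)
Lemma sparse_bound_gt1 : 1 < p ->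
  (\int[mu]_x (sparse_sum x `^ p * v x)%:E <=
    ((sparse_constant_gt1 * G `^ e * \prod_i Nf i) `^ p)%:E)%E.
Proof.
move=> p1; have vfin := w_finite ord_max; rewrite extend_max in vfin.
have v0 x : 0 <= v x by rewrite ltW// v_gt0.
have p10 : 0 < p - 1 by rewrite subr_gt0.
have m0 : (0 < m%:R :> R) by rewrite ltr0n.
pose g x := sparse_sum x `^ (p - 1) * v x.
have g0 x : 0 <= g x by rewrite mulr_ge0 ?powR_ge0.
have mg : measurable_fun setT g.
  apply: measurable_funM; last exact: measurable_v.
  by apply: measurable_powRc; exact: measurable_sparse_sum.
have gfin Q : (\int[mu]_(x in tri Q) (g x)%:E < +oo)%E.
  by apply: sparse_power_lty => //; exact: measurable_tri.
have mgI Q : measurable_fun [set: Rn] (fun x => (g x * \1_(dy Q) x)%:E).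
  apply/measurable_EFinP; apply: measurable_funM => //.
  by apply: measurable_indic; exact: measurable_dy.
have JE : (\int[mu]_x (sparse_sum x `^ p * v x)%:E =
    (\sum_(Q <- s) prod_avg Q * wint g (dy Q))%:E)%E.
  rewrite (eq_integral (fun x => \sum_(Q <- s) ((prod_avg Q)%:E * (g x * \1_(dy Q) x)%:E)))%E;
      last first.
    move=> x _; rewrite sumEFin; congr EFin.
    have -> : sparse_sum x `^ p * v x = sparse_sum x * g x.
      by rewrite /g mulrA mulr_powRB1// sparse_sum_ge0.
    by rewrite {1}/sparse_sum mulr_suml; apply: eq_bigr => Q _; ring.
  rewrite ge0_integral_sum//; last 2 first.
  - by move=> Q; exact: measurable_funeM.
  - move=> Q x _; rewrite mule_ge0 ?lee_fin ?prod_avg_ge0//.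
    by rewrite mulr_ge0// indicE.
  rewrite -sumEFin; apply: eq_bigr => Q _.
  rewrite ge0_integralZl ?lee_fin ?prod_avg_ge0//; last first.
    by move=> x _; rewrite lee_fin mulr_ge0// indicE.
  rewrite -integral_indicM EFinM (wintE mg g0 (gfin Q))//; first exact: measurable_dy.
  exact: dy_sub_tri.
set J := \sum_(Q <- s) prod_avg Q * wint g (dy Q) in JE; rewrite JE lee_fin.
have J0 : 0 <= J.
  by apply: sumr_ge0 => Q _; rewrite mulr_ge0 ?prod_avg_ge0 ?wint_ge0.
pose F := extend (fun i x => `|f i x|) g.
pose r := extend ps (p / (p - 1)).
pose X := extend (fun i => Nf i `^ ps i) J.
pose th k := 1 - q k.
have pcE : p / (p - 1) = 1 / (1 - 1 / p).
  field; rewrite !gt_eqF//.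
have thE k : r k = 1 / th k.
  rewrite /r /th /extend; case: unlift => [i|//].
  by rewrite conj_inv opprB addrCA subrr addr0 !div1r invrK.
have r1 k : 1 < r k.
  apply: (extendP (P := fun z => 1 < z)) => //.
  by rewrite ltr_pdivlMr// mul1r; lra.
have th0 k : 0 < th k.
  have : 0 < 1 / th k by rewrite -thE; apply: lt_trans (r1 k).
  by rewrite div1r invr_gt0.
have th1 : \sum_k th k = 1.
  rewrite sumrB sum_q sumr_const card_ord -natr1; ring.
have F0 k x : 0 <= F k x.
  by apply: (extendP (P := fun z => 0 <= z x)) => // i; rewrite normr_ge0.
have mF k : measurable_fun setT (F k).
  apply: (extendP (P := fun z => measurable_fun setT z)) => // i.
  exact: absf_measurable.
have Ffin k Q : (\int[mu]_(x in tri Q) (F k x)%:E < +oo)%E.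
  apply: (extendP (P := fun z => (\int[mu]_(x in tri Q) (z x)%:E < +oo)%E)) => // i.
  exact: absf_finite.
(* For the last index, (p - 1) p' = p turns g^p' v^(1 - p') into S^p v, which brings J back on the
   right. *)
have FX k : (\int[mu]_x (F k x `^ r k * w k x `^ (1 - r k))%:E = (X k)%:E)%E.
  rewrite /F /r /X /extend; case: unlift => [i|]; first exact: absf_norm.
  rewrite -JE; apply: eq_integral => x _; congr EFin.
  rewrite /g powRM ?powR_ge0// -mulrA -powRrM.
  rewrite -powRD; last by rewrite (gt_eqF (v_gt0 x)) implybT.
  rewrite (_ : (p - 1) * _ = p); last by field; rewrite gt_eqF.
  by rewrite addrCA subrr addr0 powRr1.
pose A k Q := wint (F k) (tri Q) / wint (w k) (tri Q).
have wge0 k B : 0 <= wint (w k) B by apply: wint_ge0 => x; rewrite ltW// w_gt0.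
have A0 k Q : 0 <= A k Q by rewrite divr_ge0// wint_ge0.
have carl k : \sum_(Q <- s) A k Q `^ (1 / th k) * wint (w k) (E Q) <=
    carleson_constant (r k) * X k.
  rewrite -thE; apply: carleson_real => //; exact: finite_weight_w.
have := carleson_holder th0 th1 A0 (fun k Q => wge0 k (E Q)) carl.
set B := (2 * 3 ^+ n) `^ (e * m%:R - m%:R) * G `^ e.
have B0 : 0 <= B by rewrite mulr_ge0 ?powR_ge0.
have key Q : Q \in s -> prod_avg Q * wint g (dy Q) <=
    B * \prod_k (A k Q `^ 1 * wint (w k) (E Q) `^ th k).
  move=> Qs; apply: (@le_trans _ _ (prod_avg Q * wint g (tri Q))).
    rewrite ler_wpM2l ?prod_avg_ge0// -lee_fin -!(wintE mg g0 (gfin Q))//.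
    + apply: integral_subset => //; [exact: measurable_dy|exact: measurable_tri|].
      exact: dy_sub_tri.
    + exact: measurable_tri.
    + exact: measurable_dy.
    + exact: dy_sub_tri.
  have asum : \sum_(k < m.+1) (1 : R) = m%:R + 1.
    by rewrite sumr_const card_ord natr1.
  have ale k : 1 <= e * q k by exact: e_q_ge1.
  have asum_le : \sum_(k < m.+1) (1 : R) <= 1 + e * m%:R.
    by rewrite asum addrC lerD2l ler_peMl// ?e_ge1// ltW.
  have := sparse_weight_term m0 q_gt0 sum_q finite_weight_w w_dual w_joint Qs
    (ltW e_gt0) ale asum_le.
  rewrite asum (_ : 1 + e * m%:R - (m%:R + 1) = e * m%:R - m%:R); last by ring.
  rewrite -/B [X in _ <= _ * X -> _](eq_bigr (fun k => wint (w k) (E Q) `^ th k));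
      last first.
    move=> k _; congr powR; rewrite /th; move: (q k) => z; field; rewrite gt_eqF//.
  have pA0 : 0 <= \prod_k A k Q by apply: prodr_ge0.
  move=> /(ler_wpM2l pA0); congr (_ <= _).
    have AW k : wint (F k) (tri Q) / (3 * side Q.1) ^+ n =
        A k Q * (wint (w k) (tri Q) / (3 * side Q.1) ^+ n) `^ 1.
      rewrite powRr1; last by rewrite divr_ge0// ltW// volume_gt0.
      rewrite /A; field.
      by rewrite !gt_eqF ?wint_tri_gt0 ?side_gt0 ?volume_gt0.
    rewrite mulrCA -big_split/= -(eq_bigr _ (fun k _ => AW k)) big_ord_recr /=.
    rewrite /F extend_max; under eq_bigr do rewrite extend_widen.
    rewrite -/(prod_avg Q); field; by rewrite gt_eqF// ?side_gt0// volume_gt0.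
  rewrite mulrCA; congr (_ * _); rewrite -big_split/=; apply: eq_bigr => k _.
  by rewrite powRr1.
have JB : J <= B * \sum_(Q <- s) \prod_k (A k Q `^ 1 * wint (w k) (E Q) `^ th k).
  rewrite mulr_sumr /J big_seq [leRHS]big_seq; apply: ler_sum => Q; exact: key.
move=> /(ler_wpM2l B0)/(le_trans JB).
have cge0 k : 0 <= carleson_constant (r k) by rewrite ltW// carleson_constant_gt0.
have X0 k : 0 <= X k.
  by apply: (extendP (P := fun z => 0 <= z)) => // i; rewrite powR_ge0.
rewrite (eq_bigr (fun k => carleson_constant (r k) `^ th k * X k `^ th k)); last first.
  by move=> k _; rewrite powRM.
rewrite big_split/= [X in B * (_ * X)]big_ord_recr /=.
have -> : X ord_max = J by exact: extend_max.
have -> : th ord_max = 1 - 1 / p by rewrite /th extend_max.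
rewrite (eq_bigr Nf); last first.
  move=> i _; rewrite /X /th !extend_widen -powRrM conj_inv.
  rewrite (_ : _ * _ = 1) ?powRr1//; field; by rewrite gt_eqF// ps_gt0.
set D := sparse_constant_gt1 * G `^ e * \prod_i Nf i.
have -> : B * (\prod_k carleson_constant (r k) `^ th k * (\prod_i Nf i * J `^ (1 - 1 / p))) =
    D * J `^ (1 - 1 / p).
  by rewrite /D /sparse_constant_gt1 /B /sparse_weight_constant -/r /th; ring.
have D0 : 0 <= D.
  rewrite /D mulr_ge0 ?prodr_ge0// mulr_ge0 ?powR_ge0// mulr_ge0 ?powR_ge0//.
  by apply: prodr_ge0 => k _; rewrite powR_ge0.
have [->|Jn0] := eqVneq J 0; first by rewrite powR_ge0.
have Jgt0 : 0 < J by rewrite lt_def Jn0.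
rewrite powRB; last by rewrite Jn0 implybT.
rewrite powRr1// mulrCA -[leLHS]mulr1 ler_pM2l// ler_pdivlMr ?powR_gt0// mul1r => JD.
have -> : J = (J `^ (1 / p)) `^ p.
  by rewrite -powRrM (_ : _ * _ = 1) ?powRr1//; field; rewrite gt_eqF.
have JpD : J `^ (1 / p) <= D by rewrite div1r; move: JD; rewrite !(mul1r, div1r).
by apply: ge0_ler_powR; rewrite ?nnegrE ?powR_ge0//; exact: ltW.
Qed.

End sparse_operator.

End sparse_weighted.

(** * The Dini condition and functions with bounded support *)

Section Dini.
Variables (R : realType) (rho : R -> R).
Hypothesis rhoP : modulus_of_continuity rho.

Lemma modulus_ge0 t : 0 <= t -> 0 <= rho t.
Proof.
case: rhoP => _ rho_homo _ rho0 t0.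
by rewrite -rho0; apply: rho_homo; rewrite // in_itv/= ?lexx ?t0.
Qed.

Let integrand t := rho t * ln (1 / t) / t.

Let measurable_integrand : measurable_fun (`]0, 1[%classic : set R) integrand.
Proof.
apply: (@eq_measurable_fun _ _ _ _ _
    (fun t : R => rho t * ln (t `^ (-1)) * t `^ (-1))) => [t|].
  rewrite inE/= in_itv/= => /andP[t0 _].
  by rewrite /integrand powR_inv1 ?ltW// div1r.
apply: measurable_funM; last first.
  by apply: measurable_funTS; exact: (measurable_powR (-1)).
apply: measurable_funM; last first.
  by apply: measurable_funTS; apply: (@measurableT_comp _ _ _ _ _ _ (@ln R)).
have [rho_cont _ _ _] := rhoP.
have m0 : measurable (`[0, +oo[%classic : set R) by exact: measurable_itv.
have := subspace_continuous_measurable_fun m0 rho_cont.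
apply: measurable_funS; first exact: measurable_itv.
by move=> t /=; rewrite !in_itv/= andbT => /andP[/ltW].
Qed.

(** The blocks lie below 1/2, so that [ln (1 / t)] is at least [ln 2] on them. *)
Let block k : set R := `[2 ^- k.+2, 2 ^- k.+1[%classic.

Let blockP k t : block k t = (2 ^- k.+2 <= t < 2 ^- k.+1) :> Prop.
Proof. by rewrite /block/= in_itv. Qed.

Let block_sub k : block k `<=` `]0, 1[%classic.
Proof.
move=> t; rewrite blockP => /andP[t1 t2]; rewrite /= in_itv/=.
rewrite (lt_le_trans _ t1) ?invr_gt0 ?exprn_gt0//=.
by rewrite (lt_le_trans t2)// invf_le1 ?exprn_gt0// exprn_ege1// ler1n.
Qed.

Let integrand_ge0 t : `]0, 1[%classic t -> 0 <= integrand t.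
Proof.
rewrite /= in_itv/= => /andP[t0 t1].
rewrite divr_ge0 ?mulr_ge0 ?modulus_ge0 ?ltW//.
by rewrite ln_gt0// div1r invf_gt1.
Qed.

(** On the block [rho] is at least its value at the left end, the logarithm at least ln 2 and 1/t at
    least 2^(k + 1); the length 2^-(k + 2) leaves ln 2 / 2. *)
Let block_le k :
  ((rho (2 ^- k.+2) * (ln 2 / 2))%:E <=
   \int[lebesgue_measure]_(t in block k) (integrand t)%:E)%E.
Proof.
have p0 j : 0 < 2 ^+ j :> R by exact: exprn_gt0.
have mu_block : lebesgue_measure (block k) = (2 ^- k.+2 : R)%:E.
  rewrite lebesgue_measure_itv/= lte_fin ltf_pV2 ?posrE// ltr_eXn2l ?ltr1n//.
  rewrite ltnSn -EFinB; congr EFin; rewrite !exprS; field.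
  by rewrite gt_eqF// p0.
apply: (@le_trans _ _ (\int[lebesgue_measure]_(t in block k)
    (rho (2 ^- k.+2) * ln 2 * 2 ^+ k.+1)%:E)%E).
  rewrite integral_cst//=; last exact: measurable_itv.
  rewrite mu_block -EFinM lee_fin le_eqVlt; apply/orP; left; apply/eqP.
  by rewrite !exprS; field; rewrite gt_eqF// p0.
apply: ge0_le_integral => //.
- exact: measurable_itv.
- by move=> t _; rewrite lee_fin !mulr_ge0 ?modulus_ge0 ?ln_ge0 ?ler1n// ltW// invr_gt0.
- apply/measurable_EFinP.
  have m01 : measurable (`]0, 1[%classic : set R) by exact: measurable_itv.
  exact: measurable_funS m01 (@block_sub k) measurable_integrand.
- move=> t Bt; move: (Bt); rewrite blockP => /andP[t1 t2].
  have t0 : 0 < t by apply: lt_le_trans t1; rewrite invr_gt0.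
  rewrite lee_fin /integrand.
  have rk0 : 0 <= rho (2 ^- k.+2) by rewrite modulus_ge0// ltW// invr_gt0.
  have l20 : 0 <= ln 2 :> R by rewrite ln_ge0// ler1n.
  apply: ler_pM; rewrite ?mulr_ge0//.
  + apply: ler_pM => //.
      have [_ rho_homo _ _] := rhoP.
      by apply: rho_homo; rewrite // in_itv/= andbT ?invr_ge0 ltW.
    rewrite ler_ln ?posrE ?divr_gt0// div1r -[leLHS]invrK lef_pV2 ?posrE ?invr_gt0//.
    rewrite (le_trans (ltW t2))// lef_pV2 ?posrE// exprS ler_peMr//.
    by rewrite exprn_ege1// ler1n.
  + by rewrite -[leLHS]invrK lef_pV2 ?posrE ?invr_gt0// ltW.
Qed.

(** The blocks control [rho] at 2^-2, 2^-3 and so on; its value at 1/2 is added by hand. *)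
Lemma modulus_sum_bounded :
  (\int[lebesgue_measure]_(t in `]0%R, 1%R[) (rho t * ln (1 / t) / t)%:E < +oo)%E ->
  exists2 Cr : R, 0 <= Cr & forall s, \sum_(k < s) rho (2 ^+ k.+1)^-1 <= Cr.
Proof.
move=> Dfin; set D := integral _ _ _ in Dfin.
have D0 : (0 <= D)%E by apply: integral_ge0 => t /integrand_ge0; rewrite lee_fin.
have l2 : 0 < ln 2 / 2 :> R by rewrite divr_gt0// ln_gt0// ltr1n.
have DE : D = (fine D)%:E by rewrite fineK// ge0_fin_numE.
have rho12 : 0 <= rho (2 ^+ 1)^-1 by rewrite modulus_ge0// invr_ge0.
exists (rho (2 ^+ 1)^-1 + fine D / (ln 2 / 2)).
  by rewrite addr_ge0// divr_ge0 ?fine_ge0// ltW.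
case=> [|s].
  by rewrite big_ord0 addr_ge0// divr_ge0 ?fine_ge0// ltW.
rewrite big_ord_recl/= lerD2l ler_pdivlMr// mulr_suml -lee_fin -DE -sumEFin.
apply: (@le_trans _ _ (\sum_(k < s) \int[lebesgue_measure]_(t in block k)
    (integrand t)%:E)%E).
  by apply: lee_sum => k _; exact: block_le.
have mU : measurable (\big[setU/set0]_(k < s) block k).
  by apply: bigsetU_measurable => k _; exact: measurable_itv.
have subU : \big[setU/set0]_(k < s) block k `<=` `]0, 1[%classic.
  by move=> t; rewrite -bigcup_mkord => -[k _]; exact: block_sub.
rewrite -(big_mkord xpredT (fun k =>
  \int[lebesgue_measure]_(t in block k) (integrand t)%:E)%E).
rewrite -ge0_integral_bigsetU.
- rewrite big_mkord; apply: ge0_subset_integral => //.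
    apply/measurable_EFinP; exact: measurable_integrand.
- by move=> k; exact: measurable_itv.
- exact: iota_uniq.
- apply/trivIsetP => i j _ _ ij; rewrite -subset0 => t [].
  rewrite !blockP => /andP[a1 a2] /andP[b1 b2].
  wlog lij : i j ij a1 a2 b1 b2 / (i < j)%N.
    by move=> wl; move: (ij); rewrite neq_ltn => /orP[]; [exact: (wl i j)|
       apply: (wl j i) => //; rewrite eq_sym].
  suff : t < t by rewrite ltxx.
  apply: (lt_le_trans b2); apply: le_trans a1.
  by rewrite lef_pV2 ?posrE ?exprn_gt0// ler_eXn2l ?ltr1n.
- rewrite big_mkord; apply/measurable_EFinP.
  by apply: measurable_funS measurable_integrand.
- by rewrite big_mkord => t /subU /integrand_ge0; rewrite lee_fin.
Qed.

End Dini.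

(** * Bounded functions with compact support *)

Section bounded_support.
Variables (R : realType) (n : nat).
Local Notation mu := (lebesgue_rV R n).

Definition box (M : R) : set 'rV[R]_n :=
  [set x | forall i, `[- M, M]%classic (x ord0 i)].

Lemma compact_box M : compact (box M).
Proof. by apply: (@rV_compact R n (fun=> `[- M, M]%classic)) => i; exact: segment_compact. Qed.

Lemma measurable_box M : measurable (box M).
Proof.
rewrite (_ : box M = \bigcap_(i in [set: 'I_n])
    ((fun x : 'rV[R]_n => x ord0 i) @^-1` `[- M, M]%classic)); last first.
  by apply/seteqP; split => [x bx i _|x bx i]; exact: bx.
apply: fin_bigcap_measurable => // i _.
by rewrite -[X in measurable X]setTI; apply: measurable_coord => //; exact: measurable_itv.
Qed.

Lemma Linfty0_box (f : 'rV[R]_n -> R) : Linfty0 f ->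
  exists N : nat, forall x, ~ box N%:R x -> f x = 0.
Proof.
case=> _ _ cf.
have bound (i : 'I_n) : exists N : nat, forall x, f x != 0 -> `|x ord0 i| <= N%:R.
  have : compact ((fun x : 'rV[R]_n => x ord0 i) @` closure [set x | f x != 0]).
    apply: continuous_compact => //; apply: continuous_subspaceT => x.
    exact: coord_continuous.
  move=> /compact_bounded[M [_ Mb]].
  exists (Num.truncn (Num.max (M + 1) 0)).+1 => x fx.
  apply: (Mb _ _ (x ord0 i)); last by exists x => //; exact: subset_closure.
  by rewrite (@lt_trans _ _ (M + 1)) ?ltrDl// (@le_lt_trans _ _ (Num.max (M + 1) 0)) ?le_max ?lexx// truncnS_gt.
have /choice[g gP] := bound.
exists (\max_i g i)%N => x; apply: contra_notP => /eqP fx i.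
rewrite /= in_itv/= -ler_norml (le_trans (gP i x fx))// ler_nat.
exact: (leq_bigmax i).
Qed.

Lemma box_cube (M l : R) : M < l -> box M `<=` cube (const_mx (- l)) (2 * l).
Proof.
move=> Ml x bx i; have := bx i; rewrite /= in_itv/= mxE; lra.
Qed.

Lemma Linfty0_L1 (f : 'rV[R]_n -> R) : Linfty0 f -> L1 f.
Proof.
move=> Lf; have [N Nf] := Linfty0_box Lf; case: Lf => mf [M fM] _.
have fE : EFin \o f = (EFin \o f) \_ (box N%:R).
  apply/funext => x; rewrite patchE; case: ifPn => //; rewrite notin_setE => /Nf /= ->//.
rewrite /L1 fE; apply/integrable_restrict.
- exact: measurable_box.
- exact: measurableT.
rewrite setTI; apply: measurable_bounded_integrable.
- exact: measurable_box.
- apply: (@le_lt_trans _ _ (mu (cube (const_mx (- N.+1%:R)) (2 * N.+1%:R)))).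
    apply: le_measure; rewrite ?inE; first exact: measurable_box.
      exact: measurable_cube.
    by apply: box_cube; rewrite ltr_nat.
  by rewrite lebesgue_rV_cube ?ltry// mulr_gt0 ?ltr0n.
- exact: measurable_funTS.
- exists M; split; first exact: num_real.
  by move=> y My x _ /=; rewrite (le_trans (fM x))// ltW.
Qed.

Lemma Linfty0_weighted (f v : 'rV[R]_n -> R) (q : R) : 0 < q ->
  Linfty0 f -> weight v -> (\int[mu]_x (`|f x| `^ q * v x)%:E < +oo)%E.
Proof.
move=> q0 Lf [mv v0 vfin]; have [N Nf] := Linfty0_box Lf; case: Lf => mf [M fM] _.
apply: (@le_lt_trans _ _ (\int[mu]_x ((`|M| `^ q * v x) * \1_(box N%:R) x)%:E)%E).
  apply: ge0_le_integral => //.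
  - by move=> x _; rewrite lee_fin mulr_ge0 ?powR_ge0// ltW.
  - apply/measurable_EFinP; apply: measurable_funM => //.
    apply: (@measurableT_comp _ _ _ _ _ _ (@powR R ^~ q)); first exact: measurable_powR.
    exact: measurableT_comp.
  - apply/measurable_EFinP; apply: measurable_funM.
      exact: measurable_funM.
    by apply: measurable_indic; exact: measurable_box.
  - move=> x _; rewrite lee_fin indicE; case: (boolP (x \in _)) => /= [_|].
      rewrite mulr1 ler_wpM2r ?(ltW (v0 _))//.
      by apply: ge0_ler_powR; rewrite ?nnegrE// ?(ltW q0)// (le_trans (fM x))// ler_norm.
    by rewrite notin_setE => /Nf ->; rewrite normr0 powR0 ?gt_eqF// mul0r mulr0.
rewrite -integral_indicM; under eq_integral do rewrite EFinM.
rewrite ge0_integralZl//.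
- by rewrite lte_mul_pinfty// ?lee_fin ?powR_ge0//; apply: vfin; exact: compact_box.
- exact: measurable_box.
- by apply/measurable_EFinP; exact: measurable_funTS.
- by move=> x _; rewrite lee_fin ltW.
Qed.

End bounded_support.

(** * The weighted estimate *)

Section sparse_to_weighted.
Variables (R : realType) (n m : nat).
Local Notation Rn := 'rV[R]_n.
Local Notation mu := (lebesgue_rV R n).
Variables (ps : 'I_m -> R) (p e : R) (vs : 'I_m -> Rn -> R).
Hypotheses (m_gt0 : (0 < m)%N) (ps_gt1 : forall i, 1 < ps i) (p_gt0 : 0 < p).
Hypothesis pE : 1 / p = \sum_(i < m) 1 / ps i.
Hypothesis e_ge : forall i, conjugate_exponent (ps i) <= e.
Hypothesis e_gep : p <= e.
Hypothesis vs_measurable : forall i, measurable_fun [set: Rn] (vs i).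
Hypothesis vs_gt0 : forall i x, 0 < vs i x.

Let v := product_weight ps vs p.
Let w := extend (fun i x => vs i x `^ (- (1 / (ps i - 1)))) v.
Let q := extend (fun i => 1 / conjugate_exponent (ps i)) (1 / p).

(** The root for [p <= 1] is taken because [sparse_bound_le1] has its constant outside the power
    p. *)
Definition sparse_norm_constant : R :=
  if p <= 1 then sparse_constant_le1 n ps p e `^ (1 / p)
  else sparse_constant_gt1 n ps p e.

Lemma sparse_norm_constant_ge0 : 0 <= sparse_norm_constant.
Proof.
rewrite /sparse_norm_constant; case: ifP => _; first exact: powR_ge0.
by rewrite mulr_ge0 ?powR_ge0 ?prodr_ge0// => k _; exact: powR_ge0.
Qed.

Section cube.
Variables (x0 : Rn) (l0 : R) (G : R).
Hypothesis l0_gt0 : 0 < l0.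
Hypothesis w_finite :
  forall k Q, (\int[mu]_(x in tri x0 l0 Q) (w k x)%:E < +oo)%E.
Hypothesis w_joint : forall Q,
  \prod_k (wint (w k) (tri x0 l0 Q) / (3 * side l0 Q.1) ^+ n) `^ q k <= G.
Variables (f : 'I_m -> Rn -> R) (Nf : 'I_m -> R).
Hypothesis fL1 : forall i, L1 (f i).
Hypothesis Nf_ge0 : forall i, 0 <= Nf i.
Hypothesis fN : forall i,
  (\int[mu]_x (`|f i x| `^ ps i * vs i x)%:E)%E = (Nf i `^ ps i)%:E.

Lemma sparse_bound (s : seq (cubeidx n)) (E : cubeidx n -> set Rn) :
  uniq s -> (forall Q, measurable (E Q)) -> (forall Q, E Q `<=` dy x0 l0 Q) ->
  (forall P Q, P \in s -> Q \in s -> E P `&` E Q !=set0 -> P = Q) ->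
  (forall Q, Q \in s -> (mu (dy x0 l0 Q) <= 2%:E * mu (E Q))%E) ->
  (\int[mu]_x (sparse_sum x0 l0 s f x `^ p * v x)%:E <=
   ((sparse_norm_constant * G `^ e * \prod_i Nf i) `^ p)%:E)%E.
Proof.
move=> us mE Ed Ej Eb; rewrite /sparse_norm_constant; case: ifPn => [p1|].
  apply: (le_trans (sparse_bound_le1 l0_gt0 us mE Ed Ej Eb m_gt0 ps_gt1 p_gt0 pE
    e_ge e_gep vs_measurable vs_gt0 w_finite w_joint fL1 fN p1)).
  have c0 : 0 <= sparse_constant_le1 n ps p e.
    by rewrite mulr_ge0 ?powR_ge0 ?prodr_ge0// => k _; exact: powR_ge0.
  move: (sparse_constant_le1 n ps p e) c0 => c c0.
  rewrite lee_fin !powRM ?mulr_ge0 ?powR_ge0 ?prodr_ge0//.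
  by rewrite -!powRrM div1r mulVf ?gt_eqF// powRr1// (mulrC e) powR_prod_seq.
rewrite -ltNge => p1.
exact: (sparse_bound_gt1 l0_gt0 us mE Ed Ej Eb m_gt0 ps_gt1 p_gt0 pE
  e_ge e_gep vs_measurable vs_gt0 w_finite w_joint fL1 Nf_ge0 fN p1).
Qed.

Variables (T : ('I_m -> Rn -> R) -> Rn -> R) (K : Rn -> m.-tuple Rn -> R).
Variables (rho : R -> R) (C Cw Cr : R).
Hypothesis T_multilinear : multilinear T.
Hypothesis mK : measurable_fun [set: Rn * m.-tuple Rn]
  (fun z : Rn * m.-tuple Rn => K z.1 z.2).
Hypothesis T_kernel : associated_kernel T K.
Hypothesis C_ge0 : 0 <= C.
Hypothesis rho_ge0 : forall t, 0 <= t -> 0 <= rho t.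
Hypothesis sizeK : kernel_size K C.
Hypothesis regK : kernel_regularity K rho C.
Hypothesis T_weak : weak_type_bound T Cw.
Hypothesis Cr_ge0 : 0 <= Cr.
Hypothesis rho_sum : forall s : nat, \sum_(k < s) rho (2 ^+ k.+1)^-1 <= Cr.

Let Csp := sparse_constant n m C Cw Cr.

(** The number of terms in [sparse_domination] depends on the point, whereas [sparse_bound] is
    uniform over finite families. The sets where the first N terms suffice increase to almost
    everything, and monotone convergence concludes. *)
Lemma local_op_bound Q0 :
  (\int[mu]_(x in dy x0 l0 Q0) (`|local_op x0 l0 T f Q0 x| `^ p * v x)%:E <=
   ((Csp * sparse_norm_constant * G `^ e * \prod_i Nf i) `^ p)%:E)%E.
Proof.
set g := local_op x0 l0 T f Q0; set P := stopping x0 l0 T Cw f Q0.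
pose S N := sparse_sum x0 l0 (first_terms P N) f.
have Csp0 : 0 <= Csp by exact: sparse_constant_ge0.
have mg : measurable_fun setT g.
  have [+ _ _] := T_multilinear; apply=> i.
  exact: L1_restr (measurable_tri _ _ _) (fL1 i).
have mS N : measurable_fun setT (S N) by exact: measurable_sparse_sum.
have S0 N x : 0 <= S N x by exact: sparse_sum_ge0.
have v0 x : 0 < v x by exact: v_gt0.
have mv : measurable_fun setT v by exact: measurable_v.
have mpow (h : Rn -> R) : measurable_fun setT h ->
    measurable_fun setT (fun x => h x `^ p).
  by move=> mh; apply: (measurableT_comp (measurable_powR p)).
have mdy : measurable (dy x0 l0 Q0) by exact: measurable_dy.
(* The complement of the cube is included so that the sets exhaust the whole space; the integrand
   vanishes there. *)
pose F N := ~` dy x0 l0 Q0 `|` [set x | `|g x| <= Csp * S N x].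
have mF N : measurable (F N).
  apply: measurableU; first exact: measurableC.
  rewrite -[X in measurable X]setTI; apply: measurable_fun_le => //.
    exact: measurableT_comp.
  exact: measurable_funM.
rewrite integral_indicM.
apply: (@ge0_integral_exhaust_le _ _ _ _ _ F).
- apply/measurable_EFinP; apply: measurable_funM; last exact: measurable_indic.
  apply: measurable_funM => //; apply: mpow; exact: measurableT_comp.
- by move=> x; rewrite lee_fin !mulr_ge0 ?powR_ge0// ltW.
- exact: mF.
- move=> N N' NN' x [dx|gx]; first by left.
  right; apply: (le_trans gx); apply: ler_wpM2l => //.
  apply: sum_uniq_sub_le; rewrite ?first_terms_uniq//.
    move=> Q; rewrite !mem_first_terms => /andP[-> /=] /leq_trans; exact.
  move=> Q; rewrite mulr_ge0//; apply: prodr_ge0 => i _.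
  by rewrite divr_ge0 ?mass_ge0// exprn_ge0// mulr_ge0// ltW// side_gt0.
- have := sparse_domination x0 l0_gt0 m_gt0 T_multilinear mK T_kernel C_ge0 rho_ge0
    sizeK regK T_weak rho_sum fL1 Q0.
  apply: filterS => x dom.
  have [dx|ndx] := pselect (dy x0 l0 Q0 x); last by exists 0%N; left.
  by have [N gN] := dom dx; exists N; right.
move=> N; apply: (@le_trans _ _
    (\int[mu]_x ((Csp `^ p)%:E * (S N x `^ p * v x)%:E))%E).
  apply: (@le_trans _ _ (\int[mu]_(x in F N) ((Csp `^ p)%:E * (S N x `^ p * v x)%:E))%E).
    apply: ge0_le_integral => //.
    - by move=> x _; rewrite lee_fin !mulr_ge0 ?powR_ge0// ltW.
    - apply: measurable_funTS; apply/measurable_EFinP.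
      apply: measurable_funM; last exact: measurable_indic.
      apply: measurable_funM => //; apply: mpow; exact: measurableT_comp.
    - apply: measurable_funTS; apply/measurable_EFinP.
      apply: measurable_funM => //; apply: measurable_funM => //; exact: mpow.
    - move=> x Fx; rewrite lee_fin mulrA -powRM// indicE.
      case: Fx => [ndx|gx].
        by rewrite memNset// mulr0 mulr_ge0 ?powR_ge0// ltW.
      apply: (@le_trans _ _ (`|g x| `^ p * v x)).
        by rewrite ler_piMr ?mulr_ge0 ?powR_ge0// ?(ltW (v0 _))//; case: (_ \in _).
      rewrite ler_wpM2r ?(ltW (v0 _))//.
      by apply: ge0_ler_powR; rewrite ?nnegrE ?mulr_ge0// ltW.
  apply: ge0_subset_integral => //.
    apply/measurable_EFinP; apply: measurable_funM => //.
    by apply: measurable_funM => //; exact: mpow.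
  by move=> x _; rewrite lee_fin !mulr_ge0 ?powR_ge0// ltW.
rewrite ge0_integralZl//; first last.
- by rewrite lee_fin powR_ge0.
- by move=> x _; rewrite lee_fin !mulr_ge0 ?powR_ge0// ltW.
- by apply/measurable_EFinP; apply: measurable_funM => //; exact: mpow.
have B0 : 0 <= sparse_norm_constant * G `^ e * \prod_i Nf i.
  by rewrite !mulr_ge0 ?sparse_norm_constant_ge0 ?powR_ge0 ?prodr_ge0.
rewrite -!mulrA (mulrA sparse_norm_constant) (powRM _ Csp0)// EFinM.
apply: lee_wpmul2l; first by rewrite lee_fin powR_ge0.
apply: (sparse_bound (E := core x0 l0 T Cw f)).
- exact: first_terms_uniq.
- move=> Q; exact: measurable_core.
- move=> Q; exact: core_sub.
- move=> A B; rewrite !mem_first_terms => /andP[/asboolP PA _] /andP[/asboolP PB _].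
  exact: core_disjoint PA PB.
- move=> Q _; exact: measure_core.
Qed.

End cube.

End sparse_to_weighted.

(** * Local consequences of a finite joint Muckenhoupt quantity *)

Section joint_Muckenhoupt.
Variables (R : realType) (n : nat).
Local Notation Rn := 'rV[R]_n.
Local Notation mu := (lebesgue_rV R n).

Lemma prode_gt0 k (F : 'I_k -> \bar R) (P : pred 'I_k) :
  (forall i, 0 < F i)%E -> (0 < \prod_(i < k | P i) F i)%E.
Proof. by move=> F0; elim/big_ind : _ => // x y; exact: mule_gt0. Qed.

(** Every mean is strictly positive, so a single infinite one would make the product over that cube,
    hence the supremum, infinite. *)
Lemma joint_Muckenhoupt_finite k (w : 'I_k -> Rn -> R) (q : 'I_k -> R) :
  (forall i, measurable_fun [set: Rn] (w i)) -> (forall i x, 0 < w i x) ->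
  (forall i, 0 < q i) -> (joint_Muckenhoupt w q < +oo)%E ->
  forall (x : Rn) (l : R), 0 < l ->
  (forall i, (\int[mu]_(z in cube x l) (w i z)%:E < +oo)%E) /\
  \prod_i (wint (w i) (cube x l) / l ^+ n) `^ q i <= fine (joint_Muckenhoupt w q).
Proof.
move=> mw w0 q0 Jfin x l l0.
have mu_cube : mu (cube x l) = (l ^+ n)%:E by exact: lebesgue_rV_cube.
have ln0 : 0 < l ^+ n by exact: exprn_gt0.
have PJ : (\prod_(i < k) (mean (w i) (cube x l)) `^ (q i) <= joint_Muckenhoupt w q)%E.
  by apply: ereal_sup_ubound; exists (x, l).
have I0 i : (0 < \int[mu]_(z in cube x l) (w i z)%:E)%E.
  by apply: integral_weight_gt0 => //; [exact: measurable_cube|rewrite mu_cube lte_fin].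
have mean_gt0 i : (0 < mean (w i) (cube x l))%E.
  by rewrite /mean mu_cube/= mule_gt0// lte_fin invr_gt0.
have pow_gt0 i : (0 < mean (w i) (cube x l) `^ q i)%E.
  by apply: poweR_gt0.
have Ifin i : (\int[mu]_(z in cube x l) (w i z)%:E < +oo)%E.
  rewrite ltey; apply/eqP => Ioo.
  have : (\prod_(i < k) (mean (w i) (cube x l)) `^ (q i) < +oo)%E.
    exact: le_lt_trans PJ Jfin.
  have moo : mean (w i) (cube x l) = +oo%E.
    by rewrite /mean Ioo mu_cube/= gt0_muley// lte_fin invr_gt0.
  rewrite (bigD1 i)//= moo poweRyr ?gt_eqF// gt0_mulye ?ltxx//.
  by apply: prode_gt0 => j; exact: pow_gt0.
split=> //.
have J0 : (0 <= joint_Muckenhoupt w q)%E.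
  by apply: le_trans PJ; apply: prode_ge0 => i _; exact: poweR_ge0.
rewrite -lee_fin fineK ?ge0_fin_numE//; apply: le_trans PJ.
rewrite -prodEFin le_eqVlt; apply/orP; left; apply/eqP.
apply: eq_bigr => i _; rewrite -poweR_EFin; congr poweR.
by rewrite /mean mu_cube /wint EFinM fineK ?ge0_fin_numE ?(ltW (I0 i))// muleC.
Qed.

End joint_Muckenhoupt.

Section exhaustion.
Variables (R : realType) (n : nat).

Definition root_cube : cubeidx n := (0%N, [ffun=> 0]).

Lemma dy_root (x0 : 'rV[R]_n) (l0 : R) : dy x0 l0 root_cube = cube x0 l0.
Proof.
rewrite /dy /side expr0 divr1; congr cube; apply/rowP => i.
by rewrite mxE /= ffunE addr0 mulr0 addr0.
Qed.

Lemma box_dy (M l : R) : M < l ->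
  @box R n M `<=` dy (const_mx (- l)) (2 * l) root_cube.
Proof. by rewrite dy_root; exact: box_cube. Qed.

Lemma rV_in_box (x : 'rV[R]_n) : exists N : nat, box N%:R x.
Proof.
exists (\max_i (Num.truncn `|x ord0 i|).+1)%N => i.
rewrite /= in_itv/= -ler_norml (le_trans (ltW (truncnS_gt _)))// ler_nat.
exact: (leq_bigmax i).
Qed.

Lemma le_box (M N : R) : M <= N -> @box R n M `<=` box N.
Proof. by move=> MN x bx i; have := bx i; rewrite /= !in_itv/=; lra. Qed.

End exhaustion.

Lemma kernel_size_le (R : realType) n m (K : 'rV[R]_n -> m.-tuple 'rV[R]_n -> R) C C' :
  C <= C' -> kernel_size K C -> kernel_size K C'.
Proof.
move=> CC' sK x y xy; apply: (le_trans (sK x y xy)).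
rewrite ler_wpM2r// invr_ge0 exprn_ge0//.
by elim/big_ind : _ => // [a b a0 b0|i _]; [rewrite le_max a0|exact: sqrtr_ge0].
Qed.

Lemma kernel_regularity_le (R : realType) n m
    (K : 'rV[R]_n -> m.-tuple 'rV[R]_n -> R) rho C C' :
  (forall t, 0 <= t -> 0 <= rho t) ->
  C <= C' -> kernel_regularity K rho C -> kernel_regularity K rho C'.
Proof.
move=> rho0 CC' rK a l x' x'' t y l0 ax' ax'' t2 ty.
apply: (le_trans (rK a l x' x'' t y l0 ax' ax'' t2 ty)).
have t0 : 0 <= t by lra.
by rewrite ler_wpM2r ?rho0 ?invr_ge0// ler_wpM2r// invr_ge0 exprn_ge0// mulr_ge0// ltW.
Qed.

Section weighted_estimate.
Variables (R : realType) (n m : nat).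
Local Notation Rn := 'rV[R]_n.
Local Notation mu := (lebesgue_rV R n).
Variables (T : ('I_m -> Rn -> R) -> Rn -> R) (rho : R -> R).
Variables (ps : 'I_m -> R) (p e : R).
Hypotheses (m_gt0 : (0 < m)%N) (ps_gt1 : forall i, 1 < ps i) (p_gt0 : 0 < p).
Hypothesis pE : 1 / p = \sum_(i < m) 1 / ps i.
Hypothesis e_ge : forall i, conjugate_exponent (ps i) <= e.
Hypothesis e_gep : p <= e.
Hypothesis T_CZ : Calderon_Zygmund T rho.
Hypothesis rho_Dini : (\int[lebesgue_measure]_(t in `]0%R, 1%R[)
  (rho t * ln (1 / t) / t)%:E < +oo)%E.

(** Cubes centered at the origin and containing all supports exhaust the space. On each of them
    [T f] is its own localization, and the constant of [local_op_bound] depends neither on the cube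
    nor on its lattice. *)
Lemma weighted_estimate : exists2 C : R, 0 < C &
  forall vs : 'I_m -> Rn -> R, (forall i, weight (vs i)) ->
  let v := product_weight ps vs p in
  let w := extend (fun i x => vs i x `^ (- (1 / (ps i - 1)))) v in
  let q := extend (fun i => 1 / conjugate_exponent (ps i)) (1 / p) in
  (joint_Muckenhoupt w q < +oo)%E ->
  forall f, (forall i, Linfty0 (f i)) ->
  (weighted_norm p v (T f) <= (C * fine (joint_Muckenhoupt w q) `^ e)%:E *
     \prod_(i < m) weighted_norm (ps i) (vs i) (f i))%E.
Proof.
have [T_multilinear rhoP [K [mK T_kernel [C' [sK' rK']]]] [Cw T_weak]] := T_CZ.
have rho_ge0 := modulus_ge0 rhoP.
have [Cr Cr0 rho_sum] := modulus_sum_bounded rhoP rho_Dini.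
pose C := Num.max C' 0.
have C0 : 0 <= C by rewrite le_max lexx orbT.
have C'C : C' <= C by rewrite le_max lexx.
have sK := kernel_size_le C'C sK'.
have rK := kernel_regularity_le rho_ge0 C'C rK'.
pose D := sparse_constant n m C Cw Cr * sparse_norm_constant n ps p e.
have D0 : 0 <= D by rewrite mulr_ge0 ?sparse_norm_constant_ge0// sparse_constant_ge0.
(* [D] might be 0; the constant has to be positive. *)
exists (D + 1); first by rewrite ltr_wpDl.
move=> vs vsW v w q Jfin f Lf.
have mvs i : measurable_fun setT (vs i) by have [] := vsW i.
have vs0 i x : 0 < vs i x by have [] := vsW i.
have ps0 i : 0 < ps i by rewrite (lt_trans ltr01).
set G := fine (joint_Muckenhoupt w q).
have w0 k x : 0 < w k x by exact: w_gt0.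
have mw k : measurable_fun setT (w k) by exact: measurable_w.
have q0 k : 0 < q k by exact: q_gt0.
have wG := joint_Muckenhoupt_finite mw w0 q0 Jfin.
have fL1 i : L1 (f i) by exact: Linfty0_L1.
pose I i := (\int[mu]_x (`|f i x| `^ ps i * vs i x)%:E)%E.
have Ioo i : (I i < +oo)%E by exact: Linfty0_weighted.
have I0 i : (0 <= I i)%E.
  by apply: integral_ge0 => x _; rewrite lee_fin mulr_ge0 ?powR_ge0// ltW.
pose Nf i := fine (I i) `^ (ps i)^-1.
have fN i : I i = (Nf i `^ ps i)%:E.
  rewrite /Nf -powRrM mulVf ?gt_eqF// powRr1 ?fine_ge0//.
  by rewrite fineK// ge0_fin_numE.
have Nf0 i : 0 <= Nf i by exact: powR_ge0.
have normE i : weighted_norm (ps i) (vs i) (f i) = (Nf i)%:E.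
  rewrite /weighted_norm -/(I i) fN poweR_EFin -powRrM mulfV ?gt_eqF//.
  by rewrite powRr1.
under eq_bigr do rewrite normE.
rewrite prodEFin -EFinM.
have X0 : 0 <= D * G `^ e * \prod_i Nf i.
  by rewrite mulr_ge0 ?prodr_ge0// mulr_ge0 ?powR_ge0.
suff main : (\int[mu]_x (`|T f x| `^ p * v x)%:E <=
    ((D * G `^ e * \prod_i Nf i) `^ p)%:E)%E.
  apply: (@le_trans _ _ (D * G `^ e * \prod_i Nf i)%:E); last first.
    by rewrite lee_fin !ler_wpM2r ?powR_ge0 ?prodr_ge0// lerDl.
  have -> : (D * G `^ e * \prod_i Nf i)%:E =
      (((D * G `^ e * \prod_i Nf i) `^ p)%:E `^ p^-1)%E.
    by rewrite poweR_EFin -powRrM mulfV ?gt_eqF// powRr1.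
  apply: gt0_ler_poweR => //; first by rewrite invr_ge0 ltW.
    rewrite in_itv/= leey andbT; apply: integral_ge0 => x _.
    by rewrite lee_fin mulr_ge0 ?powR_ge0// ltW// v_gt0.
  by rewrite in_itv/= leey andbT lee_fin powR_ge0.
have [N Nsupp] : exists N : nat, forall i x, ~ box N%:R x -> f i x = 0.
  have /choice[g gP] := fun i => Linfty0_box (Lf i).
  exists (\max_i g i)%N => i x bx; apply: gP; apply: contra_not bx.
  by apply: le_box; rewrite ler_nat; exact: (leq_bigmax i).
pose l k : R := (N + k).+1%:R.
have l0 k : 0 < l k by rewrite ltr0n.
pose F k := dy (const_mx (- l k)) (2 * l k) (root_cube n).
apply: (@ge0_integral_exhaust_le _ _ _ _ _ F).
- apply/measurable_EFinP; apply: measurable_funM; last exact: measurable_v.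
  apply: (measurableT_comp (measurable_powR p)); apply: measurableT_comp => //.
  by have [+ _ _] := T_multilinear; exact.
- by move=> x; rewrite lee_fin mulr_ge0 ?powR_ge0// ltW// v_gt0.
- by move=> k; exact: measurable_dy.
- move=> j k jk x; rewrite /F !dy_root => Fx i.
  have : l j <= l k by rewrite ler_nat ltnS leq_add2l.
  have := Fx i; rewrite !mxE; lra.
- apply: aeW => x; have [k bx] := rV_in_box x; exists k.
  by apply: box_dy bx; rewrite ltr_nat ltnS leq_addl.
move=> k.
have localE : T f = local_op (const_mx (- l k)) (2 * l k) T f (root_cube n).
  rewrite /local_op; congr T; apply/funext => i; apply/funext => x.
  have [bx|nbx] := pselect (box N%:R x).
    rewrite restr_in//; apply: dy_sub_tri; first by rewrite mulr_gt0.
    by apply: box_dy bx; rewrite ltr_nat ltnS leq_addr.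
  by rewrite /restr Nsupp// mul0r.
have l20 : 0 < 2 * l k by rewrite mulr_gt0.
have tri0 (Q : cubeidx n) : 0 < 3 * side (2 * l k) Q.1 by rewrite mulr_gt0// side_gt0.
rewrite localE.
exact: (local_op_bound m_gt0 ps_gt1 p_gt0 pE e_ge e_gep mvs vs0 l20
  (fun j Q => (wG _ _ (tri0 Q)).1 j) (fun Q => (wG _ _ (tri0 Q)).2) fL1 Nf0 fN
  T_multilinear mK T_kernel C0 rho_ge0 sK rK T_weak Cr0 rho_sum).
Qed.

End weighted_estimate.

Lemma joint_Muckenhoupt_extend (R : realType) (n m : nat) (ps : 'I_m -> R)
    (vs : 'I_m -> 'rV[R]_n -> R) (v : 'rV[R]_n -> R) (p : R) :
  (forall i, 1 < ps i) ->
  joint_Muckenhoupt (extend (fun i x => vs i x `^ (- (1 / (ps i - 1)))) v)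
    (extend (fun i => 1 / conjugate_exponent (ps i)) (1 / p)) =
  ereal_sup
    [set (mean v (cube c.1 c.2) `^ (1 / p) *
          \prod_(i < m)
            mean (fun x => (vs i x `^ (- (conjugate_exponent (ps i) / ps i)))%R)
                 (cube c.1 c.2) `^ (1 / conjugate_exponent (ps i)))%E
    | c in [set c : 'rV[R]_n * R | 0 < c.2]].
Proof.
move=> ps1; congr ereal_sup; apply: eq_imagel => c _.
rewrite big_ord_recr/= !extend_max muleC; congr (_ * _)%E.
apply: eq_bigr => i _; rewrite !extend_widen.
rewrite (_ : conjugate_exponent (ps i) / ps i = 1 / (ps i - 1))//.
rewrite /conjugate_exponent; field.
by rewrite !gt_eqF// ?subr_gt0// (lt_trans ltr01).
Qed.

Theorem theorem17p1 (R : realType) (n m : nat) (n_gt0 : (0 < n)%N)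
    (m_gt0 : (0 < m)%N)
    (T : ('I_m -> 'rV[R]_n -> R) -> 'rV[R]_n -> R) (rho : R -> R)
    (T_CZ : Calderon_Zygmund T rho)
    (rho_Dini : (\int[lebesgue_measure]_(t in `]0%R, 1%R[)
                   (rho t * ln (1 / t) / t)%:E < +oo)%E)
    (ps : 'I_m -> R) (ps_gt1 : forall i, 1 < ps i)
    (p : R) (p_gt0 : 0 < p) (pE : 1 / p = \sum_(i < m) 1 / ps i) :
  exists C : R, 0 < C /\
  forall vs : 'I_m -> 'rV[R]_n -> R, (forall i, weight (vs i)) ->
  let v := product_weight ps vs p in
  let w := extend (fun i x => vs i x `^ (- (1 / (ps i - 1)))) v in
  let q := extend (fun i => 1 / conjugate_exponent (ps i)) (1 / p) in
  let e := \big[Num.max/p]_(i < m) conjugate_exponent (ps i) in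
  let B := ereal_sup
    [set (mean v (cube c.1 c.2) `^ (1 / p) *
          \prod_(i < m)
            mean (fun x => (vs i x `^ (- (conjugate_exponent (ps i) / ps i)))%R)
                 (cube c.1 c.2) `^ (1 / conjugate_exponent (ps i)))%E
    | c in [set c : 'rV[R]_n * R | 0 < c.2]] in
  (operator_norm T ps vs p v <= C%:E * joint_Muckenhoupt w q `^ e)%E /\
  (C%:E * joint_Muckenhoupt w q `^ e = C%:E * B `^ e)%E.
Proof.
pose e := \big[Num.max/p]_(i < m) conjugate_exponent (ps i).
have e_ge i : conjugate_exponent (ps i) <= e.
  by rewrite /e (bigD1 i)//= le_max lexx.
have e_gep : p <= e by exact: bigmax_ge_id.
have e_gt0 : 0 < e by exact: lt_le_trans e_gep.
have [C C0 CP] := weighted_estimate m_gt0 ps_gt1 p_gt0 pE e_ge e_gep T_CZ rho_Dini.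
exists C; split=> // vs vsW v w q e' B; split; last first.
  by rewrite /B -joint_Muckenhoupt_extend.
(* As [e] and [C] are positive, an infinite quantity makes the right side infinite. *)
have [Joo|] := eqVneq (joint_Muckenhoupt w q) +oo%E.
  by rewrite Joo poweRyr ?gt_eqF// gt0_muley ?lte_fin// leey.
rewrite -ltey => Jfin.
have J0 : (0 <= joint_Muckenhoupt w q)%E.
  apply: (@le_trans _ _ (\prod_k (mean (w k) (cube 0 1)) `^ (q k))%E).
    by apply: prode_ge0 => k _; exact: poweR_ge0.
  by apply: ereal_sup_ubound; exists (0, 1) => //=; rewrite ltr01.
rewrite -[X in (_ * X `^ _)%E]fineK ?ge0_fin_numE// poweR_EFin -EFinM.
apply: ereal_inf_lbound; exists (C * fine (joint_Muckenhoupt w q) `^ e) => //.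
split; first by rewrite mulr_ge0 ?powR_ge0// ltW.
by move=> f Lf; exact: CP.
Qed.
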